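(* Let $N=2$ and let $S^-\subset\mathbb R^2$ be a domain bounded by a Lyapunov curve $S$ with external unit normal $n$. Then $$\mathrm{V.P.}\int_{S_t(x)}\frac{1}{\sqrt{1-(r/ct)^2}}\,\frac{\partial}{\partial n(y)}\left(\ln\frac1r\right)dS(y)+\frac1c\frac{\partial}{\partial t}\int_{S_t^-(x)}\frac{dV(y)}{\sqrt{c^2t^2-r^2}}=2\pi H_S^-(x)H(t),$$ where the integral in the principal value sense is taken for boundary points $x\in S$.
   Context: $c>0$ is a constant; $x\in\mathbb R^2$; $r=\|x-y\|$; $S_t(x)=\{y\in S:\ r<ct\}$; $S_t^-(x)=\{y\in S^-:\ r<ct\}$; $dS(y)$ is the arc length differential, $dV(y)=dy_1dy_2$; $\partial/\partial n(y)$ is the derivative in $y$ along $n(y)$. $H_S^-(x)$ equals $1$ on $S^-$, $1/2$ on $S$, $0$ elsewhere; $H$ is the Heaviside function with $H(0)=1/2$. V.P. denotes the principal value.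
   Formalization: The V.P. term is taken with a minus sign (with the plus sign the identity fails, e.g. at the centre of a disc); the left side is shown to exist for almost every t, and the identity is proved at every t at which it exists. *)

(* Defs.v *)
From HB Require Import structures.
From mathcomp Require Import all_boot all_order all_algebra.
From mathcomp Require Import all_classical all_reals all_analysis.

Set Implicit Arguments.
Unset Strict Implicit.
Unset Printing Implicit Defensive.

Import Order.TTheory GRing.Theory Num.Theory.
Import numFieldTopology.Exports numFieldNormedType.Exports.

Local Open Scope classical_set_scope.
Local Open Scope ring_scope.

(* The library norm on [R * R] is the sup norm: it is used only through the
   topology it induces.  Lengths and angles are Euclidean. *)
Definition dotp (R : realType) (u v : R * R) : R := u.1 * v.1 + u.2 * v.2.

Definition enorm (R : realType) (u : R * R) : R := Num.sqrt (dotp u u).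

Definition edist (R : realType) (x y : R * R) : R := enorm (x - y).

(* A simple closed curve of length L, parametrized by arc length and extended
   L-periodically to the line, whose unit tangent is Hoelder continuous. *)
Definition lyapunov_curve (R : realType) (L : R) (gamma : R -> R * R) : Prop :=
  [/\ 0 < L,
      forall s, gamma (s + L) = gamma s,
      {in `[0, L[ &, injective gamma},
      forall s, derivable gamma s 1 /\ enorm (derive1 gamma s) = 1
    & exists K a : R, [/\ 0 < a, a <= 1 &
        forall s s' : R,
          enorm (derive1 gamma s - derive1 gamma s') <= K * `|s - s'| `^ a]].

Definition curve_set (R : realType) (gamma : R -> R * R) : set (R * R) :=
  range gamma.

Definition domain_bounded_by (R : realType) (Sm S : set (R * R)) : Prop :=
  [/\ open Sm, connected Sm, bounded_set Sm & closure Sm `\` interior Sm = S].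

Definition external_unit_normal (R : realType) (gamma : R -> R * R)
    (Sm : set (R * R)) (n : R * R -> R * R) : Prop :=
  forall s : R,
    [/\ enorm (n (gamma s)) = 1,
        dotp (n (gamma s)) (derive1 gamma s) = 0
      & \forall h \near 0^'+, ~ Sm (gamma s + h *: n (gamma s))].

Definition disc (R : realType) (c : R) (x : R * R) (t : R) : set (R * R) :=
  [set y | edist x y < c * t].

Definition heaviside (R : realType) (t : R) : R :=
  if t == 0 then 2^-1 else if 0 < t then 1 else 0.

Definition domain_char (R : realType) (Sm S : set (R * R)) (x : R * R) : R :=
  if x \in Sm then 1 else if x \in S then 2^-1 else 0.

(* Sign: for the external normal the static limit t -> +oo of the integral of
   this kernel over the curve is -2 pi at interior points (Gauss), and on a
   circle of radius a centred at x it is -2 pi c t / sqrt (c^2 t^2 - a^2).  The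
   double layer therefore enters the identity with a minus sign. *)
Definition layer_kernel (R : realType) (c : R) (n : R * R -> R * R)
    (x : R * R) (t : R) (y : R * R) : R :=
  (Num.sqrt (1 - (edist x y / (c * t)) ^+ 2))^-1 *
  'D_(n y) (fun z : R * R => ln (edist x z)^-1) y.

(* Parameters of the points of E lying on the curve, each point counted once;
   as gamma is an arc length parametrization, Lebesgue measure there is dS. *)
Definition arc (R : realType) (L : R) (gamma : R -> R * R)
    (E : set (R * R)) : set R :=
  `[0, L[%classic `&` gamma @^-1` E.

Definition arc_integrable (R : realType) (L : R) (gamma : R -> R * R)
    (E : set (R * R)) (f : R * R -> R) : Prop :=
  (@lebesgue_measure R).-integrable (arc L gamma E)
    (fun s => (f (gamma s))%:E).

Definition arc_integral (R : realType) (L : R) (gamma : R -> R * R)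
    (E : set (R * R)) (f : R * R -> R) : R :=
  (\int[@lebesgue_measure R]_(s in arc L gamma E) f (gamma s))%R.

Definition punctured (R : realType) (x : R * R) (E : set (R * R)) (e : R) :
    set (R * R) :=
  E `&` [set y | e <= edist x y].

(* When x is off the (compact) curve the puncture is eventually immaterial, so
   that these are then the ordinary integrability and integral. *)
Definition pv_convergent (R : realType) (L : R) (gamma : R -> R * R)
    (x : R * R) (E : set (R * R)) (f : R * R -> R) : Prop :=
  (\forall e \near 0^'+, arc_integrable L gamma (punctured x E e) f) /\
  cvg (arc_integral L gamma (punctured x E e) f @[e --> 0^'+]).

Definition pv_integral (R : realType) (L : R) (gamma : R -> R * R)
    (x : R * R) (E : set (R * R)) (f : R * R -> R) : R :=
  lim (arc_integral L gamma (punctured x E e) f @[e --> 0^'+]).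

Definition double_layer (R : realType) (c L : R) (gamma : R -> R * R)
    (n : R * R -> R * R) (x : R * R) (t : R) : R :=
  pv_integral L gamma x (disc c x t) (layer_kernel c n x t).

Definition wave_volume (R : realType) (c : R) (Sm : set (R * R))
    (x : R * R) (t : R) : R :=
  (\int[(@lebesgue_measure R \x @lebesgue_measure R)%E]_(y in Sm `&` disc c x t)
    (Num.sqrt (c ^+ 2 * t ^+ 2 - edist x y ^+ 2))^-1)%R.

(* For fixed x this may fail at exceptional t: at t = 0, where wave_volume has
   one-sided derivatives 0 and 2 pi c if x is in Sm, or when the circle of
   radius c t centred at x is tangent to the curve. *)
Definition lhs_defined (R : realType) (c L : R) (gamma : R -> R * R)
    (Sm : set (R * R)) (n : R * R -> R * R) (x : R * R) (t : R) : Prop :=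
  pv_convergent L gamma x (disc c x t) (layer_kernel c n x t) /\
  derivable (wave_volume c Sm x) t 1.

(* Main.v *)
Require Import Defs.
From HB Require Import structures.
From mathcomp Require Import all_boot all_order all_algebra.
From mathcomp Require Import all_classical all_reals all_analysis.
From mathcomp Require Import measurable_realfun ring lra.
Import Order.TTheory GRing.Theory Num.Theory.
Import numFieldTopology.Exports numFieldNormedType.Exports.
Local Open Scope classical_set_scope.
Local Open Scope ring_scope.

Set Implicit Arguments.
Unset Strict Implicit.
Unset Printing Implicit Defensive.

(** Write q(s) for the squared distance from x to gamma(s) and g(s) for minus the
    normal derivative of ln (1/r) at gamma(s).  The Hoelder continuity of the
    tangent makes g integrable, with a singularity |s - s0|^(a - 1) at x = gamma(s0).
    The divergence theorem in Sm holds for C^1 fields: locally the boundary is a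
    graph, which a shear straightens, and bumps localize.  For radial fields
    F(r^2) (y - x) it yields two formulas.  With Gaussians concentrating at x, the
    integral I of g is 2 pi, pi or 0 (at a boundary point half of the Gaussian mass
    lies on the tangent side of Sm).  With regularizations of 1/sqrt (c^2 t^2 - r^2),
    the volume integral is W(t) = c t I - U(t) for t > 0, where U(t) is the integral
    of sqrt (c^2 t^2 - q) g.  Formally U' is the integral of
    c^2 t / sqrt (c^2 t^2 - q) g, which is -c times the double layer, so that the
    left-hand side is I.

    By Fubini U is a primitive of that formal derivative, whence the existence for
    almost every t.  At a given t > 0 where the double layer exists, the left
    difference quotients of U are dominated by twice the formal integrand; hence
    they converge, and W'(t) is identified as soon as it exists.  At t = 0 the
    one-sided derivatives of W are 0 and c I, so W'(0) exists only if I = 0. *)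

(** * Measure and calculus in the plane *)

(** In the plane [(y - x) / r^2] is free of divergence off x. So if [H 0 = 0], the field
    [H (r^2) / r^2 (y - x)] has divergence [2 H' (r^2)] and flux density [H (r^2) g] through the
    curve. Each choice of [H] trades an area integral of a radial density for a boundary integral of
    [g]; a singular density only costs a passage to the limit, and no polar coordinates occur. The
    available smoothness shapes the rest. A Lyapunov curve is C^1 but in general not C^2, so there
    are no normal coordinates along it; and the normal is given point by point, so that its
    continuity has to be derived from the local position of the domain. In time, U is compared from
    the left because the formal integrand at t vanishes where [r >= c t]. For a later time t' the
    difference quotient is positive on [c t <= r < c t'], where this integrand gives no majorant. *)

Section planar_measure.
Context {R : realType}.
Local Notation mu := (@lebesgue_measure R).
Local Notation R2 := (measurableTypeR R * measurableTypeR R)%type.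

(** The squares with rational centre and radius contained in an open set are countably many and
    cover it, and a square is a measurable rectangle of the product sigma-algebra. *)
Lemma open_measurable_plane (A : set (R * R)) : open A -> measurable (A : set R2).
Proof.
move=> oA.
pose box (p : (rat * rat) * rat) : set R2 :=
  (ball (ratr p.1.1 : R) (ratr p.2 : R)) `*` (ball (ratr p.1.2 : R) (ratr p.2 : R)).
have -> : A = \bigcup_(p in [set p | box p `<=` A]) box p.
  apply/seteqP; split => [y Ay|y [p /= pA]]; last exact: pA.
  have : nbhs y A by apply: open_nbhs_nbhs.
  rewrite -nbhs_ballE => -[e /= e0 eA].
  (* A centre within [e / 4] of y and a radius between [e / 4] and [e / 2] give a square that
     contains y and stays within [e] of it. *)
  have e4 : 0 < e / 4 by rewrite divr_gt0.
  have e42 : e / 4 < e / 2 by lra.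
  have [r] := rat_in_itvoo e42.
  rewrite in_itv /= => /andP[r1 r2].
  have near_rat (z : R) : exists q : rat, `|ratr q - z| < e / 4.
    have ez : z - e / 4 < z + e / 4 by lra.
    have [q] := rat_in_itvoo ez.
    by rewrite in_itv /= => /andP[? ?]; exists q; rewrite ltr_norml; apply/andP; split; lra.
  have [q1 q1y] := near_rat y.1.
  have [q2 q2y] := near_rat y.2.
  exists ((q1, q2), r) => /=.
    move=> z [/= z1 z2]; apply: eA; move: z1 z2; rewrite /ball /= => z1 z2.
    split; rewrite /ball /=.
    - rewrite (_ : y.1 - z.1 = - (ratr q1 - y.1) + (ratr q1 - z.1)); last by ring.
      by apply: (le_lt_trans (ler_normD _ _)); rewrite normrN; lra.
    - rewrite (_ : y.2 - z.2 = - (ratr q2 - y.2) + (ratr q2 - z.2)); last by ring.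
      by apply: (le_lt_trans (ler_normD _ _)); rewrite normrN; lra.
  by split; rewrite /ball /=; lra.
rewrite bigcup_mkcond; apply: countable_bigcupT_measurable => [|p]; first exact: countableP.
by case: ifP => // _; apply: measurableX; exact: measurable_ball.
Qed.

Lemma continuous_measurable_plane (f : R * R -> R) :
  continuous f -> measurable_fun setT (f : R2 -> R).
Proof.
move=> cf; apply: (measurability _ (RGenOpens.measurableE R)).
move=> _ [_ [a [b ->] <-]]; rewrite setTI; apply: open_measurable_plane.
by move/continuousP: cf; apply; exact: interval_open.
Qed.

(** Lebesgue measure is determined by its values on half-open intervals, and there it agrees with
    [k] times its image under the affine map. *)
Lemma ge0_integral_affine (f : R -> \bar R) (k b : R) : 0 < k ->
  measurable_fun setT f -> (forall x, 0 <= f x)%E ->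
  (\int[mu]_x f x = k%:E * \int[mu]_x f (k * x + b)%R)%E.
Proof.
move=> k0 mf f0.
have mphi : measurable_fun setT (fun x : measurableTypeR R => k * x + b : measurableTypeR R).
  by apply: continuous_measurable_fun => x; apply: cvgD;
    [apply: cvgM; [exact: cvg_cst|exact: cvg_id]|exact: cvg_cst].
pose phi (x : measurableTypeR R) : measurableTypeR R := k * x + b.
pose nu0 := measure_function_pushforward__canonical__measure_function_Measure
  (mu : {measure set measurableTypeR R -> \bar R}) (mphi : measurable_fun setT phi).
pose nu := mscale (NngNum (ltW k0)) nu0.
have E A : measurable A -> mu A = nu A.
  apply: lebesgue_measure_unique => _ [[u v] _ <-].
  transitivity (k%:E * mu (phi @^-1` `]u, v]%classic))%E; last by [].
  rewrite (_ : phi @^-1` _ = `](u - b) / k, (v - b) / k]%classic); last first.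
    apply/seteqP; split => x /=; rewrite /phi !in_itv /= ltr_pdivrMr// ler_pdivlMr//;
    by move=> /andP[? ?]; apply/andP; split; lra.
  rewrite !lebesgue_measure_itv /= !lte_fin ltr_pM2r ?invr_gt0// ltrD2r.
  case: ifP => _; last by rewrite mule0.
  by rewrite -!EFinB -EFinM; congr EFin; field; rewrite gt_eqF.
rewrite (eq_measure_integral nu) => [|A mA _]; last exact: E.
rewrite ge0_integral_mscale//; congr (_ * _)%E.
by rewrite /nu0 ge0_integral_pushforward.
Qed.

Lemma integral_translate (f : R -> \bar R) (b : R) :
  measurable_fun setT f ->
  (\int[mu]_x f (x + b)%R = \int[mu]_x f x)%E.
Proof.
move=> mf.
have H (g : R -> \bar R) : measurable_fun setT g -> (forall x, 0 <= g x)%E ->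
    (\int[mu]_x g (x + b)%R = \int[mu]_x g x)%E.
  move=> mg g0; rewrite (@ge0_integral_affine g 1 b)// mul1e.
  by apply: eq_integral => x _; rewrite mul1r.
rewrite integralE [RHS]integralE; congr (_ - _)%E.
  transitivity (\int[mu]_x (f^\+)%E (x + b)%R)%E.
    by apply: eq_integral => x _; rewrite !funeposE.
  apply: H => //; exact: measurable_funepos.
transitivity (\int[mu]_x (f^\-)%E (x + b)%R)%E.
  by apply: eq_integral => x _; rewrite !funenegE.
apply: H => //; exact: measurable_funeneg.
Qed.

Lemma ge0_integral_opp (f : R -> \bar R) :
  measurable_fun setT f -> (forall x, 0 <= f x)%E ->
  (\int[mu]_x f (- x)%R = \int[mu]_x f x)%E.
Proof.
move=> mf f0.
rewrite [RHS](eq_measure_integral (pushforward mu (-%R : _ -> measurableTypeR R))).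
  by rewrite ge0_integral_pushforward.
by move=> A mA _; exact/esym/lebesgue_measureN.
Qed.

Local Notation mu2 := (mu \x mu)%E.

(** This serves as the zoom at a point [b], in which a shrinking Gaussian becomes a fixed one. *)
Lemma ge0_integral2_affine (f : R2 -> \bar R) (k : R) (b : R2) : 0 < k ->
  measurable_fun setT f -> (forall x, 0 <= f x)%E ->
  (\int[mu2]_x f x =
   (k ^+ 2)%:E * \int[mu2]_x f ((k * x.1 + b.1)%R, (k * x.2 + b.2)%R))%E.
Proof.
move=> k0 mf f0.
have mg : measurable_fun setT (fun x : R2 => f ((k * x.1 + b.1)%R, (k * x.2 + b.2)%R)).
  apply: measurableT_comp => //; apply: measurable_fun_pair.
    apply: measurable_funD => //; apply: measurable_funM => //; exact: measurable_fst.
  apply: measurable_funD => //; apply: measurable_funM => //; exact: measurable_snd.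
rewrite (fubini_tonelli1 _ mf f0) (fubini_tonelli1 _ mg (fun=> f0 _)).
rewrite (@ge0_integral_affine _ k b.1 k0); last 2 first.
- exact: measurable_fun_fubini_tonelli_F.
- by move=> x; apply: integral_ge0 => ? _; exact: f0.
rewrite expr2 EFinM -muleA; congr (_ * _)%E.
rewrite -ge0_integralZl//=; last 3 first.
- by apply: measurable_fun_fubini_tonelli_F.
- by move=> x _; apply: integral_ge0.
- by rewrite lee_fin ltW.
apply: eq_integral => x _ /=; rewrite /fubini_F (@ge0_integral_affine _ k b.2)//.
exact/measurable_fun_pair2.
Qed.

Lemma ge0_integral2_opp (f : R2 -> \bar R) :
  measurable_fun setT f -> (forall x, 0 <= f x)%E ->
  (\int[mu2]_x f (- x.1, - x.2)%R = \int[mu2]_x f x)%E.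
Proof.
move=> mf f0.
have mg : measurable_fun setT (fun x : R2 => f (- x.1, - x.2)%R).
  apply: measurableT_comp => //; apply: measurable_fun_pair;
  apply: measurableT_comp => //.
rewrite (fubini_tonelli1 _ mf f0) (fubini_tonelli1 _ mg (fun=> f0 _)).
rewrite -[RHS]ge0_integral_opp; last 2 first.
- exact: measurable_fun_fubini_tonelli_F.
- by move=> x; apply: integral_ge0 => ? _; exact: f0.
apply: eq_integral => x _; rewrite /fubini_F /=.
rewrite -[RHS]ge0_integral_opp//; exact/measurable_fun_pair2.
Qed.

Lemma Rintegral2_swap (f : R2 -> R) : mu2.-integrable setT (EFin \o f) ->
  (\int[mu2]_x f (x.2, x.1))%R = (\int[mu2]_x f x)%R.
Proof.
move=> intf; rewrite /Rintegral; congr fine.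
have mf := measurable_int _ intf.
have ms : measurable_fun setT (fun x : R2 => (x.2, x.1)).
  by apply: measurable_fun_pair.
have mg : measurable_fun setT (fun x : R2 => (f (x.2, x.1))%:E).
  exact: (measurableT_comp mf ms).
have intg : mu2.-integrable setT (fun x : R2 => (f (x.2, x.1))%:E).
  apply/integrable12ltyP => //=.
  by have /integrable21ltyP := intf; apply.
by rewrite -integral12_prod_meas1// -integral21_prod_meas1.
Qed.

Lemma bounded_plane_measure (D : set R2) (M : R) : measurable D ->
  (forall y, D y -> `|y.1| < M /\ `|y.2| < M) -> (mu2 D < +oo)%E.
Proof.
move=> mD bD.
pose B : set R := ball 0 M.
have mB : measurable B by exact: measurable_ball.
apply: (@le_lt_trans _ _ (mu2 (B `*` B))).
  apply: le_measure; rewrite ?inE//; first exact: measurableX.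
  by move=> y /bD[y1 y2]; split; rewrite /B /ball /= sub0r normrN.
rewrite product_measure1E//.
have [M0|M0] := ltP M 0.
  have -> : B = set0 by rewrite /B; apply/seteqP; split => // x;
    rewrite /ball /= => /(le_lt_trans (normr_ge0 _)); rewrite ltNge ltW.
  by rewrite measure0 ?mule0 ?mul0e ?ltry //.
have muB : mu B = (M *+ 2)%:E by exact: lebesgue_measure_ball.
by rewrite [X in (X * _)%E]muB [X in (_ * X)%E]muB -EFinM ltry.
Qed.

Lemma bounded_plane_integrable (D : set R2) (M C : R) (f : R2 -> R) :
  measurable D -> (forall y, D y -> `|y.1| < M /\ `|y.2| < M) ->
  measurable_fun D f -> (forall y, D y -> `|f y| <= C) ->
  mu2.-integrable D (EFin \o f).
Proof.
move=> mD bD mf fC; apply: measurable_bounded_integrable => //.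
  exact: bounded_plane_measure bD.
exists C; split; first by rewrite num_real.
by move=> N CN y Dy; apply: (le_trans (fC y Dy)); exact: ltW.
Qed.

Lemma bounded_interval_integrable (D : set R) (a b C : R) (f : R -> R) :
  measurable D -> D `<=` `[a, b]%classic ->
  measurable_fun D f -> (forall y, D y -> `|f y| <= C) ->
  mu.-integrable D (EFin \o f).
Proof.
move=> mD bD mf fC; apply: measurable_bounded_integrable => //.
  apply: (@le_lt_trans _ _ (mu `[a, b]%classic)).
    by apply: le_measure; rewrite ?inE.
  by rewrite lebesgue_measure_itv /=; case: ifP => // _; rewrite -EFinB ltry.
exists C; split; first by rewrite num_real.
by move=> N CN y Dy; apply: (le_trans (fC y Dy)); exact: ltW.
Qed.

Lemma continuous_interval_integrable (a b : R) (f : R -> R) :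
  continuous f -> mu.-integrable `[a, b]%classic (EFin \o f).
Proof.
move=> cf; apply: continuous_compact_integrable; first exact: segment_compact.
exact: continuous_subspaceT.
Qed.

Lemma FTC2_continuous (F f : R -> R) (a b : R) : a <= b ->
  continuous f -> (forall x, is_derive x (1 : R) F (f x)) ->
  (\int[mu]_(x in `[a, b]) f x)%R = F b - F a.
Proof.
rewrite le_eqVlt => /orP[/eqP <- _ _|ab cf dF].
  by rewrite set_itv1 Rintegral_set1 subrr.
have cF : continuous F.
  by move=> x; apply: differentiable_continuous; apply/derivable1_diffP; case: (dF x).
rewrite /Rintegral (@continuous_FTC2 _ f F)//.
- exact: continuous_subspaceT.
- split => [x _||]; first by case: (dF x).
    by apply: cvg_at_right_filter; exact: cF.
  by apply: cvg_at_left_filter; exact: cF.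
- by move=> x _; rewrite derive1E; case: (dF x).
Qed.

End planar_measure.

Lemma Rdominated_cvg d (T : measurableType d) (R : realType)
    (mu : {measure set T -> \bar R}) (D : set T) (f_ : nat -> T -> R) (f g : T -> R) :
  measurable D -> (forall n, measurable_fun D (f_ n)) -> measurable_fun D f ->
  {ae mu, forall x, D x -> f_ ^~ x @ \oo --> f x} ->
  mu.-integrable D (EFin \o g) ->
  (forall n x, D x -> `|f_ n x| <= g x) ->
  (\int[mu]_(x in D) f_ n x)%R @[n --> \oo] --> (\int[mu]_(x in D) f x)%R.
Proof.
move=> mD mf_ mf cvf ig fg.
have [||||intf _ /= cv] := @dominated_convergence _ _ _ mu D mD
    (fun n => EFin \o f_ n) (EFin \o f) (EFin \o g) _ _ _ ig.
- by move=> n; exact/measurable_EFinP.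
- exact/measurable_EFinP.
- by apply: filterS cvf => x + Dx => /(_ Dx) fx; apply/fine_cvgP; split; first exact: nearW.
- by apply: nearW => x n Dx; rewrite /= lee_fin; exact: fg.
- rewrite /Rintegral; apply: fine_cvg.
  by rewrite fineK //; exact: integrable_fin_num.
Qed.

(** * One-variable calculus and periodic functions *)

Section one_variable.
Context {R : realType}.
Implicit Types (f g df : R -> R) (x y d : R).

Lemma is_derive_continuous f x (l : R) : is_derive x (1 : R) f l -> {for x, continuous f}.
Proof.
by move=> df; apply: differentiable_continuous; apply/derivable1_diffP; case: df.
Qed.

Lemma is_derive1_eq f x (l l' : R) :
  is_derive x (1 : R) f l -> l = l' -> is_derive x (1 : R) f l'.
Proof. by move=> + <-. Qed.

Lemma is_derive1_cst (c x : R) : is_derive x (1 : R) (fun _ : R => c) 0.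
Proof. exact: is_derive_cst. Qed.

Lemma is_derive1_id x : is_derive x (1 : R) (fun t : R => t) 1.
Proof. exact: is_derive_id. Qed.

Lemma is_derive1_add f g x (k l : R) : is_derive x (1 : R) f k ->
  is_derive x (1 : R) g l -> is_derive x (1 : R) (fun t => f t + g t) (k + l).
Proof. by move=> df dg; exact: is_deriveD. Qed.

Lemma is_derive1_opp f x (k : R) : is_derive x (1 : R) f k ->
  is_derive x (1 : R) (fun t => - f t) (- k).
Proof. by move=> df; exact: is_deriveN. Qed.

Lemma is_derive1_sub f g x (k l : R) : is_derive x (1 : R) f k ->
  is_derive x (1 : R) g l -> is_derive x (1 : R) (fun t => f t - g t) (k - l).
Proof. by move=> df dg; exact: is_deriveB. Qed.

Lemma is_derive1_mul f g x (k l : R) : is_derive x (1 : R) f k ->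
  is_derive x (1 : R) g l ->
  is_derive x (1 : R) (fun t => f t * g t) (f x * l + g x * k).
Proof. by move=> df dg; exact: is_deriveM. Qed.

Lemma is_derive1_compose f g x (k l : R) : is_derive (g x) (1 : R) f k ->
  is_derive x (1 : R) g l -> is_derive x (1 : R) (fun t => f (g t)) (k * l).
Proof. by move=> df dg; exact: is_derive1_comp. Qed.

Lemma is_derive1_inv f x (l : R) : f x != 0 -> is_derive x (1 : R) f l ->
  is_derive x (1 : R) (fun t => (f t)^-1) (- l / f x ^+ 2).
Proof.
move=> fx0 df; have := is_deriveV fx0 df; move/is_derive1_eq; apply.
by rewrite /GRing.scale /= mulNr mulrC mulNr.
Qed.

Lemma is_derive1_pow2 f x (l : R) : is_derive x (1 : R) f l ->
  is_derive x (1 : R) (fun t => f t ^+ 2) (f x * l + f x * l).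
Proof. exact: (fun H => is_derive1_mul H H). Qed.

Lemma continuous_near_abs f x (e : R) : {for x, continuous f} -> 0 < e ->
  exists2 d, 0 < d & forall y, `|y - x| < d -> `|f y - f x| < e.
Proof.
move=> cf e0; have /cvgrPdist_lt /(_ e e0) := cf.
move=> /nbhs_ballP[d /= d0 H]; exists d => // y yx.
by rewrite distrC; apply: H; rewrite /ball /= distrC.
Qed.

Lemma within_continuous_itv f (a b : R) :
  (forall x, a <= x <= b -> {for x, continuous f}) -> {within `[a, b], continuous f}.
Proof.
move=> cf; apply: continuous_in_subspaceT => x; rewrite inE /= in_itv /=.
exact: cf.
Qed.

(** Strict monotonicity comes from the mean value theorem and surjectivity from the intermediate
    value theorem. Applied to one coordinate of the curve, it makes the curve a graph. *)
Lemma local_inverse f df x0 d : 0 < d ->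
  (forall x, `|x - x0| <= d -> is_derive x (1 : R) f (df x)) ->
  (forall x, `|x - x0| <= d -> 0 < df x) ->
  exists g, [/\ f (x0 - d) < f x0, f x0 < f (x0 + d),
    (forall x, `|x - x0| <= d -> g (f x) = x) &
    forall y, f (x0 - d) < y < f (x0 + d) ->
      [/\ `|g y - x0| < d, f (g y) = y & is_derive y (1 : R) g (df (g y))^-1]].
Proof.
move=> d0 Df df0.
have dist x : (`|x - x0| <= d) = (x0 - d <= x <= x0 + d).
  by rewrite ler_norml; apply/idP/idP => /andP[? ?]; apply/andP; split; lra.
have mono x y : x0 - d <= x -> x < y -> y <= x0 + d -> f x < f y.
  move=> dx xy yd; rewrite -subr_gt0.
  have [z||z + ->] := @MVT R f df x y xy.
  - by rewrite in_itv /= => /andP[? ?]; apply: Df; rewrite dist; apply/andP; split; lra.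
  - apply: within_continuous_itv => z /andP[? ?].
    by apply: is_derive_continuous; apply: Df; rewrite dist; apply/andP; split; lra.
  - rewrite in_itv /= => /andP[? ?]; rewrite mulr_gt0 ?subr_gt0//.
    by apply: df0; rewrite dist; apply/andP; split; lra.
have inj x y : `|x - x0| <= d -> `|y - x0| <= d -> f x = f y -> x = y.
  rewrite !dist => /andP[? ?] /andP[? ?] fxy.
  have [xy|yx|//] := ltgtP x y.
  - by have : f x < f y by [apply: mono]; rewrite fxy ltxx.
  - by have : f y < f x by [apply: mono]; rewrite fxy ltxx.
pose g y := xget x0 [set x | `|x - x0| <= d /\ f x = y].
have gK x : `|x - x0| <= d -> g (f x) = x.
  move=> xd; rewrite /g; case: xgetP => [z -> [zd fz]|/(_ x)]; first exact: inj.
  by case.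
exists g; split => //.
- by apply: mono; lra.
- by apply: mono; lra.
move=> y /andP[y1 y2].
have dd : x0 - d <= x0 + d by lra.
have [||x] := @IVT R f (x0 - d) (x0 + d) y dd.
- apply: within_continuous_itv => z zd; apply: is_derive_continuous.
  by apply: Df; rewrite dist.
- have flt : f (x0 - d) < f (x0 + d) by apply: mono; lra.
  by rewrite minEle maxEle (ltW flt); apply/andP; split; exact: ltW.
rewrite in_itv /= -dist => xd fx; rewrite -fx gK//.
have xd' : `|x - x0| < d.
  rewrite ltr_norml; move: xd; rewrite dist => /andP[xd1 xd2].
  have x1 : x != x0 - d by apply: contraTneq y1 => <-; rewrite fx ltxx.
  have x2 : x != x0 + d by apply: contraTneq y2 => <-; rewrite fx ltxx.
  have h1 : x0 - d < x by rewrite lt_neqAle eq_sym x1.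
  have h2 : x < x0 + d by rewrite lt_neqAle x2.
  by apply/andP; split; lra.
have nx : \forall z \near x, `|z - x0| <= d.
  apply/nbhs_ballP; exists (d - `|x - x0|); first by rewrite /= subr_gt0.
  move=> z; rewrite /ball /= => zx.
  rewrite (_ : z - x0 = - (x - z) + (x - x0)); last by ring.
  by apply: (le_trans (ler_normD _ _)); rewrite normrN; lra.
split => //; apply: is_derive_inverse.
- by near=> z; apply: gK; near: z.
- near=> z; apply: is_derive_continuous; apply: Df; near: z; exact: nx.
- exact: Df.
- by rewrite gt_eqF// df0.
Unshelve. all: by end_near. Qed.

(** [(s - s0) / L] is rounded to the nearest integer. The quantifier over [f] stands inside, so that
    one representative serves both coordinates of the curve at once. *)
Lemma periodic_representative (L s0 s : R) : 0 < L ->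
  exists2 s', `|s' - s0| <= L / 2 &
    forall (T : Type) (f : R -> T), (forall t, f (t + L) = f t) -> f s' = f s.
Proof.
move=> L0; pose k := Num.floor ((s - s0) / L + 1 / 2).
exists (s - k%:~R * L).
  have k1 : (k%:~R : R) <= (s - s0) / L + 1 / 2 by exact: floor_le.
  have k2 : (s - s0) / L + 1 / 2 < (k%:~R : R) + 1.
    by have := floorD1_gt ((s - s0) / L + 1 / 2); rewrite -/k intrD.
  have e : ((s - s0) / L + 1 / 2) * L = s - s0 + L / 2.
    by field; rewrite gt_eqF.
  move: k1 k2; rewrite -(ler_pM2r L0) -(ltr_pM2r L0) e => k1 k2.
  by rewrite ler_norml; apply/andP; split; lra.
move=> T f fL.
have fn (n : nat) t : f (t + n%:R * L) = f t.
  elim: n t => [|n IH] t; first by rewrite mul0r addr0.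
  by rewrite -natr1 mulrDl mul1r addrA fL.
case: (intP k) => [|n|n].
- by rewrite mul0r subr0.
- by rewrite -[in RHS](subrK (n.+1%:~R * L) s) -[n.+1%:~R]/(n.+1%:R) fn.
- by rewrite mulrNz mulNr opprK -[n.+1%:~R]/(n.+1%:R) fn.
Qed.

End one_variable.

Ltac derive1 := repeat first
  [ exact: is_derive1_cst | exact: is_derive1_id | eassumption
  | apply: is_derive1_sub | apply: is_derive1_add | apply: is_derive1_opp
  | apply: is_derive1_mul | apply: is_derive1_pow2 ].

Section connectedness.
Context {R : realType}.

(* IVT for the indicator of [Om] along the path, which is locally constant. *)
Lemma path_stays_inside (Om : set (R * R)) (c : R -> R * R) : open Om ->
  (forall t, 0 <= t <= 1 -> {for t, continuous c}) ->
  (forall t, 0 <= t <= 1 -> closure Om (c t) -> Om (c t)) ->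
  Om (c 0) -> Om (c 1).
Proof.
move=> oO cc clO O0; apply: contrapT => O1.
pose f (t : R) : R := if `[< Om (c t) >] then 1 else 0.
have cf t : 0 <= t <= 1 -> {for t, continuous f}.
  move=> t01; suff : \forall u \near t, f u = f t by move/cvg_near_cst.
  have [Ot|Ot] := pselect (Om (c t)); rewrite /f ?(asboolT Ot) ?(asboolF Ot).
    have : nbhs t (c @^-1` Om) by apply: (cc _ t01); exact: open_nbhs_nbhs.
    by apply: filterS => u Ou; rewrite asboolT.
  have : nbhs t (c @^-1` (~` closure Om)).
    apply: (cc _ t01); apply: open_nbhs_nbhs.
    split; first exact/closed_openC/closed_closure.
    by move/(clO t t01).
  by apply: filterS => u Ou; rewrite asboolF// => /subset_closure.
have [||t] := @IVT R f 0 1 (2^-1) ler01.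
- exact: within_continuous_itv.
- by rewrite /f (asboolT O0) (asboolF O1) minEle maxEle ler10 /=; apply/andP; split; lra.
by rewrite /f; case: asboolP => _ _ /eqP; rewrite eq_sym ?invr_eq0 ?pnatr_eq0// => /eqP; lra.
Qed.

End connectedness.

(** * Smooth boundary data and local graphs *)

(* The componentwise data of a closed C^1 curve (a, b) of length L bounding Om,
   with normal (N1, N2); unlike the hypotheses of the theorem it is stable under
   exchanging the coordinates and under reversing the parameter. *)
Record smooth_boundary {R : realType} (L : R) (a b da db N1 N2 : R -> R)
    (Om : set (R * R)) : Prop := SmoothBoundary {
  sb_len : 0 < L;
  sb_per : forall s, a (s + L) = a s /\ b (s + L) = b s;
  sb_da : forall s, is_derive s (1 : R) a (da s);
  sb_db : forall s, is_derive s (1 : R) b (db s);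
  sb_cda : continuous da;
  sb_cdb : continuous db;
  sb_unit : forall s, da s ^+ 2 + db s ^+ 2 = 1;
  sb_inj : forall s s', `|s - s'| < L -> a s = a s' -> b s = b s' -> s = s';
  sb_nunit : forall s, N1 s ^+ 2 + N2 s ^+ 2 = 1;
  sb_northo : forall s, N1 s * da s + N2 s * db s = 0;
  sb_nper : forall s, N1 (s + L) = N1 s /\ N2 (s + L) = N2 s;
  sb_out : forall s, \forall h \near 0^'+, ~ Om (a s + h * N1 s, b s + h * N2 s);
  sb_open : open Om;
  sb_on : forall s, closure Om (a s, b s) /\ ~ Om (a s, b s);
  sb_bd : forall y, closure Om y -> ~ Om y -> exists s, y = (a s, b s);
  sb_bounded : exists M, forall y, Om y -> `|y.1| < M /\ `|y.2| < M }.

(** [sg] is 1 or -1 according to whether the domain lies below or above the graph of [h]. [gc_near]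
    carries the simplicity of the curve: no remote arc returns into the box. [gc_normal] says that
    the sign in the normal is the same all along the arc. *)
Record graph_chart {R : realType} (L : R) (a b da db N1 N2 : R -> R)
    (Om : set (R * R)) (s0 d r sg : R) (h dh : R -> R) : Prop := GraphChart {
  gc_d : 0 < d < L / 2;
  gc_r : 0 < r;
  gc_sg : sg ^+ 2 = 1;
  gc_curve : forall s, `|s - s0| < d ->
    [/\ 0 < da s, b s = h (a s) & db s = dh (a s) * da s];
  gc_onto : forall y, `|y - a s0| < r -> exists2 s, `|s - s0| < d & a s = y;
  gc_der : forall y, `|y - a s0| < r ->
    is_derive y (1 : R) h (dh y) /\ {for y, continuous dh};
  gc_side : forall y : R * R, `|y.1 - a s0| < r -> `|y.2 - b s0| < r ->
    Om y <-> sg * (y.2 - h y.1) < 0;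
  gc_near : forall s, `|s - s0| <= L / 2 -> `|a s - a s0| < r ->
    `|b s - b s0| < r -> `|s - s0| < d;
  gc_normal : forall s, `|s - s0| < d -> `|a s - a s0| < r -> `|b s - b s0| < r ->
    N1 s = - sg * db s /\ N2 s = sg * da s }.

Section chart.
Context {R : realType}.

Lemma is_derive_pos_near (F : R -> R) (l : R) : is_derive 0 (1 : R) F l ->
  F 0 = 0 -> 0 < l -> \forall t \near 0^'+, 0 < F t.
Proof.
move=> /is_derive1_caratheodory[g [Fg cg gl]] F0 l0.
have [e e0 ge] := continuous_near_abs cg l0.
near=> t.
have t0 : 0 < t by near: t; exact: nbhs_right_gt.
have te : t < e by near: t; exact: nbhs_right_lt.
have := Fg t; rewrite F0 !subr0 => ->; rewrite mulr_gt0//.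
have := ge t; rewrite subr0 gtr0_norm// => /(_ te).
by rewrite gl ltr_norml => /andP[+ _]; lra.
Unshelve. all: by end_near. Qed.

(** Along the ray the height above the graph has derivative [v2 - v1 * (dq / dp)] at 0, whose sign
    is that of [v2 * dp - v1 * dq]. *)
Lemma graph_side_near (h : R -> R) (p q dp dq v1 v2 k : R) :
  0 < dp -> q = h p -> is_derive p (1 : R) h (dq / dp) ->
  0 < k * (v2 * dp - v1 * dq) ->
  \forall t \near 0^'+, 0 < k * (q + t * v2 - h (p + t * v1)).
Proof.
move=> dp0 qh Dh vk.
have Dl u v : is_derive (0 : R) (1 : R) (fun t => u + t * v) (0 + (0 * 0 + v * 1)).
  exact: is_derive1_add (is_derive1_cst u 0)
    (is_derive1_mul (is_derive1_id 0) (is_derive1_cst v 0)).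
have Dh0 : is_derive (p + 0 * v1) (1 : R) h (dq / dp) by rewrite mul0r addr0.
apply: (@is_derive_pos_near _ (k * (v2 - v1 * (dq / dp)))).
- have D := is_derive1_mul (is_derive1_cst k 0)
    (is_derive1_sub (Dl q v2) (@is_derive1_compose _ h (fun t => p + t * v1) _ _ _ Dh0 (Dl p v1))).
  by apply: (is_derive1_eq D); ring.
- by rewrite qh !mul0r !addr0 subrr mulr0.
- rewrite (_ : k * _ = k * (v2 * dp - v1 * dq) / dp) ?divr_gt0//.
  by field; rewrite gt_eqF.
Qed.

Variables (L : R) (a b da db N1 N2 : R -> R) (Om : set (R * R)).
Hypothesis sb : smooth_boundary L a b da db N1 N2 Om.

Lemma sb_continuous_a : continuous a.
Proof. by move=> s; exact: is_derive_continuous (sb_da sb s). Qed.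

Lemma sb_continuous_b : continuous b.
Proof. by move=> s; exact: is_derive_continuous (sb_db sb s). Qed.

(** [k] is the cross product of the tangent and the normal; by Lagrange's identity for orthonormal
    vectors its square is 1. *)
Lemma sb_normal_sign s : exists k, [/\ k ^+ 2 = 1, N1 s = - k * db s & N2 s = k * da s].
Proof.
have u := sb_unit sb s; have v := sb_nunit sb s; have o := sb_northo sb s.
exists (N2 s * da s - N1 s * db s); split.
- transitivity ((N1 s ^+ 2 + N2 s ^+ 2) * (da s ^+ 2 + db s ^+ 2) -
    (N1 s * da s + N2 s * db s) ^+ 2); first by ring.
  by rewrite u v o; ring.
- transitivity (N1 s * (da s ^+ 2 + db s ^+ 2) -
    (N1 s * da s + N2 s * db s) * da s); last by ring.
  by rewrite u o; ring.
- transitivity (N2 s * (da s ^+ 2 + db s ^+ 2) -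
    (N1 s * da s + N2 s * db s) * db s); last by ring.
  by rewrite u o; ring.
Qed.

Lemma positive_lower_bound (f : R -> R) (p q : R) : p <= q -> continuous f ->
  (forall s, p <= s <= q -> 0 < f s) ->
  exists2 m, 0 < m & forall s, p <= s <= q -> m <= f s.
Proof.
move=> pq cf f0.
have [|c] := @EVT_min R f p q pq; first exact: continuous_subspaceT.
rewrite in_itv /= => cpq fc; exists (f c); first exact: f0.
by move=> s spq; apply: fc; rewrite in_itv.
Qed.

(** Away from [s0], up to half a period on either side, the parameters form two compact intervals,
    on which injectivity keeps the curve off its point at [s0]. *)
Lemma sb_away s0 d : 0 < d -> d <= L / 2 -> exists2 e, 0 < e &
  forall s, d <= `|s - s0| -> `|s - s0| <= L / 2 ->
    `|a s - a s0| < e -> `|b s - b s0| < e -> False.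
Proof.
move=> d0 dL; have L0 := sb_len sb.
pose f s := `|a s - a s0| + `|b s - b s0|.
have cf : continuous f.
  move=> s; apply: cvgD; apply: cvg_norm; apply: cvgB; try exact: cvg_cst.
    exact: sb_continuous_a.
  exact: sb_continuous_b.
have f0 s : d <= `|s - s0| -> `|s - s0| <= L / 2 -> 0 < f s.
  move=> ds sL; rewrite lt_neqAle addr_ge0// andbT eq_sym.
  rewrite paddr_eq0// !normr_eq0 !subr_eq0; apply/negP => /andP[/eqP E1 /eqP E2].
  have ss : s = s0 by apply: (sb_inj sb) => //; lra.
  by move: ds; rewrite ss subrr normr0; lra.
have [||m1 m10 H1] := @positive_lower_bound f (s0 - L / 2) (s0 - d) _ cf.
- by lra.
- move=> s /andP[? ?]; have h : s - s0 < 0 by lra.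
  by apply: f0; rewrite ltr0_norm//; lra.
have [||m2 m20 H2] := @positive_lower_bound f (s0 + d) (s0 + L / 2) _ cf.
- by lra.
- move=> s /andP[? ?]; have h : 0 < s - s0 by lra.
  by apply: f0; rewrite gtr0_norm//; lra.
(* The minimum bounds the sum of the two coordinate distances, hence the half. *)
exists (Num.min m1 m2 / 2); first by rewrite divr_gt0// lt_min m10 m20.
have e1 : Num.min m1 m2 <= m1 by rewrite ge_min lexx.
have e2 : Num.min m1 m2 <= m2 by rewrite ge_min lexx orbT.
move=> s ds sL ha hb; have fs : f s < Num.min m1 m2 by rewrite /f; lra.
have [s0s|ss0] := ltP 0 (s - s0).
  move: ds sL; rewrite gtr0_norm// => ds sL.
  by have := H2 s; rewrite (_ : _ <= _ <= _ = true); [move=> /(_ isT); lra|apply/andP; split; lra].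
move: ds sL; rewrite ler0_norm// => ds sL.
by have := H1 s; rewrite (_ : _ <= _ <= _ = true); [move=> /(_ isT); lra|apply/andP; split; lra].
Qed.

Lemma sb_boundary_repr s0 y : closure Om y -> ~ Om y ->
  exists2 s, `|s - s0| <= L / 2 & y = (a s, b s).
Proof.
move=> cy ny; have [s ->] := sb_bd sb cy ny.
have [s' h H] := periodic_representative s0 s (sb_len sb).
exists s' => //; rewrite (H _ a) ?(H _ b)// => t; first by case: (sb_per sb t).
by case: (sb_per sb t).
Qed.

End chart.

Lemma normr_sign (R : realDomainType) (k : R) : k ^+ 2 = 1 -> `|k| = 1.
Proof. by move=> k2; apply/eqP; rewrite -sqrp_eq1// real_normK ?num_real// k2. Qed.

Lemma between_affine (R : realDomainType) (u v t A B : R) : 0 <= t <= 1 ->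
  A < u < B -> A < v < B -> A < u + t * (v - u) < B.
Proof.
move=> /andP[t0 t1] /andP[u1 u2] /andP[v1 v2]; have [uv|vu] := leP u v.
  have p1 : 0 <= t * (v - u) by rewrite mulr_ge0// subr_ge0.
  have p2 : 0 <= (1 - t) * (v - u) by rewrite mulr_ge0// subr_ge0.
  by apply/andP; split; lra.
have p1 : 0 <= t * (u - v) by rewrite mulr_ge0// subr_ge0 ltW.
have p2 : 0 <= (1 - t) * (u - v) by rewrite mulr_ge0 ?subr_ge0// ltW.
by apply/andP; split; lra.
Qed.

Section local_graph.
Context {R : realType}.
Variables (L : R) (a b da db N1 N2 : R -> R) (Om : set (R * R)).
Hypothesis sb : smooth_boundary L a b da db N1 N2 Om.

(** The graph is [b] composed with the inverse of [a]. In a thin band about it each side of the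
    graph lies entirely in or out of the domain, since a path within one side does not meet the
    boundary. The outward ray at [s0] shows that one side is out; since the point is in the closure,
    the other is in. *)
Lemma local_graph_chart s0 : 0 < da s0 ->
  exists d r sg h dh, graph_chart L a b da db N1 N2 Om s0 d r sg h dh.
Proof.
move=> da0; have L0 := sb_len sb; have L42 : L / 4 < L / 2 by lra.
have [d1 d10 Hd1] := continuous_near_abs (sb_cda sb (x := s0)) da0.
(* Half of [d1], for the closed interval to lie in the neighbourhood, and a quarter period, so that
   [d < L / 2]. *)
pose d := Num.min (d1 / 2) (L / 4).
have d0 : 0 < d by rewrite lt_min !divr_gt0.
have dd1 : d <= d1 / 2 by rewrite /d ge_min lexx.
have dL : d <= L / 4 by rewrite /d ge_min lexx orbT.
have dapos s : `|s - s0| <= d -> 0 < da s.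
  move=> sd; have /Hd1 : `|s - s0| < d1 by lra.
  by rewrite ltr_norml => /andP[? ?]; lra.
have [g [am ap gK Hg]] := local_inverse d0 (fun s _ => sb_da sb s) dapos.
pose h y := b (g y); pose dh y := db (g y) / da (g y).
have ga0 : g (a s0) = s0 by apply: gK; rewrite subrr normr0 ltW.
have Dh y : a (s0 - d) < y < a (s0 + d) ->
    is_derive y (1 : R) h (dh y) /\ {for y, continuous dh}.
  move=> yI; have [gd ag Dg] := Hg y yI; split.
    exact: is_derive1_compose (sb_db sb (g y)) Dg.
  have cg := is_derive_continuous Dg.
  apply: cvgM; first by apply: continuous_comp => //; exact: sb_cdb sb _.
  apply: cvgV; first by rewrite gt_eqF// dapos// ltW.
  by apply: continuous_comp => //; exact: sb_cda sb _.
have dL2 : d <= L / 2 by lra.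
(* [e] keeps the arcs with parameters at distance [d] or more out of the box. *)
have [e e0 He] := sb_away sb s0 d0 dL2.
have ha0 : h (a s0) = b s0 by rewrite /h ga0.
have ch : {for a s0, continuous h}.
  by apply: is_derive_continuous; apply: (Dh _ _).1; rewrite am ap.
have e4 : 0 < e / 4 by rewrite divr_gt0.
have [r1 r10 Hr1] := continuous_near_abs ch e4.
pose r2 := Num.min (Num.min r1 e) (Num.min (a s0 - a (s0 - d)) (a (s0 + d) - a s0)).
have r20 : 0 < r2 by rewrite !lt_min r10 e0 !subr_gt0 am ap.
have r2r1 : r2 <= r1 by rewrite !ge_min lexx.
have r2e : r2 <= e by rewrite !ge_min lexx orbT.
have r2a : r2 <= a s0 - a (s0 - d) by rewrite !ge_min lexx !orbT.
have r2b : r2 <= a (s0 + d) - a s0 by rewrite !ge_min lexx !orbT.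
have inI y : `|y - a s0| < r2 -> a (s0 - d) < y < a (s0 + d).
  by rewrite ltr_norml => /andP[? ?]; apply/andP; split; lra.
(* A boundary point in the band comes from a parameter closer than [d] to [s0], hence lies on the
   graph. *)
have onG (y : R * R) : `|y.1 - a s0| < r2 -> `|y.2 - h y.1| < e / 2 ->
    closure Om y -> ~ Om y -> y.2 = h y.1.
  move=> y1 y2 cy ny.
  have [s sL ys] := sb_boundary_repr sb s0 cy ny.
  have hb : `|h y.1 - b s0| < e / 4 by rewrite -ha0; exact/Hr1/(lt_le_trans y1).
  have sd : `|s - s0| < d.
    rewrite ltNge; apply/negP => ds; apply: (He s ds sL).
      by rewrite ys /= in y1; lra.
    rewrite (_ : b s - b s0 = (y.2 - h y.1) + (h y.1 - b s0)).
      by apply: (le_lt_trans (ler_normD _ _)); lra.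
    by rewrite ys /=; ring.
  by rewrite ys /= /h gK// ltW.
have side_conn k (y y' : R * R) : k ^+ 2 = 1 ->
    `|y.1 - a s0| < r2 -> `|y'.1 - a s0| < r2 ->
    0 < k * (y.2 - h y.1) < e / 2 -> 0 < k * (y'.2 - h y'.1) < e / 2 ->
    Om y -> Om y'.
  move=> k2 y1 y1' yk yk' Oy.
  pose w := y.2 - h y.1; pose w' := y'.2 - h y'.1.
  (* The path interpolates linearly both the abscissa and the height above the graph, so its height
     keeps its sign and stays below [e / 2] in size. *)
  pose c1 t := y.1 + t * (y'.1 - y.1).
  pose c2 t := h (c1 t) + (w + t * (w' - w)).
  pose c t := (c1 t, c2 t).

  have c1r t : 0 <= t <= 1 -> `|c1 t - a s0| < r2.
    move=> t01; rewrite ltr_distl; apply: between_affine => //.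
      by rewrite -ltr_distl.
    by rewrite -ltr_distl.
  have cc1 : continuous c1.
    move=> t; apply: cvgD; first exact: cvg_cst.
    by apply: cvgM; [exact: cvg_id|exact: cvg_cst].
  have -> : y' = c 1.
    rewrite /c /c2 (_ : c1 1 = y'.1); last by rewrite /c1; ring.
    by rewrite [LHS]surjective_pairing /w /w'; congr pair; ring.
  apply: (@path_stays_inside R Om c (sb_open sb)).
  - move=> t t01; have := Dh _ (inI _ (c1r t t01)) => -[Dht _].
    have cc2 : {for t, continuous c2}.
      apply: cvgD.
        apply: (continuous_comp (cc1 t)); exact: is_derive_continuous Dht.
      apply: cvgD; first exact: cvg_cst.
      by apply: cvgM; [exact: cvg_id|exact: cvg_cst].
    exact: (cvg_pair (cc1 t) cc2).
  - move=> t t01 ct; apply: contrapT => nct.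
    have kc : 0 < k * ((c t).2 - h (c t).1) < e / 2.
      rewrite /c /c2 /= (_ : k * _ = k * w + t * (k * w' - k * w)); last by ring.
      exact: between_affine.
    have := onG _ (c1r t t01 : `|(c t).1 - a s0| < r2) _ ct nct.
    have -> : `|(c t).2 - h (c t).1| = k * ((c t).2 - h (c t).1).
      case/andP: kc => kc _; rewrite -(gtr0_norm kc) normrM.
      suff -> : `|k| = 1 by rewrite mul1r.
      exact: normr_sign.
    case/andP: kc => kc kce /(_ kce) E.
    by move: kc; rewrite E subrr mulr0 ltxx.
  - rewrite /c /c2 (_ : c1 0 = y.1); last by rewrite /c1; ring.
    by rewrite (_ : _ + _ = y.2) -?surjective_pairing// /w; ring.
(* With [r <= e / 4] the box lies in the band: [y.2] and [h y.1] are both within [e / 4] of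
   [b s0]. *)
pose r := Num.min r2 (e / 4).
have r0 : 0 < r by rewrite lt_min r20 e4.
have rr2 : r <= r2 by rewrite ge_min lexx.
have re : r <= e / 4 by rewrite ge_min lexx orbT.
have box (y : R * R) : `|y.1 - a s0| < r -> `|y.2 - b s0| < r -> `|y.2 - h y.1| < e / 2.
  move=> y1 y2.
  have hb : `|h y.1 - b s0| < e / 4.
    by rewrite -ha0; apply: Hr1; exact: lt_le_trans y1 (le_trans rr2 r2r1).
  rewrite (_ : y.2 - h y.1 = (y.2 - b s0) - (h y.1 - b s0)); last by ring.
  by apply: (le_lt_trans (ler_normB _ _)); lra.
have curve s : `|s - s0| < d -> [/\ 0 < da s, b s = h (a s) & db s = dh (a s) * da s].
  move=> sd; rewrite /h /dh gK ?ltW//; have ds := dapos s (ltW sd).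
  by split => //; rewrite divfK// gt_eqF.
have move_side s k v1 v2 : k ^+ 2 = 1 -> `|s - s0| < d -> `|a s - a s0| < r ->
    0 < k * (v2 * da s - v1 * db s) ->
    \forall t \near 0^'+, 0 < k * (b s + t * v2 - h (a s + t * v1)) < e / 2 /\
      `|a s + t * v1 - a s0| < r.
  move=> k2 sd sr kv; have [das bs dbs] := curve s sd.
  have [Dhs _] := Dh (a s) (inI _ (lt_le_trans sr rr2)).
  have hdiv : db s / da s = dh (a s) by rewrite dbs mulfK// gt_eqF.
  have near1 : \forall t \near 0^'+, 0 < k * (b s + t * v2 - h (a s + t * v1)).
    apply: (@graph_side_near R h (a s) (b s) (da s) (db s)) => //.
    by rewrite hdiv.
  have lin (u v : R) : {for 0, continuous (fun t : R => u + t * v)}.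
    apply: cvgD; first exact: cvg_cst.
    by apply: cvgM; [exact: cvg_id|exact: cvg_cst].
  have cF : {for 0, continuous (fun t : R => b s + t * v2 - h (a s + t * v1))}.
    apply: cvgB; first exact: lin.
    apply: continuous_comp; first exact: lin.
    by rewrite mul0r addr0; exact: is_derive_continuous Dhs.
  have e2 : 0 < e / 2 by rewrite divr_gt0.
  have [t1 t10 T1] := continuous_near_abs cF e2.
  have rs0 : 0 < r - `|a s - a s0| by rewrite subr_gt0.
  have [t2 t20 T2] := continuous_near_abs (lin (a s) v1) rs0.
  near=> t.
  have t0 : 0 < t by near: t; exact: nbhs_right_gt.
  have tt1 : t < t1 by near: t; exact: nbhs_right_lt.
  have tt2 : t < t2 by near: t; exact: nbhs_right_lt.
  have kpos : 0 < k * (b s + t * v2 - h (a s + t * v1)) by near: t; exact: near1.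
  split.
    rewrite kpos /= -(gtr0_norm kpos) normrM.
    have -> : `|k| = 1 by exact: normr_sign.
    have := T1 t; rewrite mul1r !mul0r !addr0 -bs subrr !subr0 (gtr0_norm t0).
    by move=> /(_ tt1).
  have := T2 t; rewrite mul0r addr0 subr0 gtr0_norm// => /(_ tt2).
  rewrite (_ : a s + t * v1 - a s0 = (a s + t * v1 - a s) + (a s - a s0)); last by ring.
  by move=> ?; apply: (le_lt_trans (ler_normD _ _)); rewrite -ltrBrDr.
have [sg [sg2 n1 n2]] := sb_normal_sign sb s0.
have s0d : `|s0 - s0| < d by rewrite subrr normr0.
have a0r : `|a s0 - a s0| < r by rewrite subrr normr0.
have sgN s k : k ^+ 2 = 1 -> N1 s = - k * db s -> N2 s = k * da s ->
    0 < k * (N2 s * da s - N1 s * db s).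
  move=> k2 -> ->.
  rewrite (_ : k * _ = k ^+ 2 * (da s ^+ 2 + db s ^+ 2)); last by ring.
  by rewrite k2 (sb_unit sb) mulr1.
have outside (y : R * R) : `|y.1 - a s0| < r2 -> 0 < sg * (y.2 - h y.1) < e / 2 -> ~ Om y.
  move=> y1 yk Oy.
  (* A point of the domain on this side could be joined to points of the outward ray at [s0], which
     are outside. *)
  have nn := move_side s0 sg (N1 s0) (N2 s0) sg2 s0d a0r (sgN s0 sg sg2 n1 n2).
  near (0 : R)^'+ => t.
  have [tk tr] : 0 < sg * (b s0 + t * N2 s0 - h (a s0 + t * N1 s0)) < e / 2 /\
      `|a s0 + t * N1 s0 - a s0| < r by near: t; exact: nn.
  have : ~ Om (a s0 + t * N1 s0, b s0 + t * N2 s0) by near: t; exact: sb_out sb s0.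
  by apply; apply: (side_conn sg y) => //=; exact: lt_le_trans tr rr2.
have msg2 : (- sg) ^+ 2 = 1 by rewrite sqrrN.
have inside (y : R * R) : `|y.1 - a s0| < r2 -> 0 < - sg * (y.2 - h y.1) < e / 2 -> Om y.
  move=> y1 yk.
  (* The closure provides one point [z] of the domain in the box. It is neither on the outer side
     nor on the curve, so it is on this side, and [side_conn] spreads it over the whole side. *)
  have [cl _] := sb_on sb s0.
  have [z [Oz]] : Om `&` ball (a s0, b s0) r !=set0.
    by apply: cl; exact: nbhsx_ballx.
  rewrite /ball /= => -[z1 z2]; rewrite /ball /= in z1 z2.
  rewrite distrC in z1; rewrite distrC in z2.
  have zb := box z z1 z2.
  have zr2 : `|z.1 - a s0| < r2 by exact: lt_le_trans z1 rr2.
  have nsg : `|sg| = 1 by exact: normr_sign.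
  apply: (side_conn (- sg) z) => //.
  have zs : `|sg * (z.2 - h z.1)| < e / 2 by rewrite normrM nsg mul1r.
  have [sz|sz|sz] := ltgtP 0 (sg * (z.2 - h z.1)).
  - by exfalso; apply: (outside z zr2) => //; rewrite sz -(gtr0_norm sz).
  - by move: zs; rewrite ltr0_norm// mulNr => ->; rewrite oppr_gt0 sz.
  - exfalso; have zh : z.2 = h z.1.
      apply/eqP; rewrite -subr_eq0; apply/eqP.
      have sgn0 : sg != 0 by rewrite -normr_eq0 nsg oner_eq0.
      by apply: (mulfI sgn0); rewrite mulr0.
    have [gd ag _] := Hg z.1 (inI _ zr2).
    have [_ bg _] := curve (g z.1) gd.
    have := (sb_on sb (g z.1)).2; apply.
    by rewrite bg ag -zh -surjective_pairing.
exists d, r, sg, h, dh; split => //.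
- by rewrite d0 (le_lt_trans dL).
- move=> y yr; exists (g y); have [? ? _] := Hg y (inI y (lt_le_trans yr rr2)); by [].
- by move=> y yr; apply: Dh; apply: inI; exact: lt_le_trans yr rr2.
- move=> y y1 y2; have yb := box y y1 y2.
  have yr2 : `|y.1 - a s0| < r2 by exact: lt_le_trans y1 rr2.
  have nsg : `|sg| = 1 by exact: normr_sign.
  have ys : `|sg * (y.2 - h y.1)| < e / 2 by rewrite normrM nsg mul1r.
  split => [Oy|sy]; last first.
    by apply: inside => //; move: ys; rewrite ltr0_norm// mulNr => ->; rewrite oppr_gt0 sy.
  rewrite ltNge le_eqVlt; apply/negP => /orP[/eqP sz|sy].
    have zh : y.2 = h y.1.
      apply/eqP; rewrite -subr_eq0; apply/eqP.
      have sgn0 : sg != 0 by rewrite -normr_eq0 nsg oner_eq0.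
      by apply: (mulfI sgn0); rewrite mulr0.
    have [gd ag _] := Hg y.1 (inI _ yr2).
    have [_ bg _] := curve (g y.1) gd.
    have := (sb_on sb (g y.1)).2; apply.
    by rewrite bg ag -zh -surjective_pairing.
  by apply: (outside y yr2) => //; rewrite sy -(gtr0_norm sy).
- move=> s sL s1 s2; rewrite ltNge; apply/negP => ds.
  have re' := le_trans rr2 r2e.
  by apply: (He s ds sL); [exact: lt_le_trans s1 re'|exact: lt_le_trans s2 re'].
- move=> s sd s1 s2.
  (* With the opposite sign the normal at [s] would point to the inner side, against [sb_out]. *)
  have [k [k2 m1 m2]] := sb_normal_sign sb s.
  suff -> : sg = k by [].
  have : (k - sg) * (k + sg) = 0 by rewrite -subr_sqr k2 sg2 subrr.
  move/eqP; rewrite mulf_eq0 => /orP[|]; first by rewrite subr_eq0 => /eqP.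
  rewrite addr_eq0 => /eqP ksg; exfalso.
  have nn := move_side s k (N1 s) (N2 s) k2 sd s1 (sgN s k k2 m1 m2).
  near (0 : R)^'+ => t.
  have [tk tr] : 0 < k * (b s + t * N2 s - h (a s + t * N1 s)) < e / 2 /\
      `|a s + t * N1 s - a s0| < r by near: t; exact: nn.
  have : ~ Om (a s + t * N1 s, b s + t * N2 s) by near: t; exact: sb_out sb s.
  by apply; apply: inside; rewrite /= -?ksg//; exact: lt_le_trans tr rr2.
Unshelve. all: by end_near. Qed.

End local_graph.

(** * The divergence theorem *)

Lemma continuous_at_pair (T U V : topologicalType) (f : T -> U) (g : T -> V) (x : T) :
  {for x, continuous f} -> {for x, continuous g} ->
  {for x, continuous (fun t => (f t, g t))}.
Proof. by move=> cf cg; exact: (cvg_pair cf cg). Qed.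

Section bounded_support.
Context {R : realType}.
Local Notation mu := (@lebesgue_measure R).
Local Notation R2 := (measurableTypeR R * measurableTypeR R)%type.
Local Notation mu2 := (mu \x mu)%E.

Definition bounded_support (f : R2 -> R) := exists M C : R,
  forall y, `|f y| <= C /\ (f y != 0 -> `|y.1| < M /\ `|y.2| < M).

Lemma Rintegral_support (f : R -> R) (D : set R) :
  (forall x, f x != 0 -> D x) -> (\int[mu]_x f x = \int[mu]_(x in D) f x)%R.
Proof.
move=> fD; rewrite [RHS]Rintegral_mkcond; apply: eq_Rintegral => x _.
rewrite patchE; case: ifPn => // xD; apply/eqP; apply: contraNT xD => /fD.
by move=> ?; apply/mem_set.
Qed.

Lemma bounded_support_integrable1 (f : R -> R) (M C : R) : measurable_fun setT f ->
  (forall x, `|f x| <= C) -> (forall x, f x != 0 -> `|x| < M) ->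
  mu.-integrable setT (EFin \o f).
Proof.
move=> mf fC fM.
have -> : EFin \o f = (EFin \o f) \_ (`[- M, M]%classic : set R).
  apply/funext => x; rewrite patchE; case: ifPn => //= xM.
  suff -> : f x = 0 by [].
  apply/eqP; apply: contraNT xM => /fM; rewrite ltr_norml => /andP[? ?].
  by apply/mem_set => /=; rewrite in_itv /=; apply/andP; split; exact: ltW.
apply: (integrable_mkcond _ _).1 => //.
apply: (@bounded_interval_integrable _ _ (- M) M C) => //.
exact: measurable_funTS.
Qed.

Lemma bounded_support_integrable (f : R2 -> R) :
  measurable_fun setT f -> bounded_support f -> mu2.-integrable setT (EFin \o f).
Proof.
move=> mf [M [C fMC]].
pose D : set R2 := [set y | `|y.1| < M /\ `|y.2| < M].
have mD : measurable D.
  rewrite (_ : D = [set y | `|y.1| < M] `&` [set y | `|y.2| < M]) //.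
  apply: measurableI.
    rewrite -[X in measurable X]setTI; apply: open_measurable_plane; rewrite setTI.
    apply: (@open_comp _ _ (fun y : R * R => `|y.1|) [set x | x < M]).
      by move=> y _; apply: cvg_norm; exact: cvg_fst.
    exact: open_lt.
  rewrite -[X in measurable X]setTI; apply: open_measurable_plane; rewrite setTI.
  apply: (@open_comp _ _ (fun y : R * R => `|y.2|) [set x | x < M]).
    by move=> y _; apply: cvg_norm; exact: cvg_snd.
  exact: open_lt.
have -> : EFin \o f = (EFin \o f) \_ D.
  apply/funext => x; rewrite patchE; case: ifPn => //= xM.
  suff -> : f x = 0 by [].
  by apply/eqP; apply: contraNT xM => /(fMC x).2 ?; exact/mem_set.
apply: (integrable_mkcond _ _).1 => //.
apply: (@bounded_plane_integrable _ _ M C) => //.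
  exact: measurable_funTS.
by move=> y _; case: (fMC y).
Qed.

Lemma bounded_support_Fubini1 (f : R2 -> R) :
  measurable_fun setT f -> bounded_support f ->
  (\int[mu2]_y f y)%R = (\int[mu]_x \int[mu]_y f (x, y))%R.
Proof.
move=> mf bf; have intf := bounded_support_integrable mf bf.
rewrite /Rintegral -integral12_prod_meas1//; congr fine.
apply: eq_integral => x _; rewrite /fubini_F fineK//.
apply: integrable_fin_num => //; case: bf => M [C fMC].
apply: (@bounded_support_integrable1 (fun y => f (x, y)) M C).
- exact: measurable_fun_pair2.
- by move=> y; case: (fMC (x, y)).
- by move=> y /(fMC (x, y)).2[].
Qed.

Lemma bounded_support_Fubini2 (f : R2 -> R) :
  measurable_fun setT f -> bounded_support f ->
  (\int[mu2]_y f y)%R = (\int[mu]_y \int[mu]_x f (x, y))%R.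
Proof.
move=> mf bf; have intf := bounded_support_integrable mf bf.
rewrite /Rintegral -integral21_prod_meas1//; congr fine.
apply: eq_integral => y _; rewrite /fubini_G fineK//.
apply: integrable_fin_num => //; case: bf => M [C fMC].
apply: (@bounded_support_integrable1 (fun x => f (x, y)) M C).
- exact: measurable_fun_pair1.
- by move=> x; case: (fMC (x, y)).
- by move=> x /(fMC (x, y)).2[].
Qed.

Lemma Rintegral_translate (f : R -> R) (b : R) : measurable_fun setT f ->
  (\int[mu]_x f (x + b) = \int[mu]_x f x)%R.
Proof.
move=> mf; rewrite /Rintegral; congr fine.
by apply: (@integral_translate _ (EFin \o f) b); exact/measurable_EFinP.
Qed.

Lemma continuous_bounded_box (f : R * R -> R) (M : R) : continuous f ->
  exists C, forall y, `|y.1| <= M -> `|y.2| <= M -> `|f y| <= C.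
Proof.
move=> cf.
have cA : compact (`[- M, M]%classic `*` `[- M, M]%classic : set (R * R)).
  by apply: compact_setX; exact: segment_compact.
have := continuous_compact (continuous_subspaceT cf) cA.
move/compact_bounded => [C [_ HC]]; exists (C + 1) => y y1 y2.
apply: HC; first by rewrite ltrDl.
by exists y => //; split; rewrite /= in_itv /= -ler_norml.
Qed.

Lemma continuous_bounded_segment (f : R -> R) (p q : R) : continuous f ->
  exists C, forall x, p <= x <= q -> `|f x| <= C.
Proof.
move=> cf.
have := continuous_compact (continuous_subspaceT cf) (@segment_compact R p q).
move/compact_bounded => [C [_ HC]]; exists (C + 1) => x xpq.
by apply: HC; [rewrite ltrDl|exists x => //=; rewrite in_itv].
Qed.

End bounded_support.

(** * The divergence theorem on one side of a graph *)

Section strip.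
Context {R : realType}.
Local Notation mu := (@lebesgue_measure R).
Local Notation R2 := (measurableTypeR R * measurableTypeR R)%type.
Local Notation mu2 := (mu \x mu)%E.

(** Continuous differentiability with gradient [(phi1, phi2)], stated as a chain rule along plane
    curves: this is the form in which it is applied, to vertical lines and to translates of a
    graph. *)
Definition c1_plane (phi phi1 phi2 : R * R -> R) :=
  [/\ continuous phi, continuous phi1, continuous phi2 &
    forall (u v : R -> R) (s u' v' : R), is_derive s (1 : R) u u' ->
      is_derive s (1 : R) v v' ->
      is_derive s (1 : R) (fun t => phi (u t, v t))
        (phi1 (u s, v s) * u' + phi2 (u s, v s) * v')].

Let side (sg w : R) : R := if sg * w < 0 then 1 else 0.

Let measurable_side sg : measurable_fun setT (side sg).
Proof.
apply: measurable_fun_if => //; apply: (measurable_fun_bool true).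
rewrite setTI (_ : _ @^-1` _ = [set w | sg * w < 0]); last first.
  by apply/seteqP; split => w /=; case: (_ < _).
apply: open_measurable.
apply: (@open_comp _ _ (fun w : R => sg * w) [set x | x < 0]); last exact: open_lt.
by move=> w _; apply: cvgM; [exact: cvg_cst|exact: cvg_id].
Qed.

Let side_le1 sg w : `|side sg w| <= 1.
Proof. by rewrite /side; case: ifP => _; rewrite ?normr1 ?normr0. Qed.

(** The half-line is to the left or to the right of 0 according to [sg], and [F] vanishes at its far
    end. *)
Let integral_side (sg : R) (F f : R -> R) (M : R) : sg ^+ 2 = 1 -> 0 < M ->
  continuous f -> (forall w, is_derive w (1 : R) F (f w)) ->
  (forall w, M <= `|w| -> f w = 0 /\ F w = 0) ->
  (\int[mu]_w (side sg w * f w))%R = sg * F 0.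
Proof.
move=> sg2 M0 cf dF fM.
have FM0 : F M = 0 by apply: (fM _ _).2; rewrite gtr0_norm.
have FN0 : F (- M) = 0 by apply: (fM _ _).2; rewrite normrN gtr0_norm.
have : (sg == 1) || (sg == -1) by rewrite -sqrf_eq1 sg2.
have ci (p q : R) b1 b2 : mu.-integrable [set` Interval (BSide b1 p) (BSide b2 q)] (EFin \o f).
  apply: (integrableS _ _ _ (continuous_interval_integrable p q cf)) => //.
  by apply: subset_itv; rewrite bnd_simp; case: b1; case: b2.
move=> /orP[/eqP ->|/eqP ->].
  transitivity (\int[mu]_(w in `[- M, 0[) f w)%R.
    rewrite [RHS]Rintegral_mkcond; apply: eq_Rintegral => w _.
    rewrite /side mul1r patchE; case: ifPn => w0.
      rewrite mul1r; case: ifPn => // wI.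
      apply: (fM _ _).1; move: wI; rewrite notin_setE /= in_itv /= w0 andbT ltr0_norm//.
      by move/negP; rewrite -ltNge => ?; lra.
    rewrite mul0r; case: ifPn => //; rewrite inE /= in_itv /= => /andP[_].
    by move=> h; rewrite h in w0.
  rewrite Rintegral_itv_bndo_bndc// (@FTC2_continuous _ F)//; last by lra.
  by rewrite FN0; ring.
transitivity (\int[mu]_(w in `]0, M]) f w)%R.
  rewrite [RHS]Rintegral_mkcond; apply: eq_Rintegral => w _.
  rewrite /side mulN1r oppr_lt0 patchE; case: ifPn => w0.
    rewrite mul1r; case: ifPn => // wI.
    apply: (fM _ _).1; move: wI; rewrite notin_setE /= in_itv /= w0 /= gtr0_norm//.
    by move/negP; rewrite -ltNge => ?; lra.
  rewrite mul0r; case: ifPn => //; rewrite inE /= in_itv /= => /andP[h _].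
  by rewrite h in w0.
rewrite Rintegral_itv_obnd_cbnd// (@FTC2_continuous _ F)//; last by lra.
by rewrite FM0; ring.
Qed.

Variables (h dh : R -> R) (p q M sg : R) (phi phi1 phi2 : R * R -> R).
Hypotheses (pq : p < q) (ch : continuous h) (cdh : continuous dh).
Hypothesis Dh : forall y, p < y < q -> is_derive y (1 : R) h (dh y).
Hypothesis sg2 : sg ^+ 2 = 1.
Hypothesis Cphi : c1_plane phi phi1 phi2.
Hypothesis supp : forall y, ~ (p < y.1 < q /\ `|y.2| < M) ->
  [/\ phi y = 0, phi1 y = 0 & phi2 y = 0].

Let M1 := Num.max `|p| `|q| + `|M| + 1.

Let inM1 x : p <= x <= q -> `|x| < M1.
Proof.
move=> /andP[px xq]; have := normr_ge0 M.
have h1 : `|p| <= Num.max `|p| `|q| by rewrite le_max lexx.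
have h2 : `|q| <= Num.max `|p| `|q| by rewrite le_max lexx orbT.
have := ler_norm q; have := ler_norm (- p); rewrite normrN => ? ? ?.
by rewrite ltr_norml /M1; apply/andP; split; lra.
Qed.

Let MM1 : M < M1.
Proof.
have h1 : `|p| <= Num.max `|p| `|q| by rewrite le_max lexx.
by have := normr_ge0 p; have := ler_norm M; rewrite /M1; lra.
Qed.

(** The integrand after the shear [(x, w) -> (x, w + h x)], which turns the side of the graph into a
    half-plane. The factor [m] is there because a horizontal derivative in the sheared coordinates
    produces [dh] times [phi2]. *)
Let K (m : R -> R) (f : R * R -> R) (y : R2) : R :=
  side sg y.2 * (m y.1 * f (y.1, y.2 + h y.1)).

Let measurable_K m f : continuous m -> continuous f -> measurable_fun setT (K m f).
Proof.
move=> cm cf; apply: measurable_funM.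
  exact: (measurableT_comp (measurable_side sg) measurable_snd).
apply: continuous_measurable_plane => y; apply: cvgM.
  by apply: (@continuous_comp _ _ _ fst m); [exact: cvg_fst|exact: cm].
apply: (@continuous_comp _ _ _ (fun y : R * R => (y.1, y.2 + h y.1)) f); last exact: cf.
apply: continuous_at_pair; first exact: cvg_fst.
apply: cvgD; first exact: cvg_snd.
by apply: (@continuous_comp _ _ _ fst h); [exact: cvg_fst|exact: ch].
Qed.

Let bounded_K m f : continuous m -> continuous f ->
  (forall y, ~ (p < y.1 < q /\ `|y.2| < M) -> f y = 0) ->
  bounded_support (K m f).
Proof.
move=> cm cf f0.
have [Cm HCm] := continuous_bounded_segment p q cm.
have [Ch HCh] := continuous_bounded_segment p q ch.
have [Cf HCf] := continuous_bounded_box M1 cf.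
exists (M1 + `|Ch|), (`|Cm| * `|Cf|) => y.
have [[yI yM]|yout] := pselect (p < y.1 < q /\ `|y.2 + h y.1| < M); last first.
  have -> : K m f y = 0 by rewrite /K f0// !mulr0.
  by rewrite normr0 mulr_ge0// eqxx.
have yI' : p <= y.1 <= q by case/andP: yI => ? ?; apply/andP; split; exact: ltW.
split.
  rewrite /K !normrM -[leRHS]mul1r; apply: ler_pM => //.
  apply: ler_pM => //; first exact: (le_trans (HCm _ yI') (ler_norm _)).
  apply: (le_trans _ (ler_norm Cf)); apply: HCf => /=; first exact/ltW/inM1.
  by apply: ltW; exact: lt_trans yM MM1.
move=> _; split.
  by have := inM1 yI'; have := normr_ge0 Ch; lra.
rewrite (_ : y.2 = (y.2 + h y.1) - h y.1); last by ring.
apply: (le_lt_trans (ler_normB _ _)).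
by have := le_trans (HCh _ yI') (ler_norm Ch); have := MM1; lra.
Qed.

(** On each vertical line the shear is a translation, so that Fubini and the invariance of Lebesgue
    measure replace a change of variables in the plane. *)
Let shear f : continuous f ->
  (forall y, ~ (p < y.1 < q /\ `|y.2| < M) -> f y = 0) ->
  (\int[mu2]_(y in [set y : R2 | sg * (y.2 - h y.1) < 0]%R) f y)%R =
  (\int[mu2]_y K (fun=> 1) f y)%R.
Proof.
move=> cf f0; have c1 : continuous (fun _ : R => 1 : R) by move=> ?; exact: cvg_cst.
pose G (y : R2) := side sg (y.2 - h y.1) * f y.
have mG : measurable_fun setT G.
  apply: measurable_funM; last exact: continuous_measurable_plane.
  apply: (measurableT_comp (measurable_side sg)).
  apply: continuous_measurable_plane => y; apply: cvgB; first exact: cvg_snd.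
  by apply: (@continuous_comp _ _ _ fst h); [exact: cvg_fst|exact: ch].
have [Cf HCf] := continuous_bounded_box M1 cf.
have bG : bounded_support G.
  exists M1, `|Cf| => y.
  have [[yI yM]|yout] := pselect (p < y.1 < q /\ `|y.2| < M); last first.
    by rewrite /G f0// mulr0 normr0 eqxx.
  have yI' : p <= y.1 <= q by case/andP: yI => ? ?; apply/andP; split; exact: ltW.
  split; last by move=> _; split; [exact: inM1|exact: lt_trans yM MM1].
  rewrite /G normrM -[leRHS]mul1r; apply: ler_pM => //.
  apply: (le_trans _ (ler_norm Cf)); apply: HCf => /=; first exact/ltW/inM1.
  by apply: ltW; exact: lt_trans yM MM1.
transitivity (\int[mu2]_y G y)%R.
  rewrite Rintegral_mkcond; apply: eq_Rintegral => y _; rewrite patchE /G /side.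
  case: ifPn => [/set_mem /= -> |]; first by rewrite mul1r.
  by rewrite notin_setE /= => /negP/negbTE ->; rewrite mul0r.
rewrite (bounded_support_Fubini1 mG bG).
rewrite bounded_support_Fubini1; [|exact: measurable_K|exact: bounded_K].
apply: eq_Rintegral => x _.
rewrite -(@Rintegral_translate _ (fun y => G (x, y)) (h x)); last first.
  exact: measurable_fun_pair2.
by apply: eq_Rintegral => w _; rewrite /K /G /= mul1r addrK.
Qed.

(** On vertical lines [phi2] is a derivative, and only the value at [w = 0], on the graph,
    survives. *)
Let integral_K2 m : continuous m ->
  (\int[mu2]_y K m phi2 y)%R = (\int[mu]_(x in `[p, q]) (sg * (m x * phi (x, h x))))%R.
Proof.
case: Cphi => cp cp1 cp2 dp cm.
have s2 y : ~ (p < y.1 < q /\ `|y.2| < M) -> phi2 y = 0 by move/supp => [].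
rewrite bounded_support_Fubini1; [|exact: measurable_K|exact: bounded_K].
transitivity (\int[mu]_x (sg * (m x * phi (x, h x))))%R; last first.
  apply: Rintegral_support => x nz /=; rewrite in_itv /=.
  apply: contraNT nz => xI; have [] := @supp (x, h x); last by move=> -> _ _; rewrite !mulr0.
  by move=> [/= /andP[? ?] _]; apply: (negP xI); apply/andP; split; exact: ltW.
apply: eq_Rintegral => x _; rewrite /K /=.
have -> : m x * phi (x, h x) = m x * phi (x, 0 + h x) by rewrite add0r.
apply: (@integral_side sg (fun w => m x * phi (x, w + h x))
  (fun w => m x * phi2 (x, w + h x)) (`|M| + `|h x| + 1)) => //.
- move=> w; apply: cvgM; first exact: cvg_cst.
  apply: (@continuous_comp _ _ _ (fun w => (x, w + h x)) phi2); last exact: cp2.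
  apply: continuous_at_pair; first exact: cvg_cst.
  by apply: cvgD; [exact: cvg_id|exact: cvg_cst].
- move=> w.
  have Dx := dp (fun=> x) (fun w => w + h x) w 0 (1 + 0) (is_derive1_cst x w)
    (is_derive1_add (is_derive1_id w) (is_derive1_cst (h x) w)).
  by apply: (is_derive1_eq (is_derive1_mul (is_derive1_cst (m x) w) Dx)); ring.
- move=> w wM.
  have [|-> _ ->] := @supp (x, w + h x); last by rewrite !mulr0.
  move=> [_ /=]; have : `|w| <= `|w + h x| + `|h x|.
    by rewrite -[in leLHS](addrK (h x) w); exact: ler_normB.
  by have := ler_norm M; lra.
Qed.

(** On the horizontal line at level [w] the integrand is the derivative of [phi (x, w + h x)], which
    vanishes at [p] and at [q]. *)
Let integral_K12 :
  (\int[mu2]_y (K (fun=> 1) phi1 y + K dh phi2 y))%R = 0.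
Proof.
case: Cphi => cp cp1 cp2 dp.
have c1 : continuous (fun _ : R => 1 : R) by move=> ?; exact: cvg_cst.
have s2 y : ~ (p < y.1 < q /\ `|y.2| < M) -> phi2 y = 0 by move/supp => [].
have s1 y : ~ (p < y.1 < q /\ `|y.2| < M) -> phi1 y = 0 by move/supp => [].
have [A1 [B1 H1]] := bounded_K c1 cp1 s1.
have [A2 [B2 H2]] := bounded_K cdh cp2 s2.
have c2 (u : R -> R) (f : R * R -> R) w : continuous f -> continuous u ->
    continuous (fun x : R => f (x, w + u x)).
  move=> cf cu x; apply: (@continuous_comp _ _ _ (fun x => (x, w + u x)) f); last exact: cf.
  apply: continuous_at_pair; first exact: cvg_id.
  by apply: cvgD; [exact: cvg_cst|exact: cu].
rewrite bounded_support_Fubini2; last 2 first.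
- by apply: measurable_funD; exact: measurable_K.
- exists (Num.max A1 A2), (B1 + B2) => y; have [h1 h1'] := H1 y; have [h2 h2'] := H2 y.
  split; first by apply: (le_trans (ler_normD _ _)); exact: lerD.
  move=> nz; rewrite !lt_max; have [e1|/h1'[-> ->]//] := eqVneq (K (fun=> 1) phi1 y) 0.
  by move: nz; rewrite e1 add0r => /h2'[-> ->]; rewrite !orbT.
rewrite (_ : (fun y => _) = (fun=> 0)); first by rewrite Rintegral_cst// mul0r.
apply/funext => w.
pose f x := phi1 (x, w + h x) + phi2 (x, w + h x) * dh x.
have cf : continuous f.
  move=> x; apply: cvgD; first exact: c2.
  by apply: cvgM; [exact: c2|exact: cdh].
have f0 x : ~ (p < x < q) -> f x = 0.
  move=> xI; have [|_ e1 e2] := @supp (x, w + h x); first by case.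
  by rewrite /f e1 e2 mul0r addr0.
have phi0 x : ~ (p < x < q) -> phi (x, w + h x) = 0.
  by move=> xI; have [|-> //] := @supp (x, w + h x); case.
transitivity (\int[mu]_x (side sg w * f x))%R.
  by apply: eq_Rintegral => x _; rewrite /K /f /=; ring.
rewrite RintegralZl//; last first.
  have [C HC] := continuous_bounded_segment p q cf.
  apply: (@bounded_support_integrable1 _ f M1 `|C|).
  - exact: continuous_measurable_fun.
  - move=> x; have [xI|/f0 ->] := pselect (p < x < q); last by rewrite normr0.
    by apply: (le_trans (HC x _) (ler_norm C)); case/andP: xI => ? ?; apply/andP; split; exact: ltW.
  - move=> x nz; apply: inM1; apply/andP; apply: contrapT => xI; move/eqP: nz; apply.
    by apply: f0 => /andP[? ?]; apply: xI; split; exact: ltW.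
rewrite (@Rintegral_support _ f `[p, q]%classic); last first.
  move=> x nz /=; rewrite in_itv /=; apply: contraNT nz => xI.
  by rewrite f0// => /andP[? ?]; apply: (negP xI); apply/andP; split; exact: ltW.
have ce : continuous (fun x : R => phi (x, w + h x)) by exact: c2.
rewrite /Rintegral (@continuous_FTC2 _ f (fun x => phi (x, w + h x)))//.
- have -> : phi (p, w + h p) = 0 by apply: phi0; rewrite ltxx.
  have -> : phi (q, w + h q) = 0 by apply: phi0; rewrite ltxx andbF.
  by rewrite /= subrr mulr0.
- exact: continuous_subspaceT.
- split => [x xpq||].
  + have Dhx : is_derive x (1 : R) h (dh x) by apply: Dh; move: xpq; rewrite in_itv.
    have := dp (fun t => t) (fun t => w + h t) x 1 (0 + dh x) (is_derive1_id x)
      (is_derive1_add (is_derive1_cst w x) Dhx).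
    by case.
  + by apply: cvg_at_right_filter; exact: ce.
  + by apply: cvg_at_left_filter; exact: ce.
- move=> x xpq.
  have Dhx : is_derive x (1 : R) h (dh x) by apply: Dh; move: xpq; rewrite in_itv.
  have := dp (fun t => t) (fun t => w + h t) x 1 (0 + dh x) (is_derive1_id x)
      (is_derive1_add (is_derive1_cst w x) Dhx).
  by rewrite derive1E => D; rewrite (@derive_val _ _ _ _ _ _ _ D) /f; ring.
Qed.

Lemma strip_gauss2 :
  (\int[mu2]_(y in [set y : R2 | sg * (y.2 - h y.1) < 0]%R) phi2 y)%R =
  (\int[mu]_(x in `[p, q]) (sg * phi (x, h x)))%R.
Proof.
case: Cphi => cp cp1 cp2 dp; rewrite shear//; last by move=> y /supp[].
rewrite integral_K2; last by move=> ?; exact: cvg_cst.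
by apply: eq_Rintegral => x _; rewrite mul1r.
Qed.

(** By [integral_K12] the derivative [phi1] may be exchanged for [- dh phi2], which leaves a
    vertical integration. *)
Lemma strip_gauss1 :
  (\int[mu2]_(y in [set y : R2 | sg * (y.2 - h y.1) < 0]%R) phi1 y)%R =
  (- \int[mu]_(x in `[p, q]) (sg * (dh x * phi (x, h x))))%R.
Proof.
case: Cphi => cp cp1 cp2 dp; rewrite shear//; last by move=> y /supp[].
have c1 : continuous (fun _ : R => 1 : R) by move=> ?; exact: cvg_cst.
rewrite -integral_K2//; apply/eqP; rewrite -subr_eq0 opprK; apply/eqP.
rewrite -RintegralD//.
  apply: bounded_support_integrable; first exact: measurable_K.
  by apply: bounded_K => // y /supp[].
apply: bounded_support_integrable; first exact: measurable_K.
by apply: bounded_K => // y /supp[].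
Qed.

End strip.

(** * Symmetries of the boundary data *)

Section transport.
Context {R : realType}.
Variables (L : R) (a b da db N1 N2 : R -> R) (Om : set (R * R)).
Hypothesis sb : smooth_boundary L a b da db N1 N2 Om.

Lemma continuous_swap : continuous (fun y : R * R => (y.2, y.1)).
Proof. by move=> y; apply: continuous_at_pair; [exact: cvg_snd|exact: cvg_fst]. Qed.

Lemma closure_swap (A : set (R * R)) (p q : R) :
  closure [set y | A (y.2, y.1)] (p, q) -> closure A (q, p).
Proof.
move=> cA B nB.
have [y [/= Ay By]] := cA _ (continuous_swap (nB : nbhs ((p, q).2, (p, q).1) B)).
by exists (y.2, y.1).
Qed.

Lemma sb_swap : smooth_boundary L b a db da N2 N1 [set y | Om (y.2, y.1)].
Proof.
case: sb => L0 per Da Db cda cdb un inj nu no np out op on bd [M bM]; split => //.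
- by move=> s; case: (per s).
- by move=> s; rewrite addrC.
- by move=> s s' ss bb aa; exact: inj.
- by move=> s; rewrite addrC.
- by move=> s; rewrite addrC.
- by move=> s; case: (np s).
- by apply: open_comp => // y _; exact: continuous_swap.
- move=> s; have [cl no'] := on s; split => //.
  by apply: closure_swap => /=; rewrite (_ : [set _ | _] = Om)//; apply/seteqP; split => -[].
- move=> [p q] cl nO; have [//|s [-> ->]] := bd (q, p) (closure_swap cl); by exists s.
- by exists M => y /bM[].
Qed.

Lemma sb_reverse : smooth_boundary L (a \o -%R) (b \o -%R) (fun s => - da (- s))
  (fun s => - db (- s)) (N1 \o -%R) (N2 \o -%R) Om.
Proof.
case: sb => L0 per Da Db cda cdb un inj nu no np out op on bd bM.
have rev (f : R -> R) (s : R) : (forall t, f (t + L) = f t) -> f (- (s + L)) = f (- s).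
  by move=> fL; rewrite opprD -(fL (- s - L)) subrK.
have cN (f : R -> R) : continuous f -> continuous (fun s => - f (- s)).
  move=> cf s; apply: cvgN; apply: (@continuous_comp _ _ _ -%R f); last exact: cf.
  exact: opp_continuous.
have dN (f df : R -> R) : (forall s, is_derive s (1 : R) f (df s)) ->
    forall s, is_derive s (1 : R) (f \o -%R) (- df (- s)).
  move=> Df s.
  have D := @is_derive1_compose _ f -%R s _ _ (Df (- s)) (is_derive1_opp (is_derive1_id s)).
  by rewrite -mulrN1; exact: D.
split => //.
- by move=> s /=; rewrite !rev// => t; case: (per t).
- exact: dN.
- exact: dN.
- exact: cN.
- exact: cN.
- by move=> s; rewrite !sqrrN un.
- move=> s s' ss aa bb; apply: oppr_inj; apply: inj => //.
  by rewrite opprK addrC distrC.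
- by move=> s; exact: nu.
- by move=> s /=; rewrite !mulrN -opprD no oppr0.
- by move=> s /=; rewrite !rev// => t; case: (np t).
- by move=> s; exact: out.
- by move=> s; exact: on.
- by move=> y cl nO; have [s ->] := bd y cl nO; exists (- s); rewrite /= opprK.
Qed.

End transport.

(** * Continuity of the normal and local sides of the boundary *)

Section normal_field.
Context {R : realType}.

(** To first order the domain at a boundary point is an open half-plane of directions. The tangent
    directions are left undecided; they form a null set. *)
Definition local_sides (a b N1 N2 : R -> R) (Om : set (R * R)) (s0 : R) :=
  [/\ {for s0, continuous N1}, {for s0, continuous N2},
    forall v1 v2, v1 * N1 s0 + v2 * N2 s0 < 0 ->
      \forall t \near 0^'+, Om (a s0 + t * v1, b s0 + t * v2) &
    forall v1 v2, 0 < v1 * N1 s0 + v2 * N2 s0 ->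
      \forall t \near 0^'+, ~ Om (a s0 + t * v1, b s0 + t * v2)].

(** In a chart the normal is the rotated tangent with one fixed sign, hence continuous; the side on
    which a ray runs is read off the derivative of its height above the graph. *)
Lemma local_sides_pos L a b da db N1 N2 (Om : set (R * R)) s0 :
  smooth_boundary L a b da db N1 N2 Om -> 0 < da s0 ->
  local_sides a b N1 N2 Om s0.
Proof.
move=> sb das0; have [d [r [sg [h [dh gc]]]]] := local_graph_chart sb das0.
have r0 := gc_r gc; have /andP[d0 _] := gc_d gc.
have [e1 e10 H1] := continuous_near_abs (sb_continuous_a sb (x := s0)) r0.
have [e2 e20 H2] := continuous_near_abs (sb_continuous_b sb (x := s0)) r0.
have nearN : \forall s \near s0, N1 s = - sg * db s /\ N2 s = sg * da s.
  apply/nbhs_ballP; exists (Num.min d (Num.min e1 e2)); first by rewrite /= !lt_min d0 e10 e20.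
  move=> s; rewrite /ball /= distrC !lt_min => /and3P[sd s1 s2].
  by apply: (gc_normal gc); [exact: sd|exact: H1|exact: H2].
have s0d : `|s0 - s0| < d by rewrite subrr normr0.
have a0r : `|a s0 - a s0| < r by rewrite subrr normr0.
have b0r : `|b s0 - b s0| < r by rewrite subrr normr0.
have [n1 n2] := gc_normal gc s0d a0r b0r.
have [_ bh dbh] := gc_curve gc s0d.
have [Dh _] := gc_der gc a0r.
have hdiv : db s0 / da s0 = dh (a s0) by rewrite dbh mulfK// gt_eqF.
have move_side k v1 v2 : 0 < k * (v2 * da s0 - v1 * db s0) ->
    \forall t \near 0^'+, 0 < k * (b s0 + t * v2 - h (a s0 + t * v1)).
  move=> kv; apply: (@graph_side_near R h (a s0) (b s0) (da s0) (db s0)) => //.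
  by rewrite hdiv.
have close (u v : R) : \forall t \near (0 : R)^'+, `|u + t * v - u| < r.
  have cl : {for 0, continuous (fun t : R => u + t * v)}.
    apply: cvgD; first exact: cvg_cst.
    by apply: cvgM; [exact: cvg_id|exact: cvg_cst].
  have [t1 t10 T1] := continuous_near_abs cl r0.
  near=> t; have := T1 t; rewrite mul0r addr0 subr0 gtr0_norm; last first.
    by near: t; exact: nbhs_right_gt.
  by apply; near: t; exact: nbhs_right_lt.
split.
- have cf : {for s0, continuous (fun s => - sg * db s)}.
    by apply: cvgM; [exact: cvg_cst|exact: sb_cdb sb _].
  suff : N1 s @[s --> s0] --> - sg * db s0 by rewrite -n1.
  apply: cvg_trans cf.
  by apply: near_eq_cvg; apply: filterS nearN => s [].
- have cf : {for s0, continuous (fun s => sg * da s)}.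
    by apply: cvgM; [exact: cvg_cst|exact: sb_cda sb _].
  suff : N2 s @[s --> s0] --> sg * da s0 by rewrite -n2.
  apply: cvg_trans cf.
  by apply: near_eq_cvg; apply: filterS nearN => s [].
- move=> v1 v2 vN.
  have ms : 0 < - sg * (v2 * da s0 - v1 * db s0).
    by move: vN; rewrite n1 n2 => vN; lra.
  near=> t; apply/(gc_side gc) => /=; try by near: t; exact: close.
  rewrite -oppr_gt0 -mulNr; near: t; exact: move_side.
- move=> v1 v2 vN.
  have ms : 0 < sg * (v2 * da s0 - v1 * db s0).
    by move: vN; rewrite n1 n2 => vN; lra.
  near=> t; apply/(gc_side gc) => /=; try by near: t; exact: close.
  apply/negP; rewrite -leNgt; apply: ltW; near: t; exact: move_side.
Unshelve. all: by end_near. Qed.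

Lemma local_sides_reverse (a b N1 N2 : R -> R) (Om : set (R * R)) s0 :
  local_sides (a \o -%R) (b \o -%R) (N1 \o -%R) (N2 \o -%R) Om (- s0) ->
  local_sides a b N1 N2 Om s0.
Proof.
rewrite /local_sides /= opprK => -[c1 c2 i o]; split => //.
- rewrite (_ : N1 = (N1 \o -%R) \o -%R); last by apply/funext => s /=; rewrite opprK.
  by apply: continuous_comp => //; exact: opp_continuous.
- rewrite (_ : N2 = (N2 \o -%R) \o -%R); last by apply/funext => s /=; rewrite opprK.
  by apply: continuous_comp => //; exact: opp_continuous.
Qed.

Lemma local_sides_swap (a b N1 N2 : R -> R) (Om : set (R * R)) s0 :
  local_sides b a N2 N1 [set y | Om (y.2, y.1)] s0 ->
  local_sides a b N1 N2 Om s0.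
Proof.
move=> [c1 c2 i o]; split => // v1 v2 vN.
- by apply: i; rewrite addrC.
- by apply: o; rewrite addrC.
Qed.

(** Exchanging the coordinates and reversing the parameter bring each case to the first, in which
    the boundary is a graph over the first coordinate. *)
Lemma tangent_cases L a b da db N1 N2 (Om : set (R * R)) s0 :
  smooth_boundary L a b da db N1 N2 Om ->
  [\/ 0 < da s0, da s0 < 0, 0 < db s0 | db s0 < 0].
Proof.
move=> sb; have u := sb_unit sb s0.
have [?|?|a0] := ltgtP (da s0) 0; [by constructor 2|by constructor 1|].
have [?|?|b0] := ltgtP (db s0) 0; [by constructor 4|by constructor 3|].
by move: u; rewrite a0 b0 expr0n /= addr0 => /eqP; rewrite eq_sym oner_eq0.
Qed.

Lemma sb_local_sides L a b da db N1 N2 (Om : set (R * R)) s0 :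
  smooth_boundary L a b da db N1 N2 Om -> local_sides a b N1 N2 Om s0.
Proof.
move=> sb; have sw := sb_swap sb.
case: (tangent_cases s0 sb) => h.
- exact: local_sides_pos sb h.
- apply: local_sides_reverse; apply: local_sides_pos (sb_reverse sb) _.
  by rewrite opprK oppr_gt0.
- by apply: local_sides_swap; exact: local_sides_pos sw h.
- apply: local_sides_swap; apply: local_sides_reverse.
  by apply: local_sides_pos (sb_reverse sw) _; rewrite opprK oppr_gt0.
Qed.

End normal_field.

(** * Integrals along the boundary *)

Section curve_integral.
Context {R : realType}.
Local Notation mu := (@lebesgue_measure R).

Lemma FTC2_segment (F f : R -> R) (p q : R) : p <= q -> continuous f ->
  (forall x, p <= x <= q -> is_derive x (1 : R) F (f x)) ->
  (\int[mu]_(x in `[p, q]) f x)%R = F q - F p.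
Proof.
rewrite le_eqVlt => /orP[/eqP <- _ _|pq cf dF].
  by rewrite set_itv1 Rintegral_set1 subrr.
have cF x : p <= x <= q -> {for x, continuous F}.
  by move=> xpq; exact: is_derive_continuous (dF x xpq).
rewrite /Rintegral (@continuous_FTC2 _ f F)//.
- exact: continuous_subspaceT.
- split => [x xI||].
  + have [] // := dF x _; move: xI; rewrite in_itv /= => /andP[? ?].
    by apply/andP; split; exact: ltW.
  + by apply: cvg_at_right_filter; apply: cF; rewrite lexx ltW.
  + by apply: cvg_at_left_filter; apply: cF; rewrite lexx ltW.
- move=> x xI; rewrite derive1E; have D := dF x; apply: derive_val; apply: D.
  by move: xI; rewrite in_itv /= => /andP[? ?]; apply/andP; split; exact: ltW.
Qed.

Lemma continuous_primitive (f : R -> R) (A : R) : continuous f ->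
  exists F, forall x, A < x -> is_derive x (1 : R) F (f x).
Proof.
move=> cf; exists (fun x => (\int[mu]_(t in `[A, x]) f t)%R) => x Ax.
have [||D E] := @continuous_FTC1_closed R f A x (x + 1) _ _ Ax (cf x).
- by rewrite ltrDl.
- exact: continuous_interval_integrable.
- by rewrite -E derive1E; exact: DeriveDef.
Qed.

(** As a function of its left end x, the integral over a period has derivative
    [f (x + L) - f x = 0]. *)
Lemma periodic_integral_shift (f : R -> R) (L u v : R) : 0 < L -> continuous f ->
  (forall x, f (x + L) = f x) ->
  (\int[mu]_(x in `[u, u + L]) f x)%R = (\int[mu]_(x in `[v, v + L]) f x)%R.
Proof.
move=> L0 cf fL.
wlog uv : u v / u <= v => [H|].
  by have [?|/ltW ?] := leP u v; [exact: H|apply/esym; exact: H].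
(* The base point lies strictly to the left of [u], so that the primitive is differentiable at [u]
   itself. *)
have [F DF] := @continuous_primitive f (u - 1) cf.
have E x : u <= x -> (\int[mu]_(t in `[x, x + L]) f t)%R = F (x + L) - F x.
  move=> ux; apply: FTC2_segment => //; first by lra.
  by move=> t /andP[? ?]; apply: DF; lra.
rewrite !E//; move: uv; rewrite le_eqVlt => /orP[/eqP -> //|uv].
pose G x := F (x + L) - F x.
have DG x : u <= x <= v -> is_derive x (1 : R) G 0.
  move=> /andP[ux xv].
  have D1 : is_derive x (1 : R) F (f x) by apply: DF; lra.
  have D2 : is_derive (x + L) (1 : R) F (f (x + L)) by apply: DF; lra.
  have D3 := @is_derive1_compose _ F (fun x => x + L) x _ _ D2
    (is_derive1_add (is_derive1_id x) (is_derive1_cst L x)).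
  by apply: (is_derive1_eq (is_derive1_sub D3 D1)); rewrite fL; ring.
have [||c _] := @MVT R G (fun=> 0) u v uv.
- move=> x; rewrite in_itv /= => /andP[? ?].
  by apply: DG; apply/andP; split; exact: ltW.
- by apply: within_continuous_itv => x /DG; exact: is_derive_continuous.
- by rewrite mul0r /G => h; lra.
Qed.

Lemma Rintegral_substitution (F dF G : R -> R) (p q : R) : p <= q ->
  continuous dF -> (forall x, is_derive x (1 : R) F (dF x)) ->
  {in `[p, q] &, {homo F : x y / x < y}} -> continuous G ->
  (\int[mu]_(x in `[F p, F q]) G x)%R = (\int[mu]_(x in `[p, q]) (G (F x) * dF x))%R.
Proof.
move=> pq cdF DF inc cG.
have FdF : derive1 F = dF by apply/funext => x; rewrite derive1E; exact: derive_val.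
have cF : continuous F by move=> x; exact: is_derive_continuous (DF x).
rewrite /Rintegral (@integration_by_substitution_increasing _ F)//.
- by congr fine; apply: eq_integral => x _; rewrite FdF.
- by move=> x _; rewrite FdF; exact: cdF.
- by rewrite FdF; apply/cvg_ex; exists (dF p); apply: cvg_at_right_filter; exact: cdF.
- by rewrite FdF; apply/cvg_ex; exists (dF q); apply: cvg_at_left_filter; exact: cdF.
- split => [x _||].
  + by have [] := DF x.
  + by apply: cvg_at_right_filter; exact: cF.
  + by apply: cvg_at_left_filter; exact: cF.
- exact: continuous_subspaceT.
Qed.

Lemma Rintegral_opp_segment (G : R -> R) (p q : R) : p <= q -> continuous G ->
  (\int[mu]_(x in `[- q, - p]) G x)%R = (\int[mu]_(x in `[p, q]) G (- x))%R.
Proof.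
move=> pq cG; rewrite /Rintegral integration_by_substitution_oppr//.
exact: continuous_subspaceT.
Qed.

End curve_integral.

Lemma dist_between (R : realDomainType) (c r u v w : R) : `|u - c| < r ->
  `|v - c| < r -> u <= w <= v -> `|w - c| < r.
Proof.
rewrite !ltr_norml => /andP[? ?] /andP[? ?] /andP[? ?].
by apply/andP; split; lra.
Qed.

(** * The divergence theorem near one point *)

Section local_gauss.
Context {R : realType}.
Local Notation mu := (@lebesgue_measure R).
Local Notation R2 := (measurableTypeR R * measurableTypeR R)%type.
Local Notation mu2 := (mu \x mu)%E.

Definition vanishes_outside_box (p : R * R) (r : R) (phi phi1 phi2 : R * R -> R) :=
  forall y, ~ (`|y.1 - p.1| < r /\ `|y.2 - p.2| < r) ->
    [/\ phi y = 0, phi1 y = 0 & phi2 y = 0].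

(** The divergence theorem for the two fields [(phi, 0)] and [(0, phi)]. *)
Definition gauss_on (u v : R) (a b N1 N2 : R -> R) (Om : set (R * R))
    (phi phi1 phi2 : R * R -> R) :=
  (\int[mu2]_(y in Om) phi1 y = \int[mu]_(s in `[u, v]) (phi (a s, b s) * N1 s))%R /\
  (\int[mu2]_(y in Om) phi2 y = \int[mu]_(s in `[u, v]) (phi (a s, b s) * N2 s))%R.

(** The window of parameters is centred at [s0], so that the arc in the box is not cut by the ends
    of the period. *)
Definition locally_gauss (L : R) (a b N1 N2 : R -> R) (Om : set (R * R)) (s0 : R) :=
  exists2 r, 0 < r & forall phi phi1 phi2, c1_plane phi phi1 phi2 ->
    vanishes_outside_box (a s0, b s0) r phi phi1 phi2 ->
    gauss_on (s0 - L / 2) (s0 + L / 2) a b N1 N2 Om phi phi1 phi2.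

(** On the support the domain is one side of a graph, so the strip formulas apply; their integrals
    over the abscissa are pulled back to the parameter by [x = a s], and [da] combines with [sg] and
    [dh] into the normal. *)
Lemma local_gauss_pos L a b da db N1 N2 (Om : set (R * R)) s0 :
  smooth_boundary L a b da db N1 N2 Om -> 0 < da s0 ->
  locally_gauss L a b N1 N2 Om s0.
Proof.
move=> sb das0; have [d [r [sg [h [dh gc]]]]] := local_graph_chart sb das0.
have r0 := gc_r gc; have /andP[d0 dL] := gc_d gc.
(* The half-size box leaves room for the closed interval [[p, q]] to lie where the chart is
   valid. *)
pose r' := r / 2; have r'0 : 0 < r' by rewrite divr_gt0.
have r'r : r' < r by rewrite /r'; lra.
exists r' => // phi phi1 phi2 Cphi supp.
pose p := a s0 - r'; pose q := a s0 + r'.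
have pq : p < q by rewrite /p /q; lra.
(* Clamping the abscissa to [[p, q]] extends the chart functions continuously to the line without
   changing them over the support. *)
pose cl (x : R) := Num.max p (Num.min x q).
have ccl : continuous cl.
  move=> x; apply: (@continuous_max _ _ (fun=> p) (fun x => Num.min x q)); first exact: cvg_cst.
  by apply: (@continuous_min _ _ id (fun=> q)); [exact: cvg_id|exact: cvg_cst].
have clE x : p <= x <= q -> cl x = x.
  by move=> /andP[px xq]; rewrite /cl min_l// max_r.
have clr x : `|cl x - a s0| < r.
  have h1 : p <= cl x by rewrite /cl le_max lexx.
  have h2 : cl x <= q by rewrite /cl ge_max ltW//= ge_min lexx orbT.
  by move: h1 h2; rewrite /p /q ltr_norml => ? ?; apply/andP; split; lra.
pose hc := h \o cl; pose dhc := dh \o cl.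
have chc : continuous hc.
  move=> x; apply: continuous_comp; first exact: ccl.
  by have [+ _] := gc_der gc (clr x); exact: is_derive_continuous.
have cdhc : continuous dhc.
  move=> x; apply: continuous_comp; first exact: ccl.
  by have [_] := gc_der gc (clr x).
have Dhc y : p < y < q -> is_derive y (1 : R) hc (dhc y).
  move=> /andP[py yq].
  have yI : p <= y <= q by rewrite !ltW.
  have yr : `|y - a s0| < r by rewrite -[X in `|X - _|](clE _ yI).
  have [Dh _] := gc_der gc yr.
  rewrite /dhc /= clE//; apply: near_eq_is_derive Dh.
  near=> z; rewrite /hc /= clE//.
  by apply/andP; split; apply: ltW; near: z; [exact: lt_nbhsr|exact: lt_nbhsl].
pose M := `|b s0| + r'.
have supp' y : ~ (p < y.1 < q /\ `|y.2| < M) -> [/\ phi y = 0, phi1 y = 0 & phi2 y = 0].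
  move=> ny; apply: supp => -[/= y1 y2]; apply: ny; split.
    by move: y1; rewrite ltr_norml /p /q => /andP[? ?]; apply/andP; split; lra.
  rewrite -(subrK (b s0) y.2) /M; apply: (le_lt_trans (ler_normD _ _)); lra.
have sg2 := gc_sg gc.
have setE (f : R * R -> R) :
    (forall y, ~ (`|y.1 - a s0| < r' /\ `|y.2 - b s0| < r') -> f y = 0) ->
    (\int[mu2]_(y in Om) f y)%R =
    (\int[mu2]_(y in [set y : R2 | sg * (y.2 - hc y.1) < 0]%R) f y)%R.
  move=> f0; rewrite Rintegral_mkcond [RHS]Rintegral_mkcond; apply: eq_Rintegral => y _.
  have [[y1 y2]|/f0 fy] := pselect (`|y.1 - a s0| < r' /\ `|y.2 - b s0| < r'); last first.
    by rewrite !patchE fy !if_same.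
  rewrite !patchE; have hcE : hc y.1 = h y.1.
    rewrite /hc /= clE//; move: y1; rewrite ltr_norml /p /q => /andP[? ?].
    by apply/andP; split; lra.
  have S := gc_side gc (lt_trans y1 r'r) (lt_trans y2 r'r).
  congr (if _ then _ else _); apply/idP/idP; rewrite !inE /= hcE.
    by move/S.
  by move=> ?; apply/S.
have mono s s' : `|s - s0| < d -> `|s' - s0| < d -> s < s' -> a s < a s'.
  move=> sd s'd ss; rewrite -subr_gt0.
  have [z||z + ->] := @MVT R a da s s' ss.
  - by move=> _; exact: sb_da sb z.
  - by apply: continuous_subspaceT; exact: sb_continuous_a sb.
  - rewrite in_itv /= => /andP[sz zs]; rewrite mulr_gt0 ?subr_gt0//.
    have [] // := gc_curve gc (_ : `|z - s0| < d).
    by apply: dist_between sd s'd _; rewrite !ltW.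
have pr : `|p - a s0| < r by rewrite /p addrAC subrr sub0r normrN gtr0_norm.
have qr : `|q - a s0| < r by rewrite /q addrAC subrr add0r gtr0_norm.
have [s1 s1d as1] := gc_onto gc pr.
have [s2 s2d as2] := gc_onto gc qr.
have s12 : s1 <= s2.
  rewrite leNgt; apply/negP => /(mono _ _ s2d s1d); rewrite as1 as2; lra.
have in12 s : s1 <= s <= s2 -> `|s - s0| < d.
  exact: dist_between.
have in12a s : s1 <= s <= s2 -> p <= a s <= q.
  move=> sI; have sd := in12 s sI; move: sI; rewrite !le_eqVlt.
  move=> /andP[/orP[/eqP <-|l1] /orP[/eqP E|l2]].
  - by rewrite as1 eqxx/= -as1 E as2 eqxx.
  - by rewrite as1 eqxx /= pq orbT.
  - by rewrite E as2 eqxx pq orbT.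
  - by rewrite -as1 -as2 !mono// !orbT.
(* The integral over [[s1, s2]] extends to the whole window: elsewhere the curve is outside the
   small box, by [gc_near] and monotonicity, and [phi] vanishes. *)
have pull (m n : R -> R) : continuous m ->
    (forall s, `|s - s0| < d -> `|a s - a s0| < r -> `|b s - b s0| < r ->
       p <= a s <= q -> m (a s) * da s = n s) ->
    (\int[mu]_(x in `[p, q]) (m x * phi (x, hc x)))%R =
    (\int[mu]_(s in `[(s0 - L / 2)%R, (s0 + L / 2)%R]) (phi (a s, b s) * n s))%R.
  case: (Cphi) => cphi _ _ _ cm mn; rewrite -as1 -as2.
  rewrite (@Rintegral_substitution _ a da (fun x => m x * phi (x, hc x)) s1 s2 s12
    (sb_cda sb) (sb_da sb)); last 2 first.
  - move=> s s'; rewrite !in_itv /= => sI s'I; apply: mono; exact: in12.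
  - move=> x; apply: cvgM; first exact: cm.
    apply: (@continuous_comp _ _ _ (fun x => (x, hc x)) phi); last exact: cphi.
    by apply: continuous_at_pair; [exact: cvg_id|exact: chc].
  rewrite Rintegral_mkcond [RHS]Rintegral_mkcond; apply: eq_Rintegral => s _.
  rewrite !patchE; case: ifPn => [/set_mem /=|/negP].
    rewrite in_itv /= => sI; have sd := in12 s sI; have aI := in12a s sI.
    rewrite mem_set /=; last first.
      by rewrite in_itv /=; move: sd; rewrite ltr_norml => /andP[? ?]; apply/andP; split; lra.
    have [_ bs _] := gc_curve gc sd.
    have -> : hc (a s) = b s by rewrite /hc /= clE.
    have [[y1 y2]|ny] := pselect (`|a s - a s0| < r' /\ `|b s - b s0| < r'); last first.
      by have [-> _ _] := supp (a s, b s) ny; rewrite mulr0 !mul0r.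
    by rewrite -mn//; [ring|exact: lt_trans y1 r'r|exact: lt_trans y2 r'r].
  move=> nI; case: ifPn => // /set_mem /=; rewrite in_itv /= => sL.
  suff -> : phi (a s, b s) = 0 by rewrite mul0r.
  have [|-> //] := supp (a s, b s); move=> -[/= y1 y2]; apply: nI; apply/mem_set => /=.
  have sL' : `|s - s0| <= L / 2.
    by rewrite ler_distl.
  have sd := gc_near gc sL' (lt_trans y1 r'r) (lt_trans y2 r'r).
  move: y1; rewrite ltr_norml in_itv /= => /andP[y1 y1'].
  apply/andP; split; rewrite leNgt; apply/negP => lts.
    by have := mono _ _ sd s1d lts; rewrite as1 /p; lra.
  by have := mono _ _ s2d sd lts; rewrite as2 /q; lra.
split.
- rewrite setE; last by move=> y /supp[].
  rewrite (@strip_gauss1 _ hc dhc p q M sg phi phi1 phi2)//.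
  transitivity (\int[mu]_(x in `[p, q]) (- sg * dhc x * phi (x, hc x)))%R.
    rewrite -[LHS]mulN1r -RintegralZl//.
      by apply: eq_Rintegral => x _; ring.
    apply: continuous_interval_integrable => x.
    case: (Cphi) => cphi _ _ _.
    apply: cvgM; first exact: cvg_cst.
    apply: cvgM; first exact: cdhc.
    apply: (@continuous_comp _ _ _ (fun x => (x, hc x)) phi); last exact: cphi.
    by apply: continuous_at_pair; [exact: cvg_id|exact: chc].
  apply: (pull (fun x => - sg * dhc x)).
    by move=> x; apply: cvgM; [exact: cvg_cst|exact: cdhc].
  move=> s sd sa sb' aI; have [-> _] := gc_normal gc sd sa sb'.
  have [_ _ ->] := gc_curve gc sd; rewrite /dhc /= clE//; ring.
- rewrite setE; last by move=> y /supp[].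
  rewrite (@strip_gauss2 _ hc p q M sg phi phi1 phi2)//.
  apply: (pull (fun=> sg)); first by move=> x; exact: cvg_cst.
  by move=> s sd sa sb' aI; have [_ ->] := gc_normal gc sd sa sb'.
Unshelve. all: by end_near. Qed.

End local_gauss.

Section local_gauss_everywhere.
Context {R : realType}.
Local Notation mu := (@lebesgue_measure R).
Local Notation R2 := (measurableTypeR R * measurableTypeR R)%type.
Local Notation mu2 := (mu \x mu)%E.

Lemma sb_continuous_normal L (a b da db N1 N2 : R -> R) (Om : set (R * R)) :
  smooth_boundary L a b da db N1 N2 Om -> continuous N1 /\ continuous N2.
Proof. by move=> sb; split => s; have [] := sb_local_sides s sb. Qed.

Lemma sb_continuous_curve L (a b da db N1 N2 : R -> R) (Om : set (R * R)) :
  smooth_boundary L a b da db N1 N2 Om -> continuous (fun s => (a s, b s)).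
Proof.
move=> sb s; apply: continuous_at_pair.
  exact: sb_continuous_a sb _.
exact: sb_continuous_b sb _.
Qed.

Lemma restrict_plane_bounded_support (Om : set R2) (f : R * R -> R) (M : R) :
  measurable Om -> continuous f ->
  (forall y, Om y -> f y != 0 -> `|y.1| < M /\ `|y.2| < M) ->
  measurable_fun setT (f \_ Om) /\ bounded_support (f \_ Om).
Proof.
move=> mO cf fM; split.
  apply/(measurable_restrictT _ _).1 => //; apply: measurable_funTS.
  exact: continuous_measurable_plane.
have [C HC] := continuous_bounded_box M cf.
exists M, `|C| => y; rewrite patchE; case: ifPn => [/set_mem Oy|_]; last first.
  by rewrite normr0 eqxx.
have [->|nz] := eqVneq (f y) 0; first by rewrite normr0.
have [y1 y2] := fM y Oy nz; split => //.
by apply: (le_trans _ (ler_norm C)); apply: HC; exact: ltW.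
Qed.

Lemma Rintegral_plane_swap (Om : set R2) (f : R * R -> R) (M : R) :
  open (Om : set (R * R)) -> continuous f ->
  (forall y, Om y -> `|y.1| < M /\ `|y.2| < M) ->
  (\int[mu2]_(y in [set y | Om (y.2, y.1)]) f (y.2, y.1))%R = (\int[mu2]_(y in Om) f y)%R.
Proof.
move=> oO cf bO; have mO := open_measurable_plane oO.
have [m1 b1] := @restrict_plane_bounded_support Om f M mO cf (fun y Oy _ => bO y Oy).
rewrite Rintegral_mkcond [RHS]Rintegral_mkcond -[RHS]Rintegral2_swap; last first.
  exact: bounded_support_integrable m1 b1.
apply: eq_Rintegral => y _; rewrite !patchE; congr (if _ then _ else _).
Qed.

Lemma c1_plane_swap (phi phi1 phi2 : R * R -> R) : c1_plane phi phi1 phi2 ->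
  c1_plane (fun y => phi (y.2, y.1)) (fun y => phi2 (y.2, y.1)) (fun y => phi1 (y.2, y.1)).
Proof.
move=> [c0 c1 c2 dp]; have sw (f : R * R -> R) : continuous f ->
    continuous (fun y : R * R => f (y.2, y.1)).
  by move=> cf y; apply: (@continuous_comp _ _ _ (fun y : R * R => (y.2, y.1)) f);
    [exact: continuous_swap|exact: cf].
split; [exact: sw|exact: sw|exact: sw|].
move=> u v s u' v' Du Dv.
by apply: (is_derive1_eq (dp v u s v' u' Dv Du)); rewrite addrC.
Qed.

Lemma locally_gauss_swap L (a b da db N1 N2 : R -> R) (Om : set (R * R)) s0 :
  smooth_boundary L a b da db N1 N2 Om ->
  locally_gauss L b a N2 N1 [set y | Om (y.2, y.1)] s0 ->
  locally_gauss L a b N1 N2 Om s0.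
Proof.
move=> sb [r r0 H]; exists r => // phi phi1 phi2 Cphi supp.
have [|G2 G1] := H _ _ _ (c1_plane_swap Cphi).
  by move=> y ny /=; have [|-> -> ->] := supp (y.2, y.1) => //= -[? ?]; exact: ny.
have [M bM] := sb_bounded sb; have oO := sb_open sb.
case: Cphi => c0 c1 c2 _; split.
- by rewrite -(Rintegral_plane_swap oO c1 bM) G1.
- by rewrite -(Rintegral_plane_swap oO c2 bM) G2.
Qed.

Lemma locally_gauss_reverse L (a b da db N1 N2 : R -> R) (Om : set (R * R)) s0 :
  smooth_boundary L a b da db N1 N2 Om ->
  locally_gauss L (a \o -%R) (b \o -%R) (N1 \o -%R) (N2 \o -%R) Om (- s0) ->
  locally_gauss L a b N1 N2 Om s0.
Proof.
move=> sb [r r0 H]; exists r => // phi phi1 phi2 Cphi supp.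
have [|G1 G2] := H phi phi1 phi2 Cphi; first by rewrite /= opprK.
have L0 := sb_len sb; have [cN1 cN2] := sb_continuous_normal sb.
have cc := sb_continuous_curve sb; case: Cphi => c0 _ _ _.
have E (N : R -> R) : continuous N ->
    (\int[mu]_(s in `[(- s0 - L / 2)%R, (- s0 + L / 2)%R]) (phi (a (- s), b (- s)) * N (- s)))%R =
    (\int[mu]_(s in `[(s0 - L / 2)%R, (s0 + L / 2)%R]) (phi (a s, b s) * N s))%R.
  move=> cN; rewrite -(@Rintegral_opp_segment _ (fun s => phi (a s, b s) * N s)); last 2 first.
  - by lra.
  - move=> s; apply: cvgM; last exact: cN.
    by apply: (@continuous_comp _ _ _ (fun s => (a s, b s)) phi); [exact: cc|exact: c0].
  by rewrite !opprD !opprK.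
by split; [rewrite G1 -E|rewrite G2 -E].
Qed.

Lemma sb_locally_gauss L (a b da db N1 N2 : R -> R) (Om : set (R * R)) s0 :
  smooth_boundary L a b da db N1 N2 Om -> locally_gauss L a b N1 N2 Om s0.
Proof.
move=> sb; have sw := sb_swap sb.
case: (tangent_cases s0 sb) => h.
- exact: local_gauss_pos sb h.
- apply: (locally_gauss_reverse sb); apply: local_gauss_pos (sb_reverse sb) _.
  by rewrite opprK oppr_gt0.
- by apply: (locally_gauss_swap sb); exact: local_gauss_pos sw h.
- apply: (locally_gauss_swap sb); apply: (locally_gauss_reverse sw).
  by apply: local_gauss_pos (sb_reverse sw) _; rewrite opprK oppr_gt0.
Qed.

Lemma sb_gauss_boundary L (a b da db N1 N2 : R -> R) (Om : set (R * R)) s0 :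
  smooth_boundary L a b da db N1 N2 Om ->
  exists2 r, 0 < r & forall phi phi1 phi2, c1_plane phi phi1 phi2 ->
    vanishes_outside_box (a s0, b s0) r phi phi1 phi2 ->
    gauss_on 0 L a b N1 N2 Om phi phi1 phi2.
Proof.
move=> sb; have [r r0 H] := sb_locally_gauss s0 sb; exists r => // phi phi1 phi2 Cphi supp.
have L0 := sb_len sb; have [cN1 cN2] := sb_continuous_normal sb.
have cc := sb_continuous_curve sb.
have [G1 G2] := H _ _ _ Cphi supp; case: Cphi => c0 _ _ _.
have E (N : R -> R) : continuous N -> (forall s, N (s + L) = N s) ->
    (\int[mu]_(s in `[(s0 - L / 2)%R, (s0 + L / 2)%R]) (phi (a s, b s) * N s))%R =
    (\int[mu]_(s in `[0%R, L]) (phi (a s, b s) * N s))%R.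
  move=> cN NL.
  have -> : s0 + L / 2 = s0 - L / 2 + L by lra.
  rewrite (@periodic_integral_shift _ (fun s => phi (a s, b s) * N s) L _ 0) ?add0r//.
    move=> s; apply: cvgM; last exact: cN.
    by apply: (@continuous_comp _ _ _ (fun s => (a s, b s)) phi); [exact: cc|exact: c0].
  by move=> s; have [-> ->] := sb_per sb s; rewrite NL.
split.
- by rewrite G1 E// => s; have [] := sb_nper sb s.
- by rewrite G2 E// => s; have [] := sb_nper sb s.
Qed.

(** In a box inside the domain all boundary terms vanish. The strip formulas are reused, with a
    horizontal line above the support in the place of the graph. *)
Lemma sb_gauss_interior L (a b da db N1 N2 : R -> R) (Om : set (R * R)) (p : R * R) :
  smooth_boundary L a b da db N1 N2 Om -> Om p ->
  exists2 r, 0 < r & forall phi phi1 phi2, c1_plane phi phi1 phi2 ->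
    vanishes_outside_box p r phi phi1 phi2 ->
    gauss_on 0 L a b N1 N2 Om phi phi1 phi2.
Proof.
move=> sb Op.
have : nbhs p Om by apply: open_nbhs_nbhs; split => //; exact: sb_open sb.
move/nbhs_ballP => [r /= r0 rO]; exists r => // phi phi1 phi2 Cphi supp.
have inO y : `|y.1 - p.1| < r -> `|y.2 - p.2| < r -> Om y.
  by move=> y1 y2; apply: rO; split; rewrite /ball /= distrC.
have curve0 s : phi (a s, b s) = 0.
  have [|-> //] := supp (a s, b s); move=> [/= y1 y2].
  by have := (sb_on sb s).2; apply; exact: inO.
have rhs (N : R -> R) : (\int[mu]_(s in `[0%R, L]) (phi (a s, b s) * N s))%R = 0.
  rewrite (_ : (fun s => _) = fun=> 0); first by rewrite Rintegral_cst// mul0r.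
  by apply/funext => s; rewrite curve0 mul0r.
(* The horizontal line at this height passes above the support, where [|y.2| < C]. *)
pose C := `|p.2| + r.
have supp' y : ~ (p.1 - r < y.1 < p.1 + r /\ `|y.2| < C) ->
    [/\ phi y = 0, phi1 y = 0 & phi2 y = 0].
  move=> ny; apply: supp => -[y1 y2]; apply: ny; split.
    by move: y1; rewrite ltr_norml => /andP[? ?]; apply/andP; split; lra.
  rewrite -(subrK p.2 y.2) /C; apply: (le_lt_trans (ler_normD _ _)); lra.
have phiC x : phi (x, C) = 0.
  have [|-> //] := supp' (x, C); move=> [_ /=].
  by rewrite ltNge => /negP; apply; exact: ler_norm.
have cC (k : R) : continuous (fun _ : R => k) by move=> x; exact: cvg_cst.
have pq : p.1 - r < p.1 + r by lra.
have one : (1 : R) ^+ 2 = 1 by rewrite expr1n.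
have setE (f : R * R -> R) :
    (forall y, ~ (`|y.1 - p.1| < r /\ `|y.2 - p.2| < r) -> f y = 0) ->
    (\int[mu2]_(y in Om) f y)%R =
    (\int[mu2]_(y in [set y : R2 | 1 * (y.2 - (fun=> C) y.1) < 0]%R) f y)%R.
  move=> f0; rewrite Rintegral_mkcond [RHS]Rintegral_mkcond; apply: eq_Rintegral => y _.
  have [[y1 y2]|/f0 fy] := pselect (`|y.1 - p.1| < r /\ `|y.2 - p.2| < r); last first.
    by rewrite !patchE fy !if_same.
  rewrite !patchE !mem_set//; last exact: inO.
  rewrite /= mul1r subr_lt0 /C.
  move: y2; rewrite ltr_norml => /andP[_ y2].
  by have := ler_norm p.2; lra.
have D0 y : p.1 - r < y < p.1 + r -> is_derive y (1 : R) (fun _ : R => C) ((fun=> 0 : R) y).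
  by move=> _; exact: is_derive1_cst.
split; rewrite rhs setE; try by move=> y /supp[].
- rewrite (@strip_gauss1 _ (fun=> C) (fun=> 0) (p.1 - r) (p.1 + r) C 1 phi phi1 phi2)//.
  rewrite (_ : (fun x => _) = fun=> 0); first by rewrite Rintegral_cst// mul0r oppr0.
  by apply/funext => x; rewrite mul0r mulr0.
- rewrite (@strip_gauss2 _ (fun=> C) (p.1 - r) (p.1 + r) C 1 phi phi1 phi2)//.
  rewrite (_ : (fun x => _) = fun=> 0); first by rewrite Rintegral_cst// mul0r.
  by apply/funext => x; rewrite phiC mulr0.
Qed.

End local_gauss_everywhere.

(** * Products, differences and bump functions *)

Section bump.
Context {R : realType}.
Implicit Types phi psi : R * R -> R.

Lemma c1_plane_mul phi phi1 phi2 psi psi1 psi2 : c1_plane phi phi1 phi2 ->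
  c1_plane psi psi1 psi2 -> c1_plane (fun y => phi y * psi y)
    (fun y => phi y * psi1 y + psi y * phi1 y)
    (fun y => phi y * psi2 y + psi y * phi2 y).
Proof.
move=> [c0 c1 c2 dp] [e0 e1 e2 dq]; split.
- by move=> y; apply: cvgM; [exact: c0|exact: e0].
- by move=> y; apply: cvgD; apply: cvgM; [exact: c0|exact: e1|exact: e0|exact: c1].
- by move=> y; apply: cvgD; apply: cvgM; [exact: c0|exact: e2|exact: e0|exact: c2].
- move=> u v s u' v' Du Dv.
  by apply: (is_derive1_eq (is_derive1_mul (dp u v s u' v' Du Dv) (dq u v s u' v' Du Dv))); ring.
Qed.

Lemma c1_plane_sub phi phi1 phi2 psi psi1 psi2 : c1_plane phi phi1 phi2 ->
  c1_plane psi psi1 psi2 -> c1_plane (fun y => phi y - psi y)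
    (fun y => phi1 y - psi1 y) (fun y => phi2 y - psi2 y).
Proof.
move=> [c0 c1 c2 dp] [e0 e1 e2 dq]; split.
- by move=> y; apply: cvgB; [exact: c0|exact: e0].
- by move=> y; apply: cvgB; [exact: c1|exact: e1].
- by move=> y; apply: cvgB; [exact: c2|exact: e2].
- move=> u v s u' v' Du Dv.
  by apply: (is_derive1_eq (is_derive1_sub (dp u v s u' v' Du Dv) (dq u v s u' v' Du Dv))); ring.
Qed.

Lemma c1_plane_cst (k : R) : c1_plane (fun=> k) (fun=> 0) (fun=> 0).
Proof.
split; try by move=> y; exact: cvg_cst.
by move=> u v s u' v' Du Dv; apply: (is_derive1_eq (is_derive1_cst k s)); rewrite !mul0r addr0.
Qed.

Lemma c1_plane_fst (f df : R -> R) : continuous df ->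
  (forall x, is_derive x (1 : R) f (df x)) ->
  c1_plane (fun y => f y.1) (fun y => df y.1) (fun=> 0).
Proof.
move=> cdf Df; split.
- move=> y; apply: (@continuous_comp _ _ _ fst f); first exact: cvg_fst.
  exact: is_derive_continuous (Df _).
- by move=> y; apply: (@continuous_comp _ _ _ fst df); [exact: cvg_fst|exact: cdf].
- by move=> y; exact: cvg_cst.
- move=> u v s u' v' Du Dv; apply: (is_derive1_eq (is_derive1_compose (Df (u s)) Du)).
  by rewrite mul0r addr0.
Qed.

Lemma c1_plane_snd (f df : R -> R) : continuous df ->
  (forall x, is_derive x (1 : R) f (df x)) ->
  c1_plane (fun y => f y.2) (fun=> 0) (fun y => df y.2).
Proof.
move=> cdf Df; split.
- move=> y; apply: (@continuous_comp _ _ _ snd f); first exact: cvg_snd.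
  exact: is_derive_continuous (Df _).
- by move=> y; exact: cvg_cst.
- by move=> y; apply: (@continuous_comp _ _ _ snd df); [exact: cvg_snd|exact: cdf].
- move=> u v s u' v' Du Dv; apply: (is_derive1_eq (is_derive1_compose (Df (v s)) Dv)).
  by rewrite mul0r add0r.
Qed.

(** The square of the positive part: continuously differentiable and zero on a half-line, which is
    all that C^1 cut-offs require. *)
Definition possq (u : R) : R := u * Num.max u 0.

Lemma continuous_pos : continuous (fun u : R => Num.max u 0).
Proof.
move=> u; apply: (@continuous_max _ _ id (fun=> 0)); first exact: cvg_id.
exact: cvg_cst.
Qed.

Lemma is_derive_possq (u : R) : is_derive u (1 : R) possq (2 * Num.max u 0).
Proof.
have [u0|u0|->] := ltgtP u 0.
- rewrite mulr0; apply: near_eq_is_derive (is_derive1_cst 0 u).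
  near=> v; rewrite /possq max_r ?mulr0// ltW//; near: v; exact: lt_nbhsl.
- apply: (is_derive1_eq (near_eq_is_derive _ (is_derive1_mul (is_derive1_id u) (is_derive1_id u)))).
    near=> v; rewrite /possq max_l// ltW//; near: v; exact: lt_nbhsr.
  by ring.
- rewrite mulr0; apply/is_derive1_caratheodory; exists (fun v => Num.max v 0).
  split; [|exact: continuous_pos|by rewrite maxxx].
  by move=> z; rewrite /possq mul0r !subr0 mulrC.
Unshelve. all: by end_near. Qed.

(* [bump] is 1 where [4/3 (1 - t^2) >= 1] and 0 where [1 - t^2 <= 0]. *)
Let w (t : R) := 4 / 3 * (1 - t * t).
Definition bump (t : R) : R := 1 - possq (1 - possq (w t)).
Definition dbump (t : R) : R :=
  2 * Num.max (1 - possq (w t)) 0 * (2 * Num.max (w t) 0) * (- (8 / 3) * t).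

Lemma is_derive_bump (t : R) : is_derive t (1 : R) bump (dbump t).
Proof.
have Dw : is_derive t (1 : R) w (- (8 / 3) * t).
  have D := is_derive1_mul (is_derive1_cst (4 / 3) t) (is_derive1_sub (is_derive1_cst 1 t)
    (is_derive1_mul (is_derive1_id t) (is_derive1_id t))).
  by apply: (is_derive1_eq D); field.
have D1 := is_derive1_compose (is_derive_possq (w t)) Dw.
have D2 := is_derive1_sub (is_derive1_cst 1 t) D1.
have D3 := @is_derive1_compose _ possq (fun t => 1 - possq (w t)) t _ _
  (is_derive_possq (1 - possq (w t))) D2.
by apply: (is_derive1_eq (is_derive1_sub (is_derive1_cst 1 t) D3)); rewrite /dbump; ring.
Qed.

Lemma continuous_dbump : continuous dbump.
Proof.
have cw : continuous w.
  move=> t; apply: cvgM; first exact: cvg_cst.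
  by apply: cvgB; [exact: cvg_cst|apply: cvgM; exact: cvg_id].
have cp : continuous possq by move=> u; exact: is_derive_continuous (is_derive_possq u).
move=> t; apply: cvgM; last by apply: cvgM; [exact: cvg_cst|exact: cvg_id].
apply: cvgM; (apply: cvgM; first exact: cvg_cst).
  apply: (@continuous_comp _ _ _ (fun t => 1 - possq (w t)) (fun u : R => Num.max u 0)).
    apply: cvgB; first exact: cvg_cst.
    by apply: continuous_comp; [exact: cw|exact: cp].
  exact: continuous_pos.
by apply: (@continuous_comp _ _ _ w (fun u : R => Num.max u 0)); [exact: cw|exact: continuous_pos].
Qed.

Lemma bump_out (t : R) : 1 <= `|t| -> bump t = 0 /\ dbump t = 0.
Proof.
move=> t1.
have w0 : w t <= 0.
  have : 1 <= t * t by rewrite -expr2 -real_normK ?num_real// exprn_ege1.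
  by rewrite /w; lra.
by rewrite /bump /dbump /possq (max_r w0) !mulr0 subr0 max_l// mul0r mulr1 subrr.
Qed.

Lemma bump_in (t : R) : `|t| <= 1 / 2 -> bump t = 1 /\ dbump t = 0.
Proof.
move=> t1.
have w1 : 1 <= w t.
  have : t * t <= 1 / 4.
    rewrite -expr2 -real_normK ?num_real// expr2.
    have := normr_ge0 t; nra.
  by rewrite /w; lra.
have p1 : 1 - possq (w t) <= 0.
  by rewrite /possq max_l; [nra|lra].
by rewrite /bump /dbump {1}/possq (max_r p1) !mulr0 subr0 !mul0r.
Qed.

Lemma box_bump (p : R * R) (r : R) : 0 < r -> exists psi psi1 psi2,
  [/\ c1_plane psi psi1 psi2, vanishes_outside_box p r psi psi1 psi2 &
    forall y, `|y.1 - p.1| < r / 2 -> `|y.2 - p.2| < r / 2 ->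
      [/\ psi y = 1, psi1 y = 0 & psi2 y = 0]].
Proof.
move=> r0.
have D (q : R) x : is_derive x (1 : R) (fun x => bump ((x - q) / r)) (dbump ((x - q) / r) / r).
  have Dl := is_derive1_mul (is_derive1_sub (is_derive1_id x) (is_derive1_cst q x))
    (is_derive1_cst r^-1 x).
  have := @is_derive1_compose _ bump (fun x => (x - q) / r) x _ _ (is_derive_bump _) Dl.
  by move/is_derive1_eq; apply; ring.
have cD (q : R) : continuous (fun x => dbump ((x - q) / r) / r).
  move=> x; apply: cvgM; last exact: cvg_cst.
  apply: (@continuous_comp _ _ _ (fun x => (x - q) / r) dbump); last exact: continuous_dbump.
  apply: cvgM; last exact: cvg_cst.
  by apply: cvgB; [exact: cvg_id|exact: cvg_cst].
have C := c1_plane_mul (c1_plane_fst (cD p.1) (D p.1)) (c1_plane_snd (cD p.2) (D p.2)).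
have nrm (t : R) : `|t / r| = `|t| / r by rewrite normrM normfV (gtr0_norm r0).
have big (t : R) : ~ (`|t| < r) -> 1 <= `|t / r|.
  by move=> /negP; rewrite -leNgt nrm ler_pdivlMr// mul1r.
have small (t : R) : `|t| < r / 2 -> `|t / r| <= 1 / 2.
  by move=> tr; rewrite nrm ler_pdivrMr//; lra.
eexists; eexists; eexists; split; [exact: C| |].
- move=> y ny.
  have [y1|y1] := pselect (`|y.1 - p.1| < r); last first.
    by have [-> ->] := bump_out (big _ y1); rewrite !(mul0r, mulr0, addr0).
  have y2 : ~ (`|y.2 - p.2| < r) by move=> y2; exact: ny.
  by have [-> ->] := bump_out (big _ y2); rewrite !(mul0r, mulr0, addr0).
- move=> y /small/bump_in[E1 E2] /small/bump_in[E3 E4].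
  by rewrite E1 E2 E3 E4 !(mul0r, mulr0, addr0, mulr1).
Qed.

End bump.

(* [R * R] has no canonical pointed topological structure. *)
Lemma plane_compact_cover (R : realType) (A : set (R * R)) :
  compact A -> cover_compact A.
Proof.
pose T : ptopologicalType := HB.pack (R * R)%type
  (Topological.class [the topologicalType of (R * R)%type])
  (Pointed.class [the pointedType of (R * R)%type]).
by rewrite -(@compact_cover T).
Qed.

(** * Localization by a finite cover *)

Section global_gauss.
Context {R : realType}.
Local Notation mu := (@lebesgue_measure R).
Local Notation R2 := (measurableTypeR R * measurableTypeR R)%type.
Local Notation mu2 := (mu \x mu)%E.
Variables (L : R) (a b da db N1 N2 : R -> R) (Om : set (R * R)).
Hypothesis sb : smooth_boundary L a b da db N1 N2 Om.

Lemma sb_measurable : measurable (Om : set R2).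
Proof. exact: open_measurable_plane (sb_open sb). Qed.

Lemma sb_closure_bounded : exists2 M, (forall y, Om y -> `|y.1| < M /\ `|y.2| < M) &
  forall y, closure Om y -> `|y.1| <= M /\ `|y.2| <= M.
Proof.
have [M bM] := sb_bounded sb; exists M => // y cy.
have key (k : R * R -> R) : continuous k ->
    (forall z, Om z -> `|k z| < M) -> `|k y| <= M.
  move=> ck kM; rewrite leNgt; apply/negP => My.
  have nB : nbhs y [set z | M < `|k z|].
    have cn : {for y, continuous (fun z => `|k z|)} by apply: cvg_norm; exact: ck.
    by apply: (cn [set u | M < u]); exact: lt_nbhsr.
  by have [z [/kM h /= h']] := cy _ nB; move: (lt_trans h h'); rewrite ltxx.
split; apply: key => //.
- by move=> z; exact: cvg_fst.
- by move=> z /bM[].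
- by move=> z; exact: cvg_snd.
- by move=> z /bM[].
Qed.

Lemma sb_compact_closure : compact (closure Om).
Proof.
have [M _ bM] := sb_closure_bounded.
have cB : compact (`[- M, M]%classic `*` `[- M, M]%classic : set (R * R)).
  by apply: compact_setX; exact: segment_compact.
apply: (subclosed_compact _ cB); first exact: closed_closure.
by move=> y /bM[y1 y2]; split; rewrite /= in_itv /= -ler_norml.
Qed.

Lemma sb_integrable (f : R2 -> R) (C : R) : measurable_fun Om f ->
  (forall y, Om y -> `|f y| <= C) -> mu2.-integrable Om (EFin \o f).
Proof.
have [M bM _] := sb_closure_bounded.
by move=> mf fC; exact: bounded_plane_integrable sb_measurable bM mf fC.
Qed.

Lemma sb_continuous_integrable (f : R * R -> R) : continuous f ->
  mu2.-integrable (Om : set R2) (EFin \o f).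
Proof.
move=> cf; have [M bM _] := sb_closure_bounded.
have [C HC] := continuous_bounded_box M cf.
apply: (@sb_integrable _ C).
  by apply: measurable_funTS; exact: continuous_measurable_plane.
by move=> y /bM[? ?]; apply: HC; exact: ltW.
Qed.

Lemma sb_continuous_on_curve (f : R * R -> R) : continuous f ->
  continuous (fun s => f (a s, b s)).
Proof.
move=> cf s; apply: (@continuous_comp _ _ _ (fun s => (a s, b s)) f); last exact: cf.
exact: (sb_continuous_curve sb).
Qed.

Let gauss := gauss_on 0 L a b N1 N2 Om.

Let gaussD phi phi1 phi2 psi psi1 psi2 : c1_plane phi phi1 phi2 -> c1_plane psi psi1 psi2 ->
  gauss phi phi1 phi2 -> gauss (fun y => psi y - phi y) (fun y => psi1 y - phi1 y)
    (fun y => psi2 y - phi2 y) -> gauss psi psi1 psi2.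
Proof.
move=> [c0 c1 c2 _] [e0 e1 e2 _] [G1 G2] [G3 G4].
have [cN1 cN2] := sb_continuous_normal sb.
have cc (f : R * R -> R) (N : R -> R) : continuous f -> continuous N ->
    mu.-integrable `[0%R, L]%classic (EFin \o (fun s => f (a s, b s) * N s)).
  move=> cf cN; apply: continuous_interval_integrable => s.
  by apply: cvgM; [exact: sb_continuous_on_curve|exact: cN].
have split_curve N : continuous N ->
    (\int[mu]_(s in `[0%R, L]) ((psi (a s, b s) - phi (a s, b s)) * N s) =
     \int[mu]_(s in `[0%R, L]) (psi (a s, b s) * N s) -
     \int[mu]_(s in `[0%R, L]) (phi (a s, b s) * N s))%R.
  move=> cN; rewrite -RintegralB//; try exact: cc.
  by apply: eq_Rintegral => s _; rewrite mulrBl.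
split.
- move: G3; rewrite (RintegralB sb_measurable (sb_continuous_integrable e1)
    (sb_continuous_integrable c1)) split_curve// G1 => h.
  by apply: (addIr (- (\int[mu]_(s in `[0%R, L]) (phi (a s, b s) * N1 s))%R)).
- move: G4; rewrite (RintegralB sb_measurable (sb_continuous_integrable e2)
    (sb_continuous_integrable c2)) split_curve// G2 => h.
  by apply: (addIr (- (\int[mu]_(s in `[0%R, L]) (phi (a s, b s) * N2 s))%R)).
Qed.

Let gauss_covered (r : R * R -> R) (l : seq (R * R)) phi phi1 phi2 :
  (forall p, p \in l -> 0 < r p /\ forall psi psi1 psi2, c1_plane psi psi1 psi2 ->
     vanishes_outside_box p (r p) psi psi1 psi2 -> gauss psi psi1 psi2) ->
  c1_plane phi phi1 phi2 ->
  (forall y, closure Om y ->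
     (forall p, p \in l -> ~ (`|y.1 - p.1| < r p / 2 /\ `|y.2 - p.2| < r p / 2)) ->
     [/\ phi y = 0, phi1 y = 0 & phi2 y = 0]) ->
  gauss phi phi1 phi2.
Proof.
elim: l phi phi1 phi2 => [|p l IH] phi phi1 phi2 Hl Cphi supp.
  have z y : closure Om y -> [/\ phi y = 0, phi1 y = 0 & phi2 y = 0] by move=> cy; exact: supp.
  have rhs (N : R -> R) : (\int[mu]_(s in `[0%R, L]) (phi (a s, b s) * N s))%R = 0.
    rewrite (_ : (fun s => _) = fun=> 0); first by rewrite Rintegral_cst// mul0r.
    by apply/funext => s; have [-> _ _] := z _ (sb_on sb s).1; rewrite mul0r.
  have lhs (f : R * R -> R) : (forall y, Om y -> f y = 0) -> (\int[mu2]_(y in Om) f y)%R = 0.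
    move=> f0; rewrite (@eq_Rintegral _ _ _ _ _ (fun=> 0)).
      by rewrite Rintegral_cst ?mul0r//; exact: sb_measurable.
    by move=> y /set_mem /f0.
  by split; rewrite rhs lhs// => y /subset_closure /z[].
have [rp Hp] := Hl p (mem_head _ _).
have [psi [psi1 [psi2 [Cpsi spsi ipsi]]]] := box_bump p rp.
have Cpp := c1_plane_mul Cphi Cpsi.
apply: (gaussD Cpp Cphi).
  apply: Hp => // y /spsi[-> -> ->].
  by rewrite !mulr0 !mul0r addr0.
apply: IH.
- by move=> q ql; apply: Hl; rewrite inE ql orbT.
- exact: c1_plane_sub.
- move=> y cy yl.
  have [[y1 y2]|ny] := pselect (`|y.1 - p.1| < r p / 2 /\ `|y.2 - p.2| < r p / 2).
    have [-> -> ->] := ipsi y y1 y2.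
    by rewrite !(mulr0, mulr1, add0r, mul1r) !subrr.
  have [|-> -> ->] := supp y cy; last by rewrite !(mulr0, mul0r, addr0) subrr.
  by move=> q; rewrite inE => /orP[/eqP ->//|]; exact: yl.
Qed.

(** The local theorem holds in a box about every point of the compact closure. The finite cover is
    extracted from the half-size boxes, on which the bumps are 1. *)
Theorem sb_gauss phi phi1 phi2 : c1_plane phi phi1 phi2 ->
  gauss_on 0 L a b N1 N2 Om phi phi1 phi2.
Proof.
move=> Cphi.
have loc p : exists r, closure Om p -> 0 < r /\ forall psi psi1 psi2, c1_plane psi psi1 psi2 ->
     vanishes_outside_box p r psi psi1 psi2 -> gauss psi psi1 psi2.
  have [cp|ncp] := pselect (closure Om p); last by exists 0.
  have [Op|nOp] := pselect (Om p).
    by have [r r0 H] := sb_gauss_interior sb Op; exists r.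
  have [s ->] := sb_bd sb cp nOp.
  by have [r r0 H] := sb_gauss_boundary s sb; exists r.
have [r Hr] := choice loc.
pose box p : set (R * R) := (ball p (r p / 2))°.
have cO := plane_compact_cover sb_compact_closure.
have [||D DO cD] := cO _ (closure Om) box.
- by move=> p cp; exact: open_interior.
- move=> p cp; exists p => //; apply: nbhsx_ballx; rewrite divr_gt0//; exact: (Hr p cp).1.
- apply: (@gauss_covered r (finmap.enum_fset D)) => //.
  + by move=> p pD; apply: Hr; exact/set_mem/DO.
  + move=> y cy yD; exfalso; have [p /= pD /interior_subset[y1 y2]] := cD y cy.
    apply: (yD p pD); move: y1 y2; rewrite /ball /= => y1 y2.
    by split; rewrite distrC.
Qed.

End global_gauss.

(** * Radial fields and the dipole density *)

Section regularization.
Context {R : realType}.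

(** As division by 0 gives 0, the condition on [u] makes the limit correct at a zero of [q] too. *)
Lemma cvg_regularized (u q : R) : 0 <= q -> (q = 0 -> u = 0) ->
  u / (q + n.+1%:R^-1) @[n --> \oo] --> u / q.
Proof.
move=> q0 u0; have [qz|qnz] := eqVneq q 0.
  rewrite u0// mul0r (_ : (fun n => _) = fun=> 0); first exact: cvg_cst.
  by apply/funext => n; rewrite mul0r.
apply: cvgM; first exact: cvg_cst.
apply: cvgV => //; rewrite -[X in _ --> X]addr0.
by apply: cvgD; [exact: cvg_cst|exact: cvg_harmonic].
Qed.

(** It is the limit at every point, including 0, of the continuous functions
    [u / (u^2 + 1 / (n + 1))]. *)
Lemma measurable_invr : measurable_fun setT (fun u : R => u^-1).
Proof.
apply: (@measurable_fun_cvg _ _ _ _ (fun (n : nat) (u : R) => u / (u ^+ 2 + n.+1%:R^-1)))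
  => [n|u _].
  apply: continuous_measurable_fun => u; apply: cvgM; first exact: cvg_id.
  apply: cvgV; first by rewrite gt_eqF// ltr_wpDl// ?sqr_ge0// invr_gt0.
  by apply: cvgD; [apply: cvgM; exact: cvg_id|exact: cvg_cst].
have -> : u^-1 = u / u ^+ 2.
  by have [->|u0] := eqVneq u 0; [rewrite mul0r invr0|field].
apply: cvg_regularized; first exact: sqr_ge0.
by move/eqP; rewrite sqrf_eq0 => /eqP.
Qed.

Lemma c1_plane_comp (f df : R -> R) (phi phi1 phi2 : R * R -> R) : continuous df ->
  (forall x, is_derive x (1 : R) f (df x)) -> c1_plane phi phi1 phi2 ->
  c1_plane (fun y => f (phi y)) (fun y => df (phi y) * phi1 y)
    (fun y => df (phi y) * phi2 y).
Proof.
move=> cdf Df [c0 c1 c2 dp].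
have cc (h : R -> R) : continuous h -> continuous (fun y => h (phi y)).
  by move=> ch y; apply: continuous_comp; [exact: c0|exact: ch].
split.
- by apply: cc => u; exact: is_derive_continuous (Df u).
- by move=> y; apply: cvgM; [exact: (cc _ cdf)|exact: c1].
- by move=> y; apply: cvgM; [exact: (cc _ cdf)|exact: c2].
- move=> u v s u' v' Du Dv; have D := dp u v s u' v' Du Dv.
  by apply: (is_derive1_eq (is_derive1_compose (Df _) D)); ring.
Qed.

Lemma c1_plane_inv (phi phi1 phi2 : R * R -> R) : (forall y, phi y != 0) ->
  c1_plane phi phi1 phi2 ->
  c1_plane (fun y => (phi y)^-1) (fun y => - phi1 y / phi y ^+ 2)
    (fun y => - phi2 y / phi y ^+ 2).
Proof.
move=> p0 [c0 c1 c2 dp].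
have cs (f : R * R -> R) : continuous f -> continuous (fun y => - f y / phi y ^+ 2).
  move=> cf y; apply: cvgM; first by apply: cvgN; exact: cf.
  apply: cvgV; first by rewrite sqrf_eq0.
  by apply: cvgM; exact: c0.
split; [|exact: cs|exact: cs|].
- by move=> y; apply: cvgV; [exact: p0|exact: c0].
- move=> u v s u' v' Du Dv; have D := dp u v s u' v' Du Dv.
  have D' := @is_derive1_inv _ (fun t => phi (u t, v t)) s _ (p0 _) D.
  by apply: (is_derive1_eq D'); field.
Qed.

End regularization.

Section radial.
Context {R : realType}.
Local Notation mu := (@lebesgue_measure R).
Local Notation R2 := (measurableTypeR R * measurableTypeR R)%type.
Local Notation mu2 := (mu \x mu)%E.

Definition sqdist (x y : R * R) : R := (y.1 - x.1) ^+ 2 + (y.2 - x.2) ^+ 2.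

Lemma sqdist_ge0 x y : 0 <= sqdist x y.
Proof. by rewrite addr_ge0 ?sqr_ge0. Qed.

Lemma sqdist_eq0 x y : sqdist x y = 0 -> y = x.
Proof.
move/eqP; rewrite paddr_eq0 ?sqr_ge0// !sqrf_eq0 !subr_eq0 => /andP[/eqP E1 /eqP E2].
by rewrite [y]surjective_pairing E1 E2 -surjective_pairing.
Qed.

Lemma c1_plane_sqdist x : c1_plane (sqdist x) (fun y => 2 * (y.1 - x.1))
  (fun y => 2 * (y.2 - x.2)).
Proof.
have D (k t : R) : is_derive t (1 : R) (fun t => t - k) 1.
  by apply: (is_derive1_eq (is_derive1_sub (is_derive1_id t) (is_derive1_cst k t))); rewrite subr0.
split.
- move=> y; apply: cvgD.
    by apply: cvgM; (apply: cvgB; [exact: cvg_fst|exact: cvg_cst]).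
  by apply: cvgM; (apply: cvgB; [exact: cvg_snd|exact: cvg_cst]).
- move=> y; apply: cvgM; first exact: cvg_cst.
  by apply: cvgB; [exact: cvg_fst|exact: cvg_cst].
- move=> y; apply: cvgM; first exact: cvg_cst.
  by apply: cvgB; [exact: cvg_snd|exact: cvg_cst].
- move=> u v s u' v' Du Dv.
  have D1 := is_derive1_pow2 (is_derive1_compose (D x.1 (u s)) Du).
  have D2 := is_derive1_pow2 (is_derive1_compose (D x.2 (v s)) Dv).
  by apply: (is_derive1_eq (is_derive1_add D1 D2)); rewrite /=; ring.
Qed.

Variables (L : R) (a b da db N1 N2 : R -> R) (Om : set (R * R)).
Hypothesis sb : smooth_boundary L a b da db N1 N2 Om.
Variable x : R * R.

Definition dipole_num (a b N1 N2 : R -> R) (x : R * R) (s : R) : R :=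
  (a s - x.1) * N1 s + (b s - x.2) * N2 s.

(* Minus the normal derivative of [ln (1 / r)]. *)
Definition dipole (a b N1 N2 : R -> R) (x : R * R) (s : R) : R :=
  dipole_num a b N1 N2 x s / sqdist x (a s, b s).

Let q s := sqdist x (a s, b s).
Let P := dipole_num a b N1 N2 x.
Let g := dipole a b N1 N2 x.

Lemma continuous_curve_sqdist : continuous (fun s => sqdist x (a s, b s)).
Proof. by apply: (sb_continuous_on_curve sb); case: (c1_plane_sqdist x). Qed.

Lemma continuous_dipole_num : continuous (dipole_num a b N1 N2 x).
Proof.
have [cN1 cN2] := sb_continuous_normal sb.
move=> s; apply: cvgD; apply: cvgM; try (apply: cvgB; last exact: cvg_cst).
- exact: sb_continuous_a sb _.
- exact: cN1.
- exact: sb_continuous_b sb _.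
- exact: cN2.
Qed.

Lemma measurable_dipole : measurable_fun setT (dipole a b N1 N2 x).
Proof.
apply: measurable_funM.
  by apply: continuous_measurable_fun; exact: continuous_dipole_num.
apply: (measurableT_comp measurable_invr).
by apply: continuous_measurable_fun; exact: continuous_curve_sqdist.
Qed.

Let P0 s : q s = 0 -> P s = 0.
Proof.
by move/sqdist_eq0 => E; rewrite /P /dipole_num -E /= !subrr !mul0r addr0.
Qed.

Variables (H eta : R -> R) (M : R).
Hypothesis DH : forall u, is_derive u (1 : R) H (eta u).
Hypothesis ceta : continuous eta.
Hypothesis H0 : H 0 = 0.
Hypothesis etaM : forall u, 0 <= u -> `|eta u| <= M.

Let M0 : 0 <= M.
Proof. exact: le_trans (normr_ge0 _) (etaM (lexx 0)). Qed.

Let cH : continuous H.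
Proof. by move=> u; exact: is_derive_continuous (DH u). Qed.

Let HM u : 0 <= u -> `|H u| <= M * u.
Proof.
move=> u0; have [|c cI E] := @MVT_segment R H eta 0 u u0 (fun t _ => DH t).
  exact: continuous_subspaceT.
move: E; rewrite H0 !subr0 => ->; rewrite normrM (ger0_norm u0) ler_wpM2r//.
by apply: etaM; move: cI; rewrite in_itv /= => /andP[].
Qed.

(** The divergence of the field [H q / (q + e) (y - x)], which is C^1 across x. It is written in
    ratios that stay bounded as [e] tends to 0; in the limit the first and the last term cancel. *)
Let div e (y : R * R) : R := let q := sqdist x y in
  2 * (H q / (q + e) + q / (q + e) * eta q - q / (q + e) * (H q / (q + e))).

Let regularized_gauss e : 0 < e ->
  (\int[mu2]_(y in Om) div e y)%R =
  (\int[mu]_(s in `[0%R, L]) (H (q s) / (q s + e) * P s))%R.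
Proof.
move=> e0.
have Cq := c1_plane_sqdist x.
have qe y : sqdist x y + e != 0 by rewrite gt_eqF// ltr_wpDl// sqdist_ge0.
have Cqe : c1_plane (fun y => sqdist x y + e) (fun y => 2 * (y.1 - x.1))
    (fun y => 2 * (y.2 - x.2)).
  have := c1_plane_sub Cq (c1_plane_cst (- e)); congr c1_plane; apply/funext => y;
  by rewrite ?opprK// subr0.
have CK := c1_plane_mul (c1_plane_comp ceta DH Cq) (c1_plane_inv qe Cqe).
have D (k t : R) : is_derive t (1 : R) (fun t => t - k) 1.
  by apply: (is_derive1_eq (is_derive1_sub (is_derive1_id t) (is_derive1_cst k t))); rewrite subr0.
have c1 : continuous (fun _ : R => 1 : R) by move=> ?; exact: cvg_cst.
have C1 := c1_plane_mul (c1_plane_fst c1 (D x.1)) CK.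
have C2 := c1_plane_mul (c1_plane_snd c1 (D x.2)) CK.
have [G1 _] := sb_gauss sb C1; have [_ G2] := sb_gauss sb C2.
have [cN1 cN2] := sb_continuous_normal sb.
transitivity ((\int[mu2]_(y in Om) ((y.1 - x.1) *
      (H (sqdist x y) * (- (2 * (y.1 - x.1)) / (sqdist x y + e) ^+ 2) +
     (sqdist x y + e)^-1 * (eta (sqdist x y) * (2 * (y.1 - x.1)))) +
     H (sqdist x y) / (sqdist x y + e) * 1)) + (\int[mu2]_(y in Om) ((y.2 - x.2) *
   (H (sqdist x y) * (- (2 * (y.2 - x.2)) / (sqdist x y + e) ^+ 2) +
    (sqdist x y + e)^-1 * (eta (sqdist x y) * (2 * (y.2 - x.2)))) +
   H (sqdist x y) / (sqdist x y + e) * 1)))%R.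
  rewrite -RintegralD//; last 3 first.
  - exact: (sb_measurable sb).
  - by apply: (sb_continuous_integrable sb); case: C1.
  - by apply: (sb_continuous_integrable sb); case: C2.
  apply: eq_Rintegral => y _; rewrite /div; have := qe y.
  set r := sqdist x y => re.
  have rE : (y.1 - x.1) ^+ 2 = r - (y.2 - x.2) ^+ 2 by rewrite /r /sqdist; ring.
  transitivity (2 * H r / (r + e) + ((y.1 - x.1) ^+ 2 + (y.2 - x.2) ^+ 2) *
    (2 * eta r / (r + e) - 2 * H r / (r + e) ^+ 2)).
    by rewrite rE; field.
  by field.
rewrite G1 G2 -RintegralD//; last 2 first.
- apply: continuous_interval_integrable => s; apply: cvgM; last exact: cN1.
  by have [cF _ _ _] := C1; exact: (sb_continuous_on_curve sb cF).
- apply: continuous_interval_integrable => s; apply: cvgM; last exact: cN2.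
  by have [cF _ _ _] := C2; exact: (sb_continuous_on_curve sb cF).
by apply: eq_Rintegral => s _; rewrite /P /dipole_num /=; ring.
Qed.

Let ratio_bound (e u : R) : 0 < e -> 0 <= u -> 0 <= u / (u + e) <= 1.
Proof.
move=> e0 u0; have ue : 0 < u + e by rewrite ltr_wpDl.
by rewrite divr_ge0 ?(ltW ue)//= ler_pdivrMr// mul1r lerDl ltW.
Qed.

Let H_ratio_bound (e u : R) : 0 < e -> 0 <= u -> `|H u / (u + e)| <= M.
Proof.
move=> e0 u0; have ue : 0 < u + e by rewrite ltr_wpDl.
rewrite normrM normfV (gtr0_norm ue) ler_pdivrMr//.
by apply: (le_trans (HM u0)); rewrite ler_wpM2l// lerDl ltW.
Qed.

(** Here [e] tends to 0 in the regularized identity. From [H 0 = 0] and the bound on [eta] follows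
    [|H u| <= M u], which bounds [H q / (q + e)] uniformly and gives majorants on the domain and on
    the curve. *)
Lemma radial_gauss :
  (\int[mu2]_(y in Om) (2 * eta (sqdist x y)))%R =
  (\int[mu]_(s in `[0%R, L]) (H (sqdist x (a s, b s)) * dipole a b N1 N2 x s))%R.
Proof.

have cqd : continuous (sqdist x) by case: (c1_plane_sqdist x).
have e0 n : 0 < (n.+1%:R^-1 : R) by rewrite invr_gt0.
have qe (n : nat) y : sqdist x y + n.+1%:R^-1 != 0 by rewrite gt_eqF// ltr_wpDl// sqdist_ge0.
have cdiv n : continuous (div n.+1%:R^-1).
  have cHq : continuous (fun y => H (sqdist x y)).
    by move=> y; apply: continuous_comp; [exact: cqd|exact: cH].
  have ci : continuous (fun y => (sqdist x y + n.+1%:R^-1)^-1).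
    move=> y; apply: cvgV; first exact: qe.
    by apply: cvgD; [exact: cqd|exact: cvg_cst].
  move=> y; apply: cvgM; first exact: cvg_cst.
  apply: cvgB.
    apply: cvgD; first by apply: cvgM; [exact: cHq|exact: ci].
    apply: cvgM; first by apply: cvgM; [exact: cqd|exact: ci].
    by apply: continuous_comp; [exact: cqd|exact: ceta].
  by apply: cvgM; apply: cvgM; [exact: cqd|exact: ci|exact: cHq|exact: ci].
have ce2 : continuous (fun y => 2 * eta (sqdist x y)).
  move=> y; apply: cvgM; first exact: cvg_cst.
  by apply: continuous_comp; [exact: cqd|exact: ceta].
have xE : [set x] = [set x.1] `*` [set x.2].
  by apply/seteqP; split => [y -> //|[y1 y2] [/= -> ->]]; rewrite -surjective_pairing.
have lim1 : (\int[mu2]_(y in Om) div n.+1%:R^-1 y)%R @[n --> \oo] -->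
    (\int[mu2]_(y in Om) (2 * eta (sqdist x y)))%R.
  apply: (@Rdominated_cvg _ _ R mu2 (Om : set R2) (fun (n : nat) (y : R2) => div n.+1%:R^-1 y)
    (fun y : R2 => 2 * eta (sqdist x y)) (fun=> 2 * (M + M + M))).
  - exact: (sb_measurable sb).
  - by move=> n; apply: measurable_funTS; exact: continuous_measurable_plane.
  - by apply: measurable_funTS; exact: continuous_measurable_plane.
  (* Convergence is claimed only off x, where [q / q = 1]. *)
  - exists [set x]; split.
    + by rewrite xE; exact: measurableX.
    + rewrite xE; transitivity (mu [set x.1] * mu [set x.2])%E; first exact: product_measure1E.
      by rewrite lebesgue_measure_set1 mul0e.
    + move=> y /=; apply: contra_notP => yx Oy.
      have q0 := sqdist_ge0 x y.
      have qnz : sqdist x y != 0 by apply/eqP => /sqdist_eq0.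
      set r := sqdist x y in q0 qnz.
      have c2 (u : R) : u / (r + n.+1%:R^-1) @[n --> \oo] --> u / r.
        by apply: cvg_regularized => // /eqP; rewrite (negbTE qnz).
      have E : 2 * eta r = 2 * (H r / r + r / r * eta r - r / r * (H r / r)) by field.
      rewrite E; exact: (cvgM (cvg_cst (2 : R)) (cvgB (cvgD (c2 (H r))
        (cvgM (c2 r) (cvg_cst (eta r)))) (cvgM (c2 r) (c2 (H r))))).
  - apply: (sb_integrable sb (C := 2 * (M + M + M))); first exact: measurable_cst.
    by move=> y _; rewrite ger0_norm// mulr_ge0// !addr_ge0.
  - move=> n y Oy; rewrite /div normrM (ger0_norm (ler0n _ 2)) ler_wpM2l//.
    have q0 := sqdist_ge0 x y; have /andP[r0 r1] := ratio_bound (e0 n) q0.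
    apply: (le_trans (ler_normB _ _)); apply: lerD.
      apply: (le_trans (ler_normD _ _)); apply: lerD; first exact: H_ratio_bound.
      rewrite normrM (ger0_norm r0) -[leRHS]mul1r; apply: ler_pM => //; exact: etaM.
    rewrite normrM (ger0_norm r0) -[leRHS]mul1r; apply: ler_pM => //.
    exact: H_ratio_bound.
have lim2 : (\int[mu2]_(y in Om) div n.+1%:R^-1 y)%R @[n --> \oo] -->
    (\int[mu]_(s in `[0%R, L]) (H (q s) * g s))%R.
  rewrite (_ : (fun n => _) = fun n =>
    (\int[mu]_(s in `[0%R, L]) (H (q s) / (q s + n.+1%:R^-1) * P s))%R); last first.
    by apply/funext => n; exact: regularized_gauss.
  have cHq : continuous (fun s => H (q s)).
    by move=> s; apply: continuous_comp; [exact: continuous_curve_sqdist|exact: cH].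
  apply: (@Rdominated_cvg _ _ R mu `[0%R, L]%classic
    (fun (n : nat) s => H (q s) / (q s + n.+1%:R^-1) * P s)
    (fun s => H (q s) * g s) (fun s => M * `|P s|)) => //.
  - move=> n; apply: measurable_funTS; apply: continuous_measurable_fun => s.
    apply: cvgM; last exact: continuous_dipole_num.
    apply: cvgM; first exact: cHq.
    apply: cvgV; first exact: qe.
    by apply: cvgD; [exact: continuous_curve_sqdist|exact: cvg_cst].
  - apply: measurable_funTS; apply: measurable_funM; last exact: measurable_dipole.
    exact: continuous_measurable_fun.
  - apply: aeW => s _.
    rewrite (_ : H (q s) * g s = H (q s) * P s / q s); last by rewrite /g /dipole mulrA.
    rewrite (_ : (fun n => _) = fun n => H (q s) * P s / (q s + n.+1%:R^-1)); last first.
      by apply/funext => n; rewrite mulrAC.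
    apply: cvg_regularized; first exact: sqdist_ge0.
    by move=> qs; rewrite P0// mulr0.
  - apply: continuous_interval_integrable => s; apply: cvgM; first exact: cvg_cst.
    by apply: cvg_norm; exact: continuous_dipole_num.
  - move=> n s _; rewrite normrM ler_wpM2r//; apply: H_ratio_bound => //.
    exact: sqdist_ge0.
exact: (cvg_unique (@Rhausdorff R) lim1 lim2).
Qed.

End radial.

Section fatou_bound.
Context d (T : measurableType d) (R : realType).
Variables (mu : {measure set T -> \bar R}) (D : set T) (mD : measurable D).

(** This is for singular limits of functions whose integrals are explicit but for which no majorant
    is known in advance. Once integrable, the limit can itself serve as a majorant. *)
Lemma fatou_bound (f_ : nat -> T -> R) (f : T -> R) (C : R) :
  (forall n, measurable_fun D (f_ n)) ->
  (forall n x, D x -> 0 <= f_ n x) ->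
  (forall x, D x -> f_ n x @[n --> \oo] --> f x) ->
  (forall n, (\int[mu]_(x in D) (f_ n x)%:E <= C%:E)%E) ->
  (\int[mu]_(x in D) (f x)%:E <= C%:E)%E /\ mu.-integrable D (EFin \o f).
Proof.
move=> mf f0 cf fC.
have mff : measurable_fun D f by exact: measurable_fun_cvg mf cf.
have ff0 x : D x -> 0 <= f x.
  move=> Dx; rewrite -(cvg_lim (@Rhausdorff R) (cf x Dx)); apply: limr_ge.
    by apply/cvg_ex; exists (f x); exact: cf.
  by apply: nearW => n; exact: f0.
have le : (\int[mu]_(x in D) (f x)%:E <= C%:E)%E.
  have mE n : measurable_fun D (EFin \o f_ n) by exact/measurable_EFinP.
  have e0 n x : D x -> (0 <= (EFin \o f_ n) x)%E by move=> Dx; rewrite lee_fin f0.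
  have := fatou mu mD mE e0.
  rewrite (@eq_integral _ _ _ mu D (EFin \o f)); last first.
    move=> x /set_mem Dx; have cE : (f_ n x)%:E @[n --> \oo] --> (f x)%:E.
      by apply/fine_cvgP; split; [exact: nearW|exact: cf].
    by rewrite (cvg_limn_einf_sup cE).1.
  move=> /le_trans; apply.
  rewrite limn_einf_lim; apply: lime_le; first exact: is_cvg_einfs.
  apply: nearW => n; apply: (le_trans _ (fC n)).
  by apply: ereal_inf_lbound; exists n => /=.
split => //; apply/integrableP; split; first exact/measurable_EFinP.
rewrite (@eq_integral _ _ _ mu D (EFin \o f)); first exact: le_lt_trans le (ltry _).
by move=> x /set_mem Dx; rewrite /= ger0_norm// ff0.
Qed.

End fatou_bound.

(** * Integrability of the weak singularity and of the dipole density *)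

Section holder_singularity.
Context {R : realType}.
Local Notation mu := (@lebesgue_measure R).
Variable al : R.
Hypotheses (al0 : 0 < al) (al1 : al <= 1).

(* [|t|^(al - 1)], with value 0 at 0. *)
Definition weak_sing (t : R) : R := `|t| `^ (1 + al) / t ^+ 2.

(** The power [be] of the smoothed square [w c k] regularizes [|s - c|^(al - 1)]. *)
Let be := (al - 1) / 2.
Let w (c k s : R) := (s - c) * (s - c) + k.

Let w_gt0 c k s : 0 < k -> 0 < w c k s.
Proof. by move=> k0; rewrite ltr_wpDl// -expr2 sqr_ge0. Qed.

Let Dw c k s : is_derive s (1 : R) (w c k) (2 * (s - c)).
Proof.
have D1 := is_derive1_sub (is_derive1_id s) (is_derive1_cst c s).
apply: (is_derive1_eq (is_derive1_add (is_derive1_mul D1 D1) (is_derive1_cst k s))).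
by ring.
Qed.

Let Dpow c k s (p : R) : 0 < k ->
  is_derive s (1 : R) (fun s => w c k s `^ p) (p * w c k s `^ (p - 1) * (2 * (s - c))).
Proof.
move=> k0; have D := @is_derive1_compose _ (fun u : R => u `^ p) (w c k) s _ _
  (is_derive1_powR p (w_gt0 c s k0)) (Dw c k s).
exact: D.
Qed.

Let F c k s := (s - c) * w c k s `^ be.

Let dF c k s := (s - c) * (be * w c k s `^ (be - 1) * (2 * (s - c))) + w c k s `^ be.

Let DF c k s : 0 < k -> is_derive s (1 : R) (F c k) (dF c k s).
Proof.
move=> k0; have D1 := is_derive1_sub (is_derive1_id s) (is_derive1_cst c s).
apply: (is_derive1_eq (is_derive1_mul D1 (Dpow c s be k0))).
by rewrite /dF; ring.
Qed.

Let cpow c k (p : R) : 0 < k -> continuous (fun s => w c k s `^ p).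
Proof. by move=> k0 s; exact: is_derive_continuous (Dpow c s p k0). Qed.

Let cdF c k : 0 < k -> continuous (dF c k).
Proof.
move=> k0 s; have cl : continuous (fun s : R => s - c).
  by move=> t; apply: cvgB; [exact: cvg_id|exact: cvg_cst].
apply: cvgD; last exact: cpow.
apply: cvgM; first exact: cl.
apply: cvgM; last by apply: cvgM; [exact: cvg_cst|exact: cl].
by apply: cvgM; [exact: cvg_cst|exact: cpow].
Qed.

(** With [z] the power [be - 1] of [w], one has [dF = z (al w + (1 - al) k)]: up to the factor [al],
    the derivative of [F] dominates the regularized singularity. *)
Let dF_ge c k s : 0 < k -> al * w c k s `^ be <= dF c k s.
Proof.
move=> k0; have w0 := w_gt0 c s k0.
have wE : w c k s `^ be = w c k s `^ (be - 1) * w c k s.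
  by rewrite -[X in _ * X]powRr1 ?ltW// -powRD ?subrK// (gt_eqF w0) implybT.
rewrite /dF wE; set z := w c k s `^ (be - 1).
have z0 : 0 <= z by exact: powR_ge0.
have -> : (s - c) * (be * z * (2 * (s - c))) + z * w c k s =
  al * (z * w c k s) + (1 - al) * (z * k) by rewrite /be /w; field.
by rewrite lerDl mulr_ge0// ?subr_ge0// mulr_ge0// ltW.
Qed.

(** [|F|] is at most [w] to the power [1 / 2 + be = al / 2], hence at most 1 or at most [w]. What
    matters is uniformity in [k]. *)
Let F_le c k s : 0 < k <= 1 -> `|F c k s| <= (s - c) ^+ 2 + 2.
Proof.
move=> /andP[k0 k1]; have w0 := w_gt0 c s k0.
have h1 : `|s - c| <= w c k s `^ (1 / 2).
  rewrite -[leLHS]powRr1// -{1}(_ : 2 * (1 / 2) = 1 :> R); last by field.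
  rewrite powRrM (powR_mulrn 2)// real_normK ?num_real//.
  apply: ge0_ler_powR; rewrite ?nnegrE ?sqr_ge0 ?divr_ge0//; first exact: ltW.
  by rewrite /w expr2; lra.
rewrite /F normrM (ger0_norm (powR_ge0 _ _)).
apply: (@le_trans _ _ (w c k s `^ (1 / 2) * w c k s `^ be)).
  by rewrite ler_wpM2r ?powR_ge0.
rewrite -powRD; last by rewrite (gt_eqF w0) implybT.
have [w1|w1] := leP (w c k s) 1.
  apply: (@le_trans _ _ 1); last by have := sqr_ge0 (s - c); lra.
  rewrite -[leRHS](_ : 1 `^ (1 / 2 + be) = 1); last by rewrite powR1.
  apply: ge0_ler_powR; rewrite ?nnegrE//.
    by have := al0; rewrite /be => h; lra.
  exact: ltW.
apply: (@le_trans _ _ (w c k s)); last by rewrite /w expr2; lra.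
rewrite -[leRHS](powRr1 (ltW w0)); apply: ler_powR; first exact: ltW.
by have := al1; rewrite /be => ?; lra.
Qed.

Let h c k s := `|s - c| `^ (1 + al) / ((s - c) ^+ 2 + k).

Let h_le c k s : 0 < k -> h c k s <= w c k s `^ be.
Proof.
move=> k0; have w0 := w_gt0 c s k0.
rewrite /h -[X in _ / X]/(w c k s) ler_pdivrMr//.
have -> : w c k s `^ be * w c k s = w c k s `^ ((1 + al) / 2).
  rewrite -[X in _ * X]powRr1 ?ltW// -powRD ?(gt_eqF w0) ?implybT//.
  by congr (_ `^ _); rewrite /be; field.
have -> : `|s - c| `^ (1 + al) = ((s - c) ^+ 2) `^ ((1 + al) / 2).
  rewrite -(@real_normK _ (s - c)) ?num_real// -(powR_mulrn 2)// -powRrM.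
  by congr (_ `^ _); field.
apply: ge0_ler_powR; rewrite ?nnegrE ?sqr_ge0//; last by rewrite /w expr2; lra.
- by have := al0 => ?; rewrite divr_ge0//; lra.
- exact: ltW.
Qed.

(** The integral of [dF] is a difference of values of [F] even across the singularity at [c], so
    that the interval is not split there, and it is bounded uniformly in [k]. *)
Lemma weak_sing_integrable (c p q : R) : p <= q ->
  mu.-integrable `[p, q]%classic (EFin \o (fun s => weak_sing (s - c))).
Proof.
move=> pq.
(* The bounds of [F] at the two end points, divided by the factor [al] of [dF_ge]. *)
pose C := ((q - c) ^+ 2 + 2 + ((p - c) ^+ 2 + 2)) / al.
have k0 n : 0 < (n.+1%:R^-1 : R) by rewrite invr_gt0.
have k1 n : (n.+1%:R^-1 : R) <= 1 by rewrite invf_le1// ler1n.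
have ch n : measurable_fun setT (h c n.+1%:R^-1).
  apply: measurable_funM.
    apply: (measurableT_comp (measurable_powR _)).
    apply: continuous_measurable_fun => s; apply: cvg_norm.
    by apply: cvgB; [exact: cvg_id|exact: cvg_cst].
  apply: continuous_measurable_fun => s.
  apply: cvgV; first by rewrite gt_eqF// ltr_wpDl// sqr_ge0.
  apply: cvgD; last exact: cvg_cst.
  by apply: cvgM; (apply: cvgB; [exact: cvg_id|exact: cvg_cst]).
have h0 n s : 0 <= h c n.+1%:R^-1 s.
  by rewrite divr_ge0 ?powR_ge0// addr_ge0 ?sqr_ge0// ltW.
have [||||_ //] := @fatou_bound _ _ R mu `[p, q]%classic (measurable_itv _)
  (fun (n : nat) s => h c n.+1%:R^-1 s) (fun s => weak_sing (s - c)) C.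
- by move=> n; apply: measurable_funTS; exact: ch.
- by [].
- move=> s _; apply: cvg_regularized; first exact: sqr_ge0.
  move/eqP; rewrite sqrf_eq0 => /eqP ->.
  by have := al0 => ?; rewrite normr0 powR0// gt_eqF//; lra.
- move=> n; apply: (@le_trans _ _ (\int[mu]_(s in `[p, q]) (al^-1 * dF c n.+1%:R^-1 s)%:E)%E).
    apply: ge0_le_integral => //.
    + by move=> s _; rewrite lee_fin.
    + by apply/measurable_EFinP; apply: measurable_funTS; exact: ch.
    + apply/measurable_EFinP; apply: measurable_funTS; apply: continuous_measurable_fun => s.
      by apply: cvgM; [exact: cvg_cst|exact: cdF].
    + move=> s _; rewrite lee_fin ler_pdivlMl//.
      by apply: (le_trans _ (dF_ge c s (k0 n))); apply: ler_wpM2l; [exact: ltW|exact: h_le].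
  have cdF' : continuous (fun s => al^-1 * dF c n.+1%:R^-1 s).
    by move=> s; apply: cvgM; [exact: cvg_cst|exact: cdF].
  have fin : (\int[mu]_(s in `[p, q]) (al^-1 * dF c n.+1%:R^-1 s)%:E)%E \is a fin_num.
    have ii := @continuous_interval_integrable R p q _ cdF'.
    by apply: integrable_fin_num => //; exact: ii.
  rewrite -(fineK fin) lee_fin -/(Rintegral _ _ _).
  have DF' s : is_derive s (1 : R) (fun s => al^-1 * F c n.+1%:R^-1 s)
      (al^-1 * dF c n.+1%:R^-1 s).
    have D := DF c s (k0 n).
    by apply: (is_derive1_eq (is_derive1_mul (is_derive1_cst al^-1 s) D)); ring.
  rewrite (FTC2_continuous pq cdF' DF').
  have kk : 0 < (n.+1%:R^-1 : R) <= 1 by rewrite k0 k1.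
  have := F_le c p kk; have := F_le c q kk; rewrite !ler_norml => /andP[_ Fq] /andP[Fp _].
  rewrite /C mulrC [X in _ - X]mulrC -mulrBl ler_pM2r ?invr_gt0//; lra.
Qed.

Lemma weak_sing_ge0 t : 0 <= weak_sing t.
Proof. by rewrite divr_ge0 ?powR_ge0 ?sqr_ge0. Qed.

End holder_singularity.

Section dipole_integrable.
Context {R : realType}.
Local Notation mu := (@lebesgue_measure R).
Variables (L : R) (a b da db N1 N2 : R -> R) (Om : set (R * R)).
Hypothesis sb : smooth_boundary L a b da db N1 N2 Om.
Variables (K al : R).
Hypotheses (al0 : 0 < al) (al1 : al <= 1) (K0 : 0 <= K).
Hypothesis Ha : forall s s', `|da s - da s'| <= K * `|s - s'| `^ al.
Hypothesis Hb : forall s s', `|db s - db s'| <= K * `|s - s'| `^ al.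
Variable x : R * R.

Let g := dipole a b N1 N2 x.
Let P := dipole_num a b N1 N2 x.
Let q s := sqdist x (a s, b s).

Let MVT_bound (f df : R -> R) (s t C : R) :
  (forall u, is_derive u (1 : R) f (df u)) ->
  (forall u, `|u - s| <= `|t - s| -> `|df u| <= C) -> `|f t - f s| <= C * `|t - s|.
Proof.
move=> Df dfC.
have cf : continuous f by move=> u; exact: is_derive_continuous (Df u).
have [ts|st|->] := ltgtP t s; last by rewrite !subrr normr0 mulr0.
  have [|c cI E] := @MVT R f df t s ts (fun u _ => Df u); first exact: continuous_subspaceT.
  rewrite distrC E normrM (distrC t s) ler_wpM2r// dfC//.
  move: cI; rewrite in_itv /= => /andP[? ?].
  by rewrite !ltr0_norm; lra.
have [|c cI E] := @MVT R f df s t st (fun u _ => Df u); first exact: continuous_subspaceT.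
rewrite E normrM ler_wpM2r// dfC//.
move: cI; rewrite in_itv /= => /andP[? ?].
by rewrite !gtr0_norm; lra.
Qed.

Let N_le1 s : `|N1 s| <= 1 /\ `|N2 s| <= 1.
Proof.
have u := sb_nunit sb s; have := sqr_ge0 (N1 s); have := sqr_ge0 (N2 s) => h1 h2.
by split; rewrite -(@expr_le1 _ 2)// real_normK ?num_real//; lra.
Qed.

(** [f] measures displacement along the normal at [s], not at [s0]. Its derivative vanishes at [s],
    hence is at most [2 K |u - s|^al] at [u] by Hoelder continuity of the tangent. *)
Let dipole_num_bound s0 s : x = (a s0, b s0) ->
  `|P s| <= 2 * K * `|s - s0| `^ (1 + al).
Proof.
move=> xE.
pose f u := (a u - a s) * N1 s + (b u - b s) * N2 s.
have Df u : is_derive u (1 : R) f (da u * N1 s + db u * N2 s).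
  have D1 := is_derive1_mul (is_derive1_sub (sb_da sb u) (is_derive1_cst (a s) u))
    (is_derive1_cst (N1 s) u).
  have D2 := is_derive1_mul (is_derive1_sub (sb_db sb u) (is_derive1_cst (b s) u))
    (is_derive1_cst (N2 s) u).
  by apply: (is_derive1_eq (is_derive1_add D1 D2)); ring.
have -> : P s = - (f s0 - f s) by rewrite /P /dipole_num /f xE /=; ring.
rewrite normrN.
have -> : 2 * K * `|s - s0| `^ (1 + al) = 2 * K * `|s0 - s| `^ al * `|s0 - s|.
  have := al0 => ?.
  rewrite (distrC s) (addrC 1) powRD; last by rewrite gt_eqF//; lra.
  by rewrite powRr1// mulrA.
apply: (MVT_bound Df) => u us.
have -> : da u * N1 s + db u * N2 s = (da u - da s) * N1 s + (db u - db s) * N2 s.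
  have -> : da u * N1 s + db u * N2 s = da u * N1 s + db u * N2 s -
    (N1 s * da s + N2 s * db s) by rewrite (sb_northo sb) subr0.
  by ring.
have [n1 n2] := N_le1 s.
have pw : `|u - s| `^ al <= `|s0 - s| `^ al.
  by apply: ge0_ler_powR; rewrite ?nnegrE//; exact: ltW.
apply: (le_trans (ler_normD _ _)).
have -> : 2 * K * `|s0 - s| `^ al = K * `|s0 - s| `^ al + K * `|s0 - s| `^ al by ring.
by apply: lerD; rewrite normrM -[leRHS]mulr1; apply: ler_pM => //;
  [apply: (le_trans (Ha u s))|apply: (le_trans (Hb u s))]; rewrite ler_wpM2l.
Qed.

(** The displacement along the tangent at [s0] has derivative 1 at [s0], so nearby it is at least
    half the parameter distance; squaring gives the factor [1 / 4]. *)
Let sqdist_lower s0 : x = (a s0, b s0) ->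
  exists2 d, 0 < d & forall s, `|s - s0| < d -> (s - s0) ^+ 2 / 4 <= q s.
Proof.
move=> xE.
pose f u := (a u - a s0) * da s0 + (b u - b s0) * db s0.
pose df u := da u * da s0 + db u * db s0.
have Df u : is_derive u (1 : R) f (df u).
  have D1 := is_derive1_mul (is_derive1_sub (sb_da sb u) (is_derive1_cst (a s0) u))
    (is_derive1_cst (da s0) u).
  have D2 := is_derive1_mul (is_derive1_sub (sb_db sb u) (is_derive1_cst (b s0) u))
    (is_derive1_cst (db s0) u).
  by apply: (is_derive1_eq (is_derive1_add D1 D2)); rewrite /df; ring.
have cdf : {for s0, continuous df}.
  by apply: cvgD; apply: cvgM; (exact: cvg_cst || exact: (sb_cda sb) || exact: (sb_cdb sb)).
have df0 : df s0 = 1 by rewrite /df -!expr2 (sb_unit sb).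
have h2 : 0 < 1 / 2 :> R by lra.
have [d d0 Hd] := continuous_near_abs cdf h2.
exists d => // s sd.
have D' u : is_derive u (1 : R) (fun u => f u - u) (df u - 1).
  by apply: is_derive1_sub; exact: is_derive1_id.
have H : `|(f s - s) - (f s0 - s0)| <= 1 / 2 * `|s - s0|.
  apply: (MVT_bound D') => u us.
  by have := Hd u (le_lt_trans us sd); rewrite df0 => /ltW.
have fs0 : f s0 = 0 by rewrite /f !subrr !mul0r addr0.
have E : (f s - s) - (f s0 - s0) = f s - (s - s0) by rewrite fs0; ring.
rewrite E in H.
have H2 : `|s - s0| / 2 <= `|f s|.
  have : `|s - s0| <= `|f s| + `|f s - (s - s0)|.
    by rewrite -{1}(_ : f s - (f s - (s - s0)) = s - s0) ?ler_normB//; ring.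
  by lra.
have CS : f s ^+ 2 <= q s.
  have -> : q s = f s ^+ 2 + ((a s - a s0) * db s0 - (b s - b s0) * da s0) ^+ 2.
    rewrite /q /sqdist xE /=.
    transitivity (((a s - a s0) ^+ 2 + (b s - b s0) ^+ 2) * (da s0 ^+ 2 + db s0 ^+ 2)).
      by rewrite (sb_unit sb) mulr1.
    by rewrite /f; ring.
  by rewrite lerDl sqr_ge0.
apply: le_trans CS.
have -> : (s - s0) ^+ 2 / 4 = (`|s - s0| / 2) ^+ 2.
  by rewrite expr_div_n real_normK ?num_real// -natrX.
rewrite -[leRHS]real_normK ?num_real//; apply: lerXn2r => //.
by rewrite nnegrE divr_ge0.
Qed.

(** Near [s0] the two bounds give [2 K |s - s0|^(1 + al)] over [(s - s0)^2 / 4], whence [8 K]. The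
    rest of the period stays at distance at least [e] from x. *)
Let dipole_local_bound s0 : x = (a s0, b s0) -> exists C0 C1,
  [/\ 0 <= C0, 0 <= C1 & forall s, `|s - s0| <= L / 2 ->
     `|g s| <= C0 + C1 * weak_sing al (s - s0)].
Proof.
move=> xE; have L0 := sb_len sb.
have [d1 d10 Hd1] := sqdist_lower xE.
pose d := Num.min d1 (L / 2).
have d0 : 0 < d by rewrite lt_min d10 divr_gt0.
have dd1 : d <= d1 by rewrite ge_min lexx.
have dL : d <= L / 2 by rewrite ge_min lexx orbT.
have [e e0 He] := sb_away sb s0 d0 dL.
have [C HC] := continuous_bounded_segment (s0 - L / 2) (s0 + L / 2)
  (continuous_dipole_num sb (x := x)).
exists (`|C| / e ^+ 2), (8 * K); split.
- by rewrite divr_ge0// sqr_ge0.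
- by rewrite mulr_ge0.
move=> s sL.
have [sd|ds] := ltP `|s - s0| d.
  apply: (@le_trans _ _ (8 * K * weak_sing al (s - s0))); last first.
    by rewrite lerDr divr_ge0// sqr_ge0.
  rewrite /g /dipole normrM normfV (ger0_norm (sqdist_ge0 _ _)) -/P -/(q s).
  have [->|sn] := eqVneq s s0.
    rewrite {1}/P /dipole_num xE /= !subrr !mul0r addr0 normr0 mul0r.
    by rewrite mulr_ge0 ?weak_sing_ge0// mulr_ge0.
  have ss0 : 0 < (s - s0) ^+ 2 by rewrite exprn_even_gt0 //= subr_eq0.
  have qs : (s - s0) ^+ 2 / 4 <= q s by apply: Hd1; exact: lt_le_trans sd dd1.
  have q0 : 0 < q s by apply: lt_le_trans qs; rewrite divr_gt0.
  rewrite ler_pdivrMr//; apply: (le_trans (dipole_num_bound s xE)).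
  have -> : 2 * K * `|s - s0| `^ (1 + al) =
      8 * K * weak_sing al (s - s0) * ((s - s0) ^+ 2 / 4).
    by rewrite /weak_sing; field; rewrite subr_eq0.
  by rewrite ler_wpM2l// mulr_ge0 ?weak_sing_ge0// mulr_ge0.
apply: (@le_trans _ _ (`|C| / e ^+ 2)); last by rewrite lerDl mulr_ge0 ?weak_sing_ge0// mulr_ge0.
have qe : e ^+ 2 <= q s.
  rewrite leNgt; apply/negP => qe; apply: (He s ds sL).
    rewrite -(ltr_pXn2r (n := 2))// ?nnegrE ?(ltW e0)// real_normK ?num_real//.
    by apply: le_lt_trans qe; rewrite /q /sqdist xE /= lerDl sqr_ge0.
  rewrite -(ltr_pXn2r (n := 2))// ?nnegrE ?(ltW e0)// real_normK ?num_real//.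
  by apply: le_lt_trans qe; rewrite /q /sqdist xE /= lerDr sqr_ge0.
rewrite /g /dipole normrM normfV (ger0_norm (sqdist_ge0 _ _)) -/P -/(q s).
have e2 : 0 < e ^+ 2 by rewrite exprn_gt0.
apply: ler_pM => //; first by rewrite invr_ge0 sqdist_ge0.
  apply: (le_trans _ (ler_norm C)); apply: HC.
  by move: sL; rewrite ler_norml => /andP[? ?]; apply/andP; split; lra.
by rewrite lef_pV2// posrE //; exact: lt_le_trans e2 qe.
Qed.

Lemma dipole_integrable :
  mu.-integrable `[0%R, L]%classic (EFin \o dipole a b N1 N2 x).
Proof.
have L0 := sb_len sb.
have mI : measurable (`[0, L]%classic : set (measurableTypeR R)) by exact: measurable_itv.
have [[s1 xE]|off] := pselect (exists s, x = (a s, b s)); last first.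
  apply: continuous_interval_integrable => s; apply: cvgM.
    exact: (continuous_dipole_num sb).
  apply: cvgV; last exact: (continuous_curve_sqdist sb).
  by apply/eqP => /sqdist_eq0 E; apply: off; exists s.
(* The representative closest to [L / 2] lies in [[0, L]]. *)
have [s0 s0L H0] := periodic_representative (L / 2) s1 L0.
have xE0 : x = (a s0, b s0).
  rewrite xE (H0 _ a) ?(H0 _ b)// => t; first by case: (sb_per sb t).
  by case: (sb_per sb t).
have [C0 [C1 [C00 C10 HC]]] := dipole_local_bound xE0.
have gL t : g (t + L) = g t.
  rewrite /g /dipole /dipole_num; have [-> ->] := sb_per sb t.
  by have [-> ->] := sb_nper sb t.
have gNL t : g (t - L) = g t by rewrite -gL subrK.
(* The local bound reaches half a period to either side of [s0]; the rest of [[0, L]] is controlled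
   by the translated singularities at [s0 + L] and [s0 - L]. *)
pose B s := C0 + (C1 * weak_sing al (s - s0) + (C1 * weak_sing al (s - (s0 + L)) +
   C1 * weak_sing al (s - (s0 - L)))).
have w0 t : 0 <= C1 * weak_sing al t by rewrite mulr_ge0 ?weak_sing_ge0.
have iw c : mu.-integrable `[0%R, L]%classic (EFin \o (fun s => C1 * weak_sing al (s - c))).
  have := integrableZl mI C1 (weak_sing_integrable al0 al1 c (ltW L0)).
  by apply: eq_integrable.
have iB : mu.-integrable `[0%R, L]%classic (EFin \o B).
  have ic : mu.-integrable `[0%R, L]%classic (EFin \o (fun=> C0)).
    by apply: continuous_interval_integrable => s; exact: cvg_cst.
  have i1 := integrableD mI (iw (s0 + L)) (iw (s0 - L)).
  have i2 := integrableD mI (iw s0) i1.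
  exact: (integrableD mI ic i2).
apply: (le_integrable mI _ _ iB).
  by apply/measurable_EFinP; apply: measurable_funTS; exact: (measurable_dipole sb).
move=> s /=; rewrite in_itv /= => /andP[s0' sL]; rewrite lee_fin.
apply: (le_trans _ (ler_norm _)); rewrite -/(g s) /B.
move: s0L; rewrite ler_norml => /andP[h1 h2].
have [lo|hi] := leP s (s0 + L / 2); last first.
  have /HC : `|(s - L) - s0| <= L / 2 by rewrite ler_norml; apply/andP; split; lra.
  rewrite gNL (_ : s - L - s0 = s - (s0 + L)); last by ring.
  by have := w0 (s - s0); have := w0 (s - (s0 - L)); lra.
have [lo'|hi'] := ltP s (s0 - L / 2).
  have /HC : `|(s + L) - s0| <= L / 2 by rewrite ler_norml; apply/andP; split; lra.
  rewrite gL (_ : s + L - s0 = s - (s0 - L)); last by ring.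
  by have := w0 (s - s0); have := w0 (s - (s0 + L)); lra.
have /HC : `|s - s0| <= L / 2 by rewrite ler_norml; apply/andP; split; lra.
by have := w0 (s - (s0 - L)); have := w0 (s - (s0 + L)); lra.
Qed.

End dipole_integrable.

(** * The Gauss integral *)

Section planar_gaussian.
Context {R : realType}.
Local Notation mu := (@lebesgue_measure R).
Local Notation R2 := (measurableTypeR R * measurableTypeR R)%type.
Local Notation mu2 := (mu \x mu)%E.

(** The factor 2 is that of the density [2 * eta] in [radial_gauss]; it makes the total mass
    [2 pi]. *)
Definition gauss2 (v : R2) : R := 2 * (gauss_fun v.1 * gauss_fun v.2).

Lemma gauss2_ge0 v : 0 <= gauss2 v.
Proof. by rewrite mulr_ge0// mulr_ge0 ?gauss_fun_ge0. Qed.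

Lemma measurable_gauss2 : measurable_fun setT gauss2.
Proof.
apply: measurable_funM => //; apply: measurable_funM.
  by apply: (measurableT_comp measurable_gauss_fun).
by apply: (measurableT_comp measurable_gauss_fun).
Qed.

Lemma integral_gauss2 : (\int[mu2]_v (gauss2 v)%:E = (2 * pi)%:E)%E.
Proof.
have mg : measurable_fun setT (fun x : R => (gauss_fun x)%:E).
  by apply/measurable_EFinP; exact: measurable_gauss_fun.
have g0 (x : R) : (0 <= (gauss_fun x)%:E)%E by rewrite lee_fin gauss_fun_ge0.
rewrite fubini_tonelli1; last 2 first.
- by apply/measurable_EFinP; exact: measurable_gauss2.
- by move=> v; rewrite lee_fin gauss2_ge0.
transitivity (\int[mu]_x ((2 * Num.sqrt pi)%:E * (gauss_fun x)%:E))%E.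
  apply: eq_integral => x _; rewrite /fubini_F /gauss2 /=.
  under eq_integral do rewrite mulrA EFinM.
  rewrite ge0_integralZl//; last by rewrite lee_fin mulr_ge0 ?gauss_fun_ge0.
  by rewrite integralT_gauss -!EFinM; congr EFin; ring.
rewrite ge0_integralZl//.
rewrite integralT_gauss -EFinM; congr EFin.
by rewrite -mulrA -expr2 sqr_sqrtr// pi_ge0.
Qed.

Lemma gauss2_integrable : mu2.-integrable setT (EFin \o gauss2).
Proof.
apply/integrableP; split; first by apply/measurable_EFinP; exact: measurable_gauss2.
rewrite (@eq_integral _ _ _ mu2 setT (EFin \o gauss2)).
  by rewrite integral_gauss2 ltry.
by move=> v _; rewrite /= ger0_norm// gauss2_ge0.
Qed.

Variables n1 n2 : R.
Hypothesis nn : n1 ^+ 2 + n2 ^+ 2 = 1.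

Let dot (v : R2) := v.1 * n1 + v.2 * n2.

Let mdot : measurable_fun setT dot.
Proof. by apply: measurable_funD; apply: measurable_funM. Qed.

Let mdotC (A : set R) : measurable A -> measurable [set v | A (dot v)].
Proof. by move=> mA; rewrite -[X in measurable X]setTI; exact: mdot. Qed.

(** Unless the line is vertical its vertical sections are single points; a vertical line is a
    product with a null factor. *)
Lemma line_null : mu2 [set v : R2 | v.1 * n1 + v.2 * n2 = 0] = 0%E.
Proof.
have [n20|n20] := eqVneq n2 0.
  have n10 : n1 != 0.
    by apply/eqP => n10; move: nn; rewrite n10 n20 expr0n addr0 => /eqP; rewrite eq_sym oner_eq0.
  have -> : [set v : R2 | v.1 * n1 + v.2 * n2 = 0] = [set 0] `*` setT.
    apply/seteqP; split => v /=; rewrite n20 mulr0 addr0.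
      by move/eqP; rewrite mulf_eq0 (negbTE n10) orbF => /eqP.
    by move=> [-> _]; rewrite mul0r.
  transitivity (mu [set 0%R] * mu setT)%E; first exact: product_measure1E.
  by rewrite lebesgue_measure_set1 mul0e.
rewrite /product_measure1 /=.
rewrite (@eq_integral _ _ _ _ _ (fun=> 0%E)); first by rewrite integral0.
move=> x _ /=; rewrite (_ : xsection _ x = [set - (x * n1) / n2]).
  exact: lebesgue_measure_set1.
apply/seteqP; split => y; rewrite /xsection /= inE /=.
  move=> /eqP; rewrite addrC addr_eq0 => /eqP <-; by rewrite mulfK.
by move=> ->; rewrite divfK// subrr.
Qed.

(** The map [v -> - v] preserves the Gaussian and exchanges the two open half-planes; the line
    between them is null. *)
Lemma integral_gauss2_half :
  (\int[mu2]_(v in [set v : R2 | v.1 * n1 + v.2 * n2 < 0]%R) (gauss2 v)%:E = pi%:E)%E.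
Proof.
pose N : set R2 := [set v | v.1 * n1 + v.2 * n2 < 0].
pose Z : set R2 := [set v | v.1 * n1 + v.2 * n2 = 0].
pose Q : set R2 := [set v | 0 < v.1 * n1 + v.2 * n2].
have mN : measurable N.
  by apply: (@mdotC [set u | u < 0]); apply: open_measurable; exact: open_lt.
have mQ : measurable Q.
  by apply: (@mdotC [set u | 0 < u]); apply: open_measurable; exact: open_gt.
have mZ : measurable Z by apply: (@mdotC [set 0]).
have mG : measurable_fun setT (EFin \o gauss2) by apply/measurable_EFinP; exact: measurable_gauss2.
have G0 v : (0 <= (gauss2 v)%:E)%E by rewrite lee_fin gauss2_ge0.
have NQ : (\int[mu2]_(v in N) (gauss2 v)%:E = \int[mu2]_(v in Q) (gauss2 v)%:E)%E.
  rewrite integral_mkcond [RHS]integral_mkcond -[LHS]ge0_integral2_opp; last 2 first.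
  - by apply/(measurable_restrictT _ _).1 => //; exact: measurable_funTS.
  - by move=> v; apply: erestrict_ge0.
  apply: eq_integral => v _; rewrite !patchE /=.
  have -> : ((- v.1, - v.2) \in N) = (v \in Q).
    by apply/idP/idP; rewrite !inE /N /Q /= !mulNr -opprD oppr_lt0.
  by case: ifP => // _; rewrite /gauss2 /gauss_fun /= !sqrrN.
have Z0 : (\int[mu2]_(v in Z) (gauss2 v)%:E = 0)%E.
  by apply: null_set_integral => //; [exact: measurable_funTS|exact: line_null].
have tot : (\int[mu2]_v (gauss2 v)%:E =
    \int[mu2]_(v in N) (gauss2 v)%:E + \int[mu2]_(v in Q) (gauss2 v)%:E)%E.
  have TE : setT = N `|` Q `|` Z.
    apply/seteqP; split => // v _; rewrite /N /Q /Z /=.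
    by case: (ltgtP (v.1 * n1 + v.2 * n2) 0) => ?; [left; left|left; right|right].
  rewrite [in LHS]TE ge0_integral_setU//=.
  - rewrite Z0 adde0 ge0_integral_setU//=.
    + exact: measurable_funTS.
    + apply/disj_setPS => v [/= h1 h2]; move: (lt_trans h1 h2); by rewrite ltxx.
  - exact: measurableU.
  - exact: measurable_funTS.
  - by apply/disj_setPS => v [/= [h|h] h2]; move: h; rewrite /N /Q /= h2 ltxx.
move: tot; rewrite integral_gauss2 -NQ.
set I := (\int[mu2]_(v in N) _)%E => tot.
have I0 : (0 <= I)%E by apply: integral_ge0.
case: I I0 tot => [r r0|//|//] [rE].
by congr EFin; lra.
Qed.

End planar_gaussian.

(** * Blow-up of the domain at a point *)

Section total_dipole.
Context {R : realType}.
Local Notation mu := (@lebesgue_measure R).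
Local Notation R2 := (measurableTypeR R * measurableTypeR R)%type.
Local Notation mu2 := (mu \x mu)%E.

Lemma near_right_harmonic (P : R -> Prop) :
  (\forall t \near 0^'+, P t) -> \forall n \near \oo, P n.+1%:R^-1.
Proof.
move=> [e /= e0 eP].
have := @cvg_harmonic R; move/cvgrPdist_lt => /(_ e e0).
apply: filterS => n /= ne; apply: eP; last by rewrite invr_gt0.
by rewrite /ball /=.
Qed.

Lemma open_ray (U : set (R * R)) (x : R * R) (v : R * R) : open U -> U x ->
  \forall t \near (0 : R)^'+, U (x.1 + t * v.1, x.2 + t * v.2).
Proof.
move=> oU Ux; pose f (t : R) := (x.1 + t * v.1, x.2 + t * v.2).
have cf : {for 0, continuous f}.
  by apply: continuous_at_pair; (apply: cvgD; first exact: cvg_cst);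
    apply: cvgM; (exact: cvg_id || exact: cvg_cst).
have : nbhs (f 0) U.
  by rewrite /f !mul0r !addr0 -surjective_pairing; exact: open_nbhs_nbhs.
by move=> nU; exact: (cvg_at_right_filter cf nU).
Qed.

Variables (L : R) (a b da db N1 N2 : R -> R) (Om : set (R * R)).
Hypothesis sb : smooth_boundary L a b da db N1 N2 Om.
Variable x : R * R.
Hypothesis intg : mu.-integrable `[0%R, L]%classic (EFin \o dipole a b N1 N2 x).

(** The domain as seen from x at scale [t]. Up to a null set it tends to the plane, to a half-plane
    or to the empty set. *)
Let ind (t : R) (v : R2) : R :=
  \1_(Om : set R2) ((x.1 + t * v.1, x.2 + t * v.2) : R2).

Let mind t : measurable_fun setT (ind t).
Proof.
apply: (measurableT_comp (measurable_indic (sb_measurable sb))).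
by apply: measurable_fun_pair; apply: measurable_funD => //; apply: measurable_funM.
Qed.

(** This is [radial_gauss] for [H u = 1 - exp (- u / k^2)], followed by [y = x + k v]; the area
    factor [k^2] cancels the denominator in [eta]. *)
Let gaussian_identity (k : R) : 0 < k ->
  (\int[mu2]_v (gauss2 v * ind k v))%R =
  (\int[mu]_(s in `[0%R, L]) ((1 - expR (- sqdist x (a s, b s) / k ^+ 2)) *
     dipole a b N1 N2 x s))%R.
Proof.
move=> k0; have e0 : 0 < k ^+ 2 by rewrite exprn_gt0.
pose H u := 1 - expR (- u / k ^+ 2).
pose eta u := expR (- u / k ^+ 2) / k ^+ 2.
have DH u : is_derive u (1 : R) H (eta u).
  have D1 := is_derive1_mul (is_derive1_opp (is_derive1_id u)) (is_derive1_cst (k ^+ 2)^-1 u).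
  have D2 := @is_derive1_compose _ expR (fun u => - u / k ^+ 2) u _ _ (is_derive_expR _) D1.
  by apply: (is_derive1_eq (is_derive1_sub (is_derive1_cst 1 u) D2)); rewrite /eta; ring.
have ceta : continuous eta.
  move=> u; apply: cvgM; last exact: cvg_cst.
  apply: (@continuous_comp _ _ _ (fun u : R => - u / k ^+ 2) expR); last exact: continuous_expR.
  by apply: cvgM; [apply: cvgN; exact: cvg_id|exact: cvg_cst].
have H0 : H 0 = 0 by rewrite /H oppr0 mul0r expR0 subrr.
have etaM u : 0 <= u -> `|eta u| <= (k ^+ 2)^-1.
  move=> u0; rewrite /eta ger0_norm; last by rewrite divr_ge0 ?expR_ge0// ltW.
  rewrite ler_piMl ?invr_ge0 ?(ltW e0)// -expR0 ler_expR mulNr oppr_le0.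
  by rewrite divr_ge0// ltW.
rewrite -(radial_gauss sb x DH ceta H0 etaM).
rewrite [RHS]Rintegral_mkcond /Rintegral; congr fine.
pose f (y : R2) : \bar R := ((2 * eta (sqdist x y)) * \1_(Om : set R2) y)%:E.
have mf : measurable_fun setT f.
  apply/measurable_EFinP; apply: measurable_funM; last exact: measurable_indic (sb_measurable sb).
  apply: continuous_measurable_plane => y; apply: cvgM; first exact: cvg_cst.
  apply: (@continuous_comp _ _ _ (sqdist x) eta); last exact: ceta.
  by case: (c1_plane_sqdist x) => + _ _ _; apply.
have f0 y : (0 <= f y)%E.
  by rewrite lee_fin mulr_ge0// mulr_ge0// divr_ge0 ?expR_ge0// ltW.
transitivity (\int[mu2]_y f y)%E; last first.
  apply: eq_integral => y _; rewrite /f patchE indicE.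
  by case: ifP => _; rewrite ?mulr1 ?mulr0.
rewrite (ge0_integral2_affine x k0 mf f0) -ge0_integralZl//=; last first.
- by rewrite lee_fin ltW.
- apply: (measurableT_comp mf); apply: measurable_fun_pair;
  by apply: measurable_funD => //; apply: measurable_funM.
apply: eq_integral => v _; rewrite /f /ind -EFinM; congr EFin.
rewrite mulrA; congr (_ * _); last by congr (\1_ _ _); congr pair; ring.
rewrite /gauss2 /gauss_fun -expRD /eta.
have -> : - sqdist x (k * v.1 + x.1, k * v.2 + x.2) / k ^+ 2 = - v.1 ^+ 2 + - v.2 ^+ 2.
  by rewrite /sqdist /=; field; rewrite gt_eqF.
by field; rewrite gt_eqF.
Qed.

(** As the scale tends to 0 the weight [1 - exp (- q / k^2)] tends to 1 where [q > 0], with [|g|] as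
    majorant, while the Gaussian stays fixed and the domain converges to its blow-up. Where [q = 0],
    division by zero makes [g] zero. *)
Lemma total_dipole_limit (T : R2 -> R) (Z : set R2) : measurable_fun setT T ->
  measurable Z -> mu2 Z = 0%E ->
  (forall v, ~ Z v -> \forall t \near 0^'+, ind t v = T v) ->
  (\int[mu]_(s in `[0%R, L]) dipole a b N1 N2 x s)%R = (\int[mu2]_v (gauss2 v * T v))%R.
Proof.
move=> mT mZ Z0 lim.
have mg := measurable_dipole sb x.
have k0 n : 0 < (n.+1%:R^-1 : R) by rewrite invr_gt0.
have l1 : (\int[mu2]_v (gauss2 v * ind n.+1%:R^-1 v))%R @[n --> \oo] -->
    (\int[mu2]_v (gauss2 v * T v))%R.
  apply: (@Rdominated_cvg _ _ R mu2 setT (fun (n : nat) v => gauss2 v * ind n.+1%:R^-1 v)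
    (fun v => gauss2 v * T v) gauss2) => //.
  - by move=> n; apply: measurable_funM; [exact: measurable_gauss2|exact: mind].
  - by apply: measurable_funM; [exact: measurable_gauss2|].
  - exists Z; split => // v /= ; apply: contra_notP => nZ _.
    apply: cvgM; first exact: cvg_cst.
    have := near_right_harmonic (lim v nZ) => nr.
    by apply: cvg_near_cst.
  - exact: gauss2_integrable.
  - move=> n v _; rewrite normrM (ger0_norm (gauss2_ge0 v)) -[leRHS]mulr1.
    by rewrite ler_wpM2l ?gauss2_ge0// /ind indicE; case: (_ \in _); rewrite ?normr1 ?normr0.
have l2 : (\int[mu2]_v (gauss2 v * ind n.+1%:R^-1 v))%R @[n --> \oo] -->
    (\int[mu]_(s in `[0%R, L]) dipole a b N1 N2 x s)%R.
  rewrite (_ : (fun n => _) = fun n => (\int[mu]_(s in `[0%R, L])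
    ((1 - expR (- sqdist x (a s, b s) / n.+1%:R^-1 ^+ 2)) * dipole a b N1 N2 x s))%R); last first.
    by apply/funext => n; exact: gaussian_identity.
  apply: (@Rdominated_cvg _ _ R mu `[0%R, L]%classic (fun (n : nat) s =>
     (1 - expR (- sqdist x (a s, b s) / n.+1%:R^-1 ^+ 2)) * dipole a b N1 N2 x s)
    (dipole a b N1 N2 x) (fun s => `|dipole a b N1 N2 x s|)) => //.
  - move=> n; apply: measurable_funTS; apply: measurable_funM; last exact: mg.
    apply: continuous_measurable_fun => s; apply: cvgB; first exact: cvg_cst.
    apply: (@continuous_comp _ _ _ (fun s => - sqdist x (a s, b s) / n.+1%:R^-1 ^+ 2) expR);
      last exact: continuous_expR.
    apply: cvgM; last exact: cvg_cst.
    by apply: cvgN; exact: (continuous_curve_sqdist sb).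
  - exact: measurable_funTS.
  - apply: aeW => s _; have [q0|q0] := eqVneq (sqdist x (a s, b s)) 0.
      by rewrite /dipole q0 invr0 mulr0; under eq_fun do rewrite mulr0; exact: cvg_cst.
    have qpos : 0 < sqdist x (a s, b s) by rewrite lt_neqAle eq_sym q0 sqdist_ge0.
    set q := sqdist x (a s, b s) in q0 qpos *; set d := dipole _ _ _ _ _ _.
    suff : (1 - expR (- q / n.+1%:R^-1 ^+ 2)) * d @[n --> \oo] --> (1 - 0) * d.
      by rewrite subr0 mul1r.
    apply: cvgM; last exact: cvg_cst.
    apply: cvgB; first exact: cvg_cst.
    (* exp (-z) <= 1 / z *)
    apply: (@squeeze_cvgr _ _ _ _ (fun=> 0) (fun n : nat => n.+1%:R^-1 * q^-1)).
    + near=> n; rewrite expR_ge0 /=.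
      have z0 : 0 < q / n.+1%:R^-1 ^+ 2 by rewrite divr_gt0// exprn_gt0.
      rewrite mulNr expRN.
      apply: (@le_trans _ _ (q / n.+1%:R^-1 ^+ 2)^-1).
        rewrite lef_pV2 ?posrE ?expR_gt0//; apply: ltW.
        by have := expR_gt1Dx (lt0r_neq0 z0); lra.
      rewrite invf_div ler_wpM2r ?invr_ge0 ?(ltW qpos)// expr2 ler_piMr// ?(ltW (k0 n))//.
      by rewrite invf_le1// ler1n.
    + exact: cvg_cst.
    + rewrite -[X in _ --> X](mul0r q^-1); apply: cvgM; last exact: cvg_cst.
      exact: cvg_harmonic.
  - by have := integrable_abse intg.
  - move=> n s _; rewrite normrM ler_piMl// ger0_norm.
      by rewrite lerBlDr lerDl expR_ge0.
    rewrite subr_ge0 -expR0 ler_expR mulNr oppr_le0 divr_ge0 ?sqdist_ge0//.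
exact: (cvg_unique (@Rhausdorff R) l2 l1).
Unshelve. all: by end_near. Qed.

Lemma total_dipole_inside : Om x ->
  (\int[mu]_(s in `[0%R, L]) dipole a b N1 N2 x s)%R = 2 * pi.
Proof.
move=> Ox; rewrite (@total_dipole_limit (fun=> 1) set0)//.
  by under eq_Rintegral do rewrite mulr1; rewrite /Rintegral integral_gauss2.
move=> v _; apply: filterS (open_ray v (sb_open sb) Ox) => t Ot.
by rewrite /ind indicE mem_set.
Qed.

Lemma total_dipole_outside : ~ closure Om x ->
  (\int[mu]_(s in `[0%R, L]) dipole a b N1 N2 x s)%R = 0.
Proof.
move=> nOx; rewrite (@total_dipole_limit (fun=> 0) set0)//.
  by under eq_Rintegral do rewrite mulr0; rewrite Rintegral_cst// mul0r.
move=> v _; have oC : open (~` closure Om) by exact/closed_openC/closed_closure.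
apply: filterS (open_ray v oC nOx) => t Ot.
by rewrite /ind indicE memNset// => /subset_closure.
Qed.

(** [local_sides] decides the blow-up in every direction except those of the tangent line [Z]. *)
Lemma total_dipole_on s : x = (a s, b s) ->
  (\int[mu]_(s in `[0%R, L]) dipole a b N1 N2 x s)%R = pi.
Proof.
move=> xE; have [_ _ Hin Hout] := sb_local_sides s sb.
pose N : set R2 := [set v | v.1 * N1 s + v.2 * N2 s < 0].
pose Z : set R2 := [set v | v.1 * N1 s + v.2 * N2 s = 0].
have md : measurable_fun setT (fun v : R2 => v.1 * N1 s + v.2 * N2 s).
  by apply: measurable_funD; apply: measurable_funM.
have mN : measurable N.
  rewrite -[N]setTI; apply: (md measurableT [set u | u < 0]).
  by apply: open_measurable; exact: open_lt.
have mZ : measurable Z.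
  by rewrite -[Z]setTI; apply: (md measurableT [set 0]).
rewrite (@total_dipole_limit \1_N Z)//.
- transitivity (fine (\int[mu2]_(v in N) (gauss2 v)%:E)%E).
    rewrite /Rintegral; congr fine; rewrite [RHS]integral_mkcond.
    apply: eq_integral => v _; rewrite patchE indicE.
    by case: ifP => _; rewrite ?mulr1 ?mulr0.
  by rewrite (integral_gauss2_half (sb_nunit sb s)).
- exact: line_null (sb_nunit sb s).
- move=> v nZ; have [vN|vN|vN] := ltgtP (v.1 * N1 s + v.2 * N2 s) 0.
  + apply: filterS (Hin _ _ vN) => t Ot.
    by rewrite /ind !indicE !mem_set// xE.
  + apply: filterS (Hout _ _ vN) => t Ot.
    rewrite /ind !indicE !memNset//; last by rewrite xE.
    by rewrite /N /= => h; move: (lt_trans h vN); rewrite ltxx.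
  + by exfalso; exact: nZ.
Qed.

End total_dipole.

(** * The volume integral *)

Section root4.
Context {R : realType}.

(** A regularization of [sqrt p] on the whole line. The square of the positive part, and not the
    positive part itself, stands under the roots so that the function is C^1 at 0. *)
Definition root4 (k p : R) : R := Num.sqrt (Num.sqrt (possq p + k)).
(** Twice the derivative of [root4 k]. For [p > 0] it lies below [1 / sqrt p], and it is bounded for
    each [k > 0]. *)
Definition rho (k p : R) : R :=
  Num.max p 0 / (Num.sqrt (possq p + k) * Num.sqrt (Num.sqrt (possq p + k))).

Lemma possqE (p : R) : possq p = (Num.max p 0) ^+ 2.
Proof.
rewrite /possq; have [p0|p0] := leP p 0; first by rewrite mulr0 expr0n.
by rewrite expr2.
Qed.

Lemma possq_ge0 (p : R) : 0 <= possq p.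
Proof. by rewrite possqE sqr_ge0. Qed.

Lemma sqrt_max0 (p : R) : Num.sqrt (Num.max p 0) = Num.sqrt p.
Proof. by have [p0|p0] := leP p 0; rewrite ?(ler0_sqrtr p0) ?sqrtr0. Qed.

Section fixed_k.
Variable k : R.
Hypothesis k0 : 0 < k.

Lemma possqk_gt0 (p : R) : 0 < possq p + k.
Proof. by rewrite ltr_wpDl// possq_ge0. Qed.

Lemma is_derive_root4 (p : R) : is_derive p (1 : R) (root4 k) (rho k p / 2).
Proof.
have z0 := possqk_gt0 p.
have D1 := is_derive1_add (is_derive_possq p) (is_derive1_cst k p).
have D2 := @is_derive1_compose _ Num.sqrt (fun p => possq p + k) p _ _ (is_derive1_sqrt z0) D1.
have sz0 : 0 < Num.sqrt (possq p + k) by rewrite sqrtr_gt0.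
have D3 := @is_derive1_compose _ Num.sqrt (fun p => Num.sqrt (possq p + k)) p _ _
  (is_derive1_sqrt sz0) D2.
apply: (is_derive1_eq D3); rewrite /rho.
have n1 : Num.sqrt (possq p + k) != 0 by rewrite gt_eqF.
have n2 : Num.sqrt (Num.sqrt (possq p + k)) != 0 by rewrite gt_eqF// sqrtr_gt0.
by field; rewrite n1 n2.
Qed.

Lemma continuous_possqk : continuous (fun p : R => possq p + k).
Proof.
move=> p; apply: cvgD; last exact: cvg_cst.
exact: is_derive_continuous (is_derive_possq p).
Qed.

Lemma continuous_rho : continuous (rho k).
Proof.
move=> p; have z0 := possqk_gt0 p.
have c1 : {for p, continuous (fun p => Num.sqrt (possq p + k))}.
  apply: (@continuous_comp _ _ _ (fun p => possq p + k) Num.sqrt).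
    exact: continuous_possqk.
  exact: sqrt_continuous.
apply: cvgM; first exact: continuous_pos.
apply: cvgV; first by rewrite mulf_neq0 ?gt_eqF ?sqrtr_gt0 ?sqrtr_gt0.
apply: cvgM; first exact: c1.
apply: (@continuous_comp _ _ _ (fun p => Num.sqrt (possq p + k)) Num.sqrt); first exact: c1.
exact: sqrt_continuous.
Qed.

Lemma rho_ge0 p : 0 <= rho k p.
Proof. by rewrite divr_ge0 ?mulr_ge0 ?sqrtr_ge0// le_max lexx orbT. Qed.

Lemma rho_le p : rho k p <= (Num.sqrt p)^-1.
Proof.
have [p0|p0] := leP p 0; first by rewrite /rho (max_r p0) mul0r invr_ge0 sqrtr_ge0.
have z0 := possqk_gt0 p.
have pz : p <= Num.sqrt (possq p + k).
  rewrite -[leLHS](ger0_norm (ltW p0)) -sqrtr_sqr ler_wsqrtr// possqE (max_l (ltW p0)).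
  by rewrite lerDl ltW.
rewrite /rho (max_l (ltW p0)) ler_pdivrMr; last by rewrite mulr_gt0 ?sqrtr_gt0.
rewrite ler_pdivlMl ?sqrtr_gt0// mulrC; apply: ler_pM; rewrite ?sqrtr_ge0 ?(ltW p0)//.
by rewrite ler_wsqrtr.
Qed.

Lemma rho_bounded p : rho k p <= (Num.sqrt (Num.sqrt k))^-1.
Proof.
have z0 := possqk_gt0 p.
have m0 : 0 <= Num.max p 0 by rewrite le_max lexx orbT.
have pz : Num.max p 0 <= Num.sqrt (possq p + k).
  rewrite -[leLHS](ger0_norm m0) -sqrtr_sqr ler_wsqrtr// possqE.
  by rewrite lerDl ltW.
rewrite /rho invfM mulrA; rewrite -[leRHS]mul1r; apply: ler_pM.
- by rewrite divr_ge0 ?sqrtr_ge0.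
- by rewrite invr_ge0 sqrtr_ge0.
- by rewrite ler_pdivrMr ?sqrtr_gt0// mul1r.
- rewrite lef_pV2 ?posrE ?sqrtr_gt0 ?sqrtr_gt0// ler_wsqrtr// ler_wsqrtr// lerDr.
  exact: possq_ge0.
Qed.

End fixed_k.

Lemma cvg_root4 p : root4 n.+1%:R^-1 p @[n --> \oo] --> Num.sqrt p.
Proof.
have -> : Num.sqrt p = Num.sqrt (Num.sqrt (possq p + 0)).
  rewrite addr0 possqE sqrtr_sqr ger0_norm ?sqrt_max0//.
  by rewrite le_max lexx orbT.
have c0 : (fun n => possq p + n.+1%:R^-1) @ \oo --> possq p + 0.
  by apply: cvgD; [exact: cvg_cst|exact: cvg_harmonic].
have c1 := cvg_comp _ _ c0 (@sqrt_continuous R (possq p + 0)).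
exact: (cvg_comp _ _ c1 (@sqrt_continuous R _)).
Qed.

(** For [p <= 0] the limit is 0 by the conventions for the root of a negative number and the inverse
    of 0. The restriction to [r < c t] is thereby built into the formulas. *)
Lemma cvg_rho p : rho n.+1%:R^-1 p @[n --> \oo] --> (Num.sqrt p)^-1.
Proof.
have [p0|p0] := leP p 0.
  rewrite (ler0_sqrtr p0) invr0 /rho (max_r p0).
  by under eq_fun do rewrite mul0r; exact: cvg_cst.
have sp : Num.sqrt (possq p + 0) = p.
  by rewrite addr0 possqE (max_l (ltW p0)) sqrtr_sqr gtr0_norm.
have c0 : (fun n => possq p + n.+1%:R^-1) @ \oo --> possq p + 0.
  by apply: cvgD; [exact: cvg_cst|exact: cvg_harmonic].
have := cvg_comp _ _ c0 (@sqrt_continuous R (possq p + 0)); rewrite sp => c1.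
have c2 := cvg_comp _ _ c1 (@sqrt_continuous R _).
have -> : (Num.sqrt p)^-1 = p / (p * Num.sqrt p).
  by field; rewrite !gt_eqF ?sqrtr_gt0.
rewrite /rho (max_l (ltW p0)); apply: cvgM; first exact: cvg_cst.
apply: cvgV; first by rewrite mulf_neq0// gt_eqF ?sqrtr_gt0.
exact: cvgM c1 c2.
Qed.

End root4.

Section volume.
Context {R : realType}.
Local Notation mu := (@lebesgue_measure R).
Local Notation R2 := (measurableTypeR R * measurableTypeR R)%type.
Local Notation mu2 := (mu \x mu)%E.
Variables (L : R) (a b da db N1 N2 : R -> R) (Om : set (R * R)).
Hypothesis sb : smooth_boundary L a b da db N1 N2 Om.
Variable x : R * R.
Hypothesis intg : mu.-integrable `[0%R, L]%classic (EFin \o dipole a b N1 N2 x).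
Variable tau : R.
Hypothesis tau0 : 0 <= tau.

Let g := dipole a b N1 N2 x.
Let q s := sqdist x (a s, b s).
(** The primitive that vanishes at 0 and whose doubled derivative is the regularized density
    [rho k (tau - u)]. *)
Let H k u := root4 k tau - root4 k (tau - u).

Let DH k u : 0 < k -> is_derive u (1 : R) (H k) (rho k (tau - u) / 2).
Proof.
move=> k0.
have D1 := is_derive1_sub (is_derive1_cst tau u) (is_derive1_id u).
have D2 := @is_derive1_compose _ (root4 k) (fun u => tau - u) u _ _
  (is_derive_root4 k0 (tau - u)) D1.
apply: (is_derive1_eq (is_derive1_sub (is_derive1_cst (root4 k tau) u) D2)).
by field.
Qed.

Let ceta k : 0 < k -> continuous (fun u => rho k (tau - u) / 2).
Proof.
move=> k0 u; apply: cvgM; last exact: cvg_cst.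
apply: (@continuous_comp _ _ _ (fun u => tau - u) (rho k)); last exact: continuous_rho.
by apply: cvgB; [exact: cvg_cst|exact: cvg_id].
Qed.

Let C := root4 1 tau.

Let H_bound k u : 0 < k <= 1 -> 0 <= u -> `|H k u| <= C.
Proof.
move=> /andP[k0 k1] u0.
have h1 : root4 k (tau - u) <= root4 k tau.
  have m0 (z : R) : 0 <= Num.max z 0 by rewrite le_max lexx orbT.
  have hm : Num.max (tau - u) 0 <= Num.max tau 0.
    rewrite ge_max m0 andbT (max_l tau0); lra.
  by rewrite /root4 !ler_wsqrtr// lerD2r !possqE lerXn2r// nnegrE m0.
rewrite /H ger0_norm ?subr_ge0//.
apply: (@le_trans _ _ (root4 k tau)); first by rewrite lerBlDr lerDl sqrtr_ge0.
by rewrite /C /root4 !ler_wsqrtr// lerD2l.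
Qed.

Let k0 (n : nat) : 0 < (n.+1%:R^-1 : R).
Proof. by rewrite invr_gt0. Qed.

Let k01 (n : nat) : 0 < (n.+1%:R^-1 : R) <= 1.
Proof. by rewrite k0 invf_le1// ler1n. Qed.

Let cq : continuous (sqdist x).
Proof. by case: (c1_plane_sqdist x). Qed.

Let gauss_rho n : (\int[mu2]_(y in Om) rho n.+1%:R^-1 (tau - sqdist x y))%R =
  (\int[mu]_(s in `[0%R, L]) (H n.+1%:R^-1 (q s) * g s))%R.
Proof.
have kk := k0 n; have D u := DH u kk.
rewrite -(radial_gauss sb x D (ceta kk) _ (M := (Num.sqrt (Num.sqrt n.+1%:R^-1))^-1 / 2)).
- by apply: eq_Rintegral => y _; field.
- by rewrite /H subr0 subrr.
- move=> u _; have r0 := rho_ge0 n.+1%:R^-1 (tau - u).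
  have rb := rho_bounded kk (tau - u).
  rewrite ger0_norm; last by apply: divr_ge0.
  by rewrite ler_wpM2r// invr_ge0.
Qed.

Let crho n : continuous (fun y => rho n.+1%:R^-1 (tau - sqdist x y)).
Proof.
move=> y; apply: (@continuous_comp _ _ _ (fun y => tau - sqdist x y) (rho _)).
  by apply: cvgB; [exact: cvg_cst|exact: cq].
exact: continuous_rho.
Qed.

Let intabs : mu.-integrable `[0%R, L]%classic (EFin \o (fun s => C * `|g s|)).
Proof.
have mI : measurable (`[0, L]%classic : set (measurableTypeR R)) by exact: measurable_itv.
have := integrableZl mI C (integrable_abse intg).
by apply: eq_integrable.
Qed.

Let mH n : measurable_fun setT (fun s => H n.+1%:R^-1 (q s) * g s).
Proof.
apply: measurable_funM; last exact: measurable_dipole sb x.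
apply: continuous_measurable_fun => s.
apply: (@continuous_comp _ _ _ q (H _)); first exact: (continuous_curve_sqdist sb).
exact: is_derive_continuous (DH (q s) (k0 n)).
Qed.

Let cvg_H u : H n.+1%:R^-1 u @[n --> \oo] --> Num.sqrt tau - Num.sqrt (tau - u).
Proof. by apply: cvgB; exact: cvg_root4. Qed.

(** The boundary side of [gauss_rho] is at most the integral of [C |g|] for every [n], and Fatou's
    lemma carries the bound to the limit. *)
Lemma volume_integrable :
  mu2.-integrable (Om : set R2) (EFin \o (fun y => (Num.sqrt (tau - sqdist x y))^-1)).
Proof.
have [||||_ //] := @fatou_bound _ _ R mu2 (Om : set R2) (sb_measurable sb)
  (fun (n : nat) y => rho n.+1%:R^-1 (tau - sqdist x y))
  (fun y => (Num.sqrt (tau - sqdist x y))^-1)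
  (\int[mu]_(s in `[0%R, L]) (C * `|g s|))%R.
- by move=> n; apply: measurable_funTS; apply: continuous_measurable_plane; exact: crho.
- by move=> n y _; exact: rho_ge0.
- by move=> y _; exact: cvg_rho.
- move=> n; have ii := sb_continuous_integrable sb (@crho n).
  have fin : (\int[mu2]_(y in Om) (rho n.+1%:R^-1 (tau - sqdist x y))%:E)%E \is a fin_num.
    by apply: integrable_fin_num => //; exact: (sb_measurable sb).
  rewrite -(fineK fin) lee_fin -/(Rintegral _ _ _) gauss_rho.
  have mI : measurable (`[0, L]%classic : set (measurableTypeR R)) by exact: measurable_itv.
  have iH : mu.-integrable `[0%R, L]%classic (EFin \o (fun s => H n.+1%:R^-1 (q s) * g s)).
    apply: (le_integrable mI _ _ intabs).
      by apply/measurable_EFinP; apply: measurable_funTS; exact: mH.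
    move=> s _; rewrite lee_fin normrM [leRHS]ger0_norm; last first.
      by rewrite mulr_ge0 ?sqrtr_ge0.
    by rewrite ler_wpM2r// H_bound// sqdist_ge0.
  apply: le_Rintegral => // s _; apply: (le_trans (ler_norm _)).
  by rewrite normrM ler_wpM2r// H_bound// sqdist_ge0.
Qed.

(** In the area integral the limit itself is the majorant, as [rho k] lies below it; on the curve
    [C |g|] is. *)
Lemma volume_formula :
  (\int[mu2]_(y in Om) (Num.sqrt (tau - sqdist x y))^-1)%R =
  (\int[mu]_(s in `[0%R, L]) ((Num.sqrt tau - Num.sqrt (tau - q s)) * g s))%R.
Proof.
have csq : continuous (fun y => Num.sqrt (tau - sqdist x y)).
  move=> y; apply: (@continuous_comp _ _ _ (fun y => tau - sqdist x y) Num.sqrt).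
    by apply: cvgB; [exact: cvg_cst|exact: cq].
  exact: sqrt_continuous.
have l1 : (\int[mu2]_(y in Om) rho n.+1%:R^-1 (tau - sqdist x y))%R @[n --> \oo] -->
    (\int[mu2]_(y in Om) (Num.sqrt (tau - sqdist x y))^-1)%R.
  apply: (@Rdominated_cvg _ _ R mu2 (Om : set R2)
    (fun (n : nat) y => rho n.+1%:R^-1 (tau - sqdist x y))
    (fun y => (Num.sqrt (tau - sqdist x y))^-1) (fun y => (Num.sqrt (tau - sqdist x y))^-1)).
  - exact: (sb_measurable sb).
  - by move=> n; apply: measurable_funTS; apply: continuous_measurable_plane; exact: crho.
  - apply: measurable_funTS; apply: (measurableT_comp measurable_invr).
    exact: continuous_measurable_plane.
  - by apply: aeW => y _; exact: cvg_rho.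
  - exact: volume_integrable.
  - by move=> n y _; rewrite ger0_norm ?rho_ge0// rho_le.
have l2 : (\int[mu2]_(y in Om) rho n.+1%:R^-1 (tau - sqdist x y))%R @[n --> \oo] -->
    (\int[mu]_(s in `[0%R, L]) ((Num.sqrt tau - Num.sqrt (tau - q s)) * g s))%R.
  under eq_fun do rewrite gauss_rho.
  apply: (@Rdominated_cvg _ _ R mu `[0%R, L]%classic
    (fun (n : nat) s => H n.+1%:R^-1 (q s) * g s)
    (fun s => (Num.sqrt tau - Num.sqrt (tau - q s)) * g s) (fun s => C * `|g s|)) => //.
  - by move=> n; apply: measurable_funTS; exact: mH.
  - apply: measurable_funTS; apply: measurable_funM; last exact: measurable_dipole sb x.
    apply: continuous_measurable_fun => s; apply: cvgB; first exact: cvg_cst.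
    apply: (@continuous_comp _ _ _ (fun s => tau - q s) Num.sqrt); last exact: sqrt_continuous.
    by apply: cvgB; [exact: cvg_cst|exact: (continuous_curve_sqdist sb)].
  - by apply: aeW => s _; apply: cvgM; [exact: cvg_H|exact: cvg_cst].
  - by move=> n s _; rewrite normrM ler_wpM2r// H_bound// sqdist_ge0.
exact: (cvg_unique (@Rhausdorff R) l1 l2).
Qed.

End volume.

(** * Differentiation in time *)

Section time_integral.
Context {R : realType}.
Local Notation mu := (@lebesgue_measure R).
Variable c : R.
Hypothesis c0 : 0 < c.

(* The time derivative of [sqrt (c^2 t^2 - q)], with value 0 where [c^2 t^2 <= q]. *)
Definition wave_factor (q t : R) : R := c ^+ 2 * t / Num.sqrt (c ^+ 2 * t ^+ 2 - q).

Let phase (q t : R) : R := c ^+ 2 * t ^+ 2 - q.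

Let Dphase q t : is_derive t (1 : R) (phase q) (2 * c ^+ 2 * t).
Proof.
have D := is_derive1_sub (is_derive1_mul (is_derive1_cst (c ^+ 2) t)
  (is_derive1_pow2 (is_derive1_id t))) (is_derive1_cst q t).
by apply: (is_derive1_eq D); ring.
Qed.

Let cphase q : continuous (phase q).
Proof. by move=> t; exact: is_derive_continuous (Dphase q t). Qed.

Lemma measurable_wave_factor q : measurable_fun setT (wave_factor q).
Proof.
apply: measurable_funM.
  apply: continuous_measurable_fun => t; apply: cvgM; [exact: cvg_cst|exact: cvg_id].
apply: (measurableT_comp measurable_invr); apply: continuous_measurable_fun => t.
apply: (@continuous_comp _ _ _ (phase q) Num.sqrt); first exact: cphase.
exact: sqrt_continuous.
Qed.

Lemma wave_factor_ge0 q t : 0 <= t -> 0 <= wave_factor q t.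
Proof. by move=> t0; rewrite divr_ge0 ?sqrtr_ge0// mulr_ge0 ?sqr_ge0. Qed.

(** The integrand may be unbounded near [c^2 t^2 = q], so the fundamental theorem is applied to
    [root4] of the phase before passing to the limit. At time 0 the phase is [- q <= 0], so the root
    starts from 0. *)
Lemma wave_factor_integral q A : 0 <= q -> 0 <= A ->
  mu.-integrable `[0%R, A]%classic (EFin \o wave_factor q) /\
  (\int[mu]_(t in `[0%R, A]) wave_factor q t)%R = Num.sqrt (phase q A).
Proof.
move=> q0 A0.
pose vk k t := c ^+ 2 * t * rho k (phase q t).
have kpos (n : nat) : 0 < (n.+1%:R^-1 : R) by rewrite invr_gt0.
have cvk (n : nat) : continuous (vk n.+1%:R^-1).
  move=> t; apply: cvgM; first by apply: cvgM; [exact: cvg_cst|exact: cvg_id].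
  by apply: (@continuous_comp _ _ _ (phase q) (rho _)); [exact: cphase|exact: continuous_rho].
have Dk (n : nat) t : is_derive t (1 : R) (fun t => root4 n.+1%:R^-1 (phase q t)) (vk n.+1%:R^-1 t).
  have D := @is_derive1_compose _ (root4 n.+1%:R^-1) (phase q) t _ _
    (is_derive_root4 (kpos n) _) (Dphase q t).
  by apply: (is_derive1_eq D); rewrite /vk; field.
have ftc (n : nat) : (\int[mu]_(t in `[0%R, A]) vk n.+1%:R^-1 t)%R =
    root4 n.+1%:R^-1 (phase q A) - root4 n.+1%:R^-1 (phase q 0).
  exact: FTC2_continuous A0 (cvk n) (Dk n).
have cvgv t : vk n.+1%:R^-1 t @[n --> \oo] --> wave_factor q t.
  by apply: cvgM; [exact: cvg_cst|exact: cvg_rho].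
have mI : measurable (`[0, A]%classic : set (measurableTypeR R)) by exact: measurable_itv.
have vk0 (n : nat) t : 0 <= t -> 0 <= vk n.+1%:R^-1 t.
  by move=> t0; rewrite mulr_ge0 ?rho_ge0// mulr_ge0 ?sqr_ge0.
have int : mu.-integrable `[0%R, A]%classic (EFin \o wave_factor q).
  have [||||_ //] := @fatou_bound _ _ R mu `[0, A]%classic mI
    (fun (n : nat) t => vk n.+1%:R^-1 t) (wave_factor q) (root4 1 (phase q A)).
  - by move=> n; apply: measurable_funTS; exact: continuous_measurable_fun.
  - by move=> n t /=; rewrite in_itv /= => /andP[? _]; exact: vk0.
  - by move=> t _; exact: cvgv.
  - move=> n; have ii := @continuous_interval_integrable R 0 A _ (cvk n).
    have fin : (\int[mu]_(t in `[0%R, A]) (vk n.+1%:R^-1 t)%:E)%E \is a fin_num.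
      by apply: integrable_fin_num => //; exact: ii.
    rewrite -(fineK fin) lee_fin -/(Rintegral _ _ _) ftc.
    apply: (@le_trans _ _ (root4 n.+1%:R^-1 (phase q A))).
      by rewrite lerBlDr lerDl sqrtr_ge0.
    by rewrite /root4 !ler_wsqrtr// lerD2l invf_le1// ler1n.
split => //.
have l1 : (\int[mu]_(t in `[0%R, A]) vk n.+1%:R^-1 t)%R @[n --> \oo] -->
    (\int[mu]_(t in `[0%R, A]) wave_factor q t)%R.
  apply: (@Rdominated_cvg _ _ R mu `[0, A]%classic (fun (n : nat) t => vk n.+1%:R^-1 t)
    (wave_factor q) (wave_factor q)) => //.
  - by move=> n; apply: measurable_funTS; exact: continuous_measurable_fun.
  - by apply: measurable_funTS; exact: measurable_wave_factor.
  - by apply: aeW => t _; exact: cvgv.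
  - move=> n t /=; rewrite in_itv /= => /andP[t0 _].
    have ct0 : 0 <= c ^+ 2 * t by rewrite mulr_ge0 ?sqr_ge0.
    rewrite ger0_norm ?vk0// /vk /wave_factor ler_wpM2l//.
    exact: rho_le (kpos n) _.
have l2 : (\int[mu]_(t in `[0%R, A]) vk n.+1%:R^-1 t)%R @[n --> \oo] -->
    Num.sqrt (phase q A) - Num.sqrt (phase q 0).
  by under eq_fun do rewrite ftc; apply: cvgB; exact: cvg_root4.
have s0 : Num.sqrt (phase q 0) = 0.
  by apply: ler0_sqrtr; rewrite /phase expr0n /= mulr0 sub0r oppr_le0.
have := cvg_unique (@Rhausdorff R) l1 l2; rewrite s0 subr0; apply.
Qed.

(** The difference of the roots is at most that of the phases divided by the larger root, and the
    phases differ by [c^2 (t + t') (t - t')]; the factor 2 is [t + t' <= 2 t]. *)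
Lemma wave_root_quotient_le q t t' : 0 < t' < t ->
  0 <= (Num.sqrt (phase q t) - Num.sqrt (phase q t')) / (t - t') <= 2 * wave_factor q t.
Proof.
move=> /andP[t'0 t't]; have t0 := lt_trans t'0 t't.
have d0 : 0 < t - t' by rewrite subr_gt0.
have c2 : 0 < c ^+ 2 by rewrite exprn_gt0.
have pp : phase q t - phase q t' = c ^+ 2 * (t + t') * (t - t') by rewrite /phase; ring.
have pp0 : 0 < phase q t - phase q t'.
  by rewrite pp mulr_gt0// mulr_gt0// addr_gt0.
have le : Num.sqrt (phase q t') <= Num.sqrt (phase q t) by rewrite ler_wsqrtr//; lra.
apply/andP; split; first by rewrite divr_ge0 ?subr_ge0// ltW.
have [p0|p0] := leP (phase q t) 0.
  have p'0 : phase q t' <= 0 by lra.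
  by rewrite !ler0_sqrtr// subrr mul0r mulr_ge0 ?wave_factor_ge0// ltW.
have sp : 0 < Num.sqrt (phase q t) by rewrite sqrtr_gt0.
rewrite ler_pdivrMr//.
apply: (@le_trans _ _ ((phase q t - phase q t') / Num.sqrt (phase q t))).
  rewrite ler_pdivlMr// mulrBl -expr2 sqr_sqrtr ?(ltW p0)//.
  have [p'0|p'0] := leP (phase q t') 0; first by rewrite (ler0_sqrtr p'0) mul0r subr0; lra.
  rewrite lerD2l lerN2 -[leLHS](@sqr_sqrtr _ (phase q t')) ?(ltW p'0)// expr2.
  by rewrite ler_wpM2l ?sqrtr_ge0.
rewrite pp /wave_factor -/(phase q t) -mulrA mulrAC -[leLHS]mulrA.
rewrite [leLHS](_ : _ = c ^+ 2 * (t + t') / Num.sqrt (phase q t) * (t - t')); last by ring.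
rewrite ler_wpM2r ?(ltW d0)// mulrA ler_wpM2r ?invr_ge0 ?sqrtr_ge0//.
have -> : 2 * (c ^+ 2 * t) = c ^+ 2 * (2 * t) by ring.
by rewrite ler_wpM2l ?(ltW c2)//; lra.
Qed.

(** Where [c^2 t^2 <= q] the root vanishes at [t] and at all earlier times, so the quotients
    converge even when [c^2 t^2 = q], where the root is not differentiable. *)
Lemma wave_root_quotient_cvg q t (t_ : nat -> R) : 0 <= q -> 0 < t ->
  (forall n, 0 < t_ n < t) -> t_ n @[n --> \oo] --> t ->
  (Num.sqrt (phase q t) - Num.sqrt (phase q (t_ n))) / (t - t_ n) @[n --> \oo] -->
  wave_factor q t.
Proof.
move=> q0 t0 tn ct.
have [p0|p0] := leP (phase q t) 0.
  rewrite (_ : (fun n => _) = fun=> 0); last first.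
    apply/funext => n; have /andP[n0 nt] := tn n.
    have p'0 : phase q (t_ n) <= 0.
      apply: (le_trans _ p0); rewrite /phase lerD2r ler_wpM2l ?sqr_ge0//.
      by rewrite lerXn2r ?nnegrE ?ltW.
    by rewrite !ler0_sqrtr// subrr mul0r.
  by rewrite /wave_factor -/(phase q t) (ler0_sqrtr p0) invr0 mulr0; exact: cvg_cst.
have sp : Num.sqrt (phase q t) != 0 by rewrite gt_eqF// sqrtr_gt0.
have D : is_derive t (1 : R) (fun t => Num.sqrt (phase q t)) (wave_factor q t).
  apply: (is_derive1_eq (@is_derive1_compose _ Num.sqrt (phase q) t _ _
    (is_derive1_sqrt p0) (Dphase q t))).
  by rewrite /wave_factor -/(phase q t); field.
have [G [GE cG Gt]] := (is_derive1_caratheodory _ _ _).1 D.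
rewrite -Gt (_ : (fun n => _) = fun n => G (t_ n)); first exact: (continuous_cvg _ cG ct).
apply/funext => n; have /andP[n0 nt] := tn n; have := GE (t_ n) => E.
have -> : Num.sqrt (phase q t) - Num.sqrt (phase q (t_ n)) = G (t_ n) * (t - t_ n).
  by rewrite -[LHS]opprB E; ring.
by rewrite mulfK// subr_eq0 gt_eqF.
Qed.

End time_integral.

(** * The function U and its derivative *)

Section time_derivative.
Context {R : realType}.
Local Notation mu := (@lebesgue_measure R).
Local Notation R2 := (measurableTypeR R * measurableTypeR R)%type.
Local Notation mu2 := (mu \x mu)%E.
Variables (c L : R) (q g : R -> R).
Hypotheses (c0 : 0 < c) (q0 : forall s, 0 <= q s) (cq : continuous q).
Hypotheses (mg : measurable_fun setT g)
  (intg : mu.-integrable `[0%R, L]%classic (EFin \o g)).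

Let I : set (measurableTypeR R) := `[0, L]%classic.
Let mI : measurable I. Proof. exact: measurable_itv. Qed.

(** U of the overview, for an arbitrary continuous [q >= 0] and an integrable [g]. *)
Definition wave_moment (t : R) : R :=
  (\int[mu]_(s in `[0%R, L]) (Num.sqrt (c ^+ 2 * t ^+ 2 - q s) * g s))%R.

Definition wave_rate (t : R) : R :=
  (\int[mu]_(s in `[0%R, L]) (wave_factor c (q s) t * g s))%R.

Lemma bounded_mul_integrable (m : R -> R) (C : R) (D : set (measurableTypeR R)) :
  measurable D -> D `<=` I ->
  measurable_fun setT m -> (forall s, D s -> `|m s| <= C) ->
  mu.-integrable D (EFin \o (fun s => m s * g s)).
Proof.
move=> mD DI mm mC.
have iC : mu.-integrable D (EFin \o (fun s => C * `|g s|)).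
  have iD := integrableS mI mD DI intg.
  have := integrableZl mD C (integrable_abse iD); by apply: eq_integrable.
apply: (le_integrable mD _ _ iC).
  by apply/measurable_EFinP; apply: measurable_funTS; exact: measurable_funM.
move=> s Ds; rewrite lee_fin normrM; apply: (le_trans _ (ler_norm _)).
by rewrite ler_wpM2r// mC.
Qed.

Let croot t : continuous (fun s => Num.sqrt (c ^+ 2 * t ^+ 2 - q s)).
Proof.
move=> s; apply: (@continuous_comp _ _ _ (fun s => c ^+ 2 * t ^+ 2 - q s) Num.sqrt).
  by apply: cvgB; [exact: cvg_cst|exact: cq].
exact: sqrt_continuous.
Qed.

Lemma wave_root_le t s : 0 <= t -> Num.sqrt (c ^+ 2 * t ^+ 2 - q s) <= c * t.
Proof.
move=> t0; have ct : 0 <= c * t by rewrite mulr_ge0// ltW.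
rewrite -[leRHS](ger0_norm ct) -sqrtr_sqr ler_wsqrtr// exprMn lerBlDr lerDl.
exact: q0.
Qed.

Lemma wave_root_integrable t : 0 <= t ->
  mu.-integrable I (EFin \o (fun s => Num.sqrt (c ^+ 2 * t ^+ 2 - q s) * g s)).
Proof.
move=> t0; apply: (@bounded_mul_integrable _ (c * t)) => //.
  apply: continuous_measurable_fun; exact: croot.
by move=> s _; rewrite ger0_norm ?sqrtr_ge0// wave_root_le.
Qed.

Lemma measurable_wave_factor_curve t : measurable_fun setT (fun s => wave_factor c (q s) t).
Proof.
apply: measurable_funM => //; apply: (measurableT_comp measurable_invr).
apply: continuous_measurable_fun; exact: croot.
Qed.

(** The majorant involves the integrand at the single time [t], where its integrability is
    assumed. *)
Lemma wave_moment_left_quotient t (t_ : nat -> R) : 0 < t ->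
  (forall n, 0 < t_ n < t) -> t_ n @[n --> \oo] --> t ->
  mu.-integrable I (EFin \o (fun s => wave_factor c (q s) t * g s)) ->
  (wave_moment t - wave_moment (t_ n)) / (t - t_ n) @[n --> \oo] --> wave_rate t.
Proof.
move=> t0 tn ct iv.
pose Q (n : nat) s := (Num.sqrt (c ^+ 2 * t ^+ 2 - q s) -
  Num.sqrt (c ^+ 2 * t_ n ^+ 2 - q s)) / (t - t_ n) * g s.
have QE n : (wave_moment t - wave_moment (t_ n)) / (t - t_ n) =
    (\int[mu]_(s in `[0%R, L]) Q n s)%R.
  have /andP[n0 nt] := tn n.
  have i1 := wave_root_integrable (ltW t0); have i2 := wave_root_integrable (ltW n0).
  rewrite /wave_moment -RintegralB// mulrC -RintegralZl//; last exact: integrableB i1 i2.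
  by apply: eq_Rintegral => s _; rewrite /Q; ring.
under eq_fun do rewrite QE.
apply: (@Rdominated_cvg _ _ R mu I Q (fun s => wave_factor c (q s) t * g s)
  (fun s => 2 * `|wave_factor c (q s) t * g s|)) => //.
- move=> n; apply: measurable_funTS; apply: measurable_funM => //; apply: measurable_funM => //.
  by apply: measurable_funB; apply: continuous_measurable_fun; exact: croot.
- apply: measurable_funTS; apply: measurable_funM => //; exact: measurable_wave_factor_curve.
- apply: aeW => s _; apply: cvgM; last exact: cvg_cst.
  exact: wave_root_quotient_cvg.
- have := integrableZl mI 2 (integrable_abse iv); by apply: eq_integrable.
- move=> n s _; have /andP[h1 h2] := wave_root_quotient_le c0 (q s) (tn n).
  rewrite /Q normrM (ger0_norm h1) [in leRHS]normrM [leRHS]mulrA ler_wpM2r//.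
  by apply: (le_trans h2); rewrite ler_wpM2l// ler_norm.
Qed.

Section fixed_horizon.
Variable A : R.
Hypothesis A0 : 0 <= A.

Let f (y : R2) : R := \1_(`[0, A]%classic : set (measurableTypeR R)) y.1 *
  (\1_I y.2 * (wave_factor c (q y.2) y.1 * g y.2)).

Let mA : measurable (`[0, A]%classic : set (measurableTypeR R)).
Proof. exact: measurable_itv. Qed.

Let mf : measurable_fun setT f.
Proof.
apply: measurable_funM; first exact: (measurableT_comp (measurable_indic mA) measurable_fst).
apply: measurable_funM; first exact: (measurableT_comp (measurable_indic mI) measurable_snd).
apply: measurable_funM; last exact: (measurableT_comp mg measurable_snd).
apply: measurable_funM; first by apply: measurable_funM.
apply: (measurableT_comp measurable_invr); apply: continuous_measurable_plane => y.
apply: (@continuous_comp _ _ _ (fun y : R * R => c ^+ 2 * y.1 ^+ 2 - q y.2) Num.sqrt).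
  apply: cvgB.
    apply: cvgM; first exact: cvg_cst.
    by apply: cvgM; exact: cvg_fst.
  by apply: (@continuous_comp _ _ _ snd q); [exact: cvg_snd|exact: cq].
exact: sqrt_continuous.
Qed.

(** One computation for two purposes: the absolute value gives integrability on the product, the
    identity gives the value of the iterated integral. *)
Let inner (h : R -> R) s : h = (fun u => u) \/ h = Num.norm ->
  (\int[mu]_t (h (f (t, s)))%:E =
   (\1_I s * h (g s) * Num.sqrt (c ^+ 2 * A ^+ 2 - q s))%:E)%E.
Proof.
move=> hE; have [iv vE] := wave_factor_integral c (q0 s) A0.
have hM u v : 0 <= u -> h (u * v) = u * h v.
  by move=> u0; case: hE => -> //; rewrite normrM ger0_norm.
transitivity (\int[mu]_(t in `[0%R, A]) ((\1_I s * h (g s))%:E * (wave_factor c (q s) t)%:E))%E.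
  rewrite [RHS]integral_mkcond; apply: eq_integral => t _; rewrite patchE /f /= indicE.
  case: ifPn => [/set_mem /=|_]; last by rewrite hM// mul0r.
  rewrite in_itv /= => /andP[t0 _]; rewrite mul1r -EFinM; congr EFin.
  by rewrite hM ?indicE// hM ?wave_factor_ge0//; ring.
rewrite integralZl//.
rewrite -vE [RHS]EFinM; congr (_ * _)%E; rewrite /Rintegral fineK//.
exact: integrable_fin_num.
Qed.

Let intf : mu2.-integrable setT (EFin \o f).
Proof.
apply/integrable21ltyP; first exact/measurable_EFinP.
rewrite (@eq_integral _ _ _ _ _ (fun s => (\1_I s * `|g s| *
    Num.sqrt (c ^+ 2 * A ^+ 2 - q s))%:E)); last first.
  by move=> s _ /=; apply: (@inner Num.norm); right.
have /integrableP[_] := wave_root_integrable A0.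
apply: le_lt_trans; rewrite le_eqVlt; apply/orP; left; apply/eqP.
rewrite [RHS]integral_mkcond; apply: eq_integral => s _.
rewrite patchE indicE; case: ifP => _; last by rewrite !mul0r.
by rewrite /= mul1r normrM (ger0_norm (sqrtr_ge0 _)) mulrC.
Qed.

Lemma wave_factor_ae_integrable : {ae mu, forall t, 0 <= t <= A ->
  mu.-integrable I (EFin \o (fun s => wave_factor c (q s) t * g s))}.
Proof.
have := ae_integrable1 intf; apply: filterS => t it tA.
apply/(integrable_mkcond _ mI).2; apply: eq_integrable it => // s _.
rewrite /= /f /= !indicE mem_set /=; last by rewrite in_itv.
by rewrite mul1r patchE; case: ifP => _; rewrite ?mul1r ?mul0r.
Qed.

Let Fx t := (\int[mu]_s (f (t, s))%:E)%E.

Let Fx_rate t : 0 <= t <= A -> wave_rate t = fine (Fx t).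
Proof.
move=> tA; rewrite /wave_rate /Rintegral; congr fine.
rewrite [LHS]integral_mkcond; apply: eq_integral => s _.
have tI : t \in (`[0, A]%classic : set R) by rewrite inE /= in_itv.
rewrite patchE /f /= !indicE tI /=.
by rewrite mul1r; case: ifP => _; rewrite ?mul1r ?mul0r.
Qed.

Let int_Fx : mu.-integrable setT Fx.
Proof. exact: integrable_fubini_F intf. Qed.

Lemma wave_rate_integrable : mu.-integrable `[0%R, A]%classic (EFin \o wave_rate).
Proof.
have iF := integrableS measurableT mA (@subsetT _ _) int_Fx.
have mF := measurable_int _ iF.
have i2 : mu.-integrable `[0%R, A]%classic (fun t => (fine (Fx t))%:E).
  apply: (le_integrable mA _ _ iF).
    by apply/measurable_EFinP; apply: measurableT_comp => //.
  by move=> t _; case: (Fx t) => [r| |] //=; rewrite ?leey.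
apply: eq_integrable i2 => // t /set_mem /=; rewrite in_itv /= => tA.
by rewrite -Fx_rate.
Qed.

(** Fubini in the time and the parameter, with the inner time integral supplied by
    [wave_factor_integral]. *)
Lemma wave_moment_integral :
  wave_moment A = (\int[mu]_(t in `[0%R, A]) wave_rate t)%R.
Proof.
have iF := integrableS measurableT mA (@subsetT _ _) int_Fx.
have mF := measurable_int _ iF.
transitivity (fine (\int[mu]_(t in `[0%R, A]) Fx t)%E); last first.
  rewrite /Rintegral; congr fine; apply: ae_eq_integral => //.
    exact: (measurable_int _ wave_rate_integrable).
  have := integrable_ae mA iF; apply: filterS => t fin tA.
  have ft := fin tA; move: tA; rewrite /= in_itv /= => tA.
  by rewrite Fx_rate// fineK.
have -> : (\int[mu]_(t in `[0%R, A]) Fx t = \int[mu]_t Fx t)%E.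
  rewrite integral_mkcond; apply: eq_integral => t _; rewrite patchE.
  case: ifPn => // tA; rewrite /Fx; apply/esym.
  rewrite (@eq_integral _ _ _ _ _ (fun=> 0%E)); first by rewrite integral0.
  by move=> s _; rewrite /f /= indicE (negbTE tA) mul0r.
rewrite -[X in fine X]/(\int[mu]_t fubini_F mu (EFin \o f) t)%E.
rewrite integral12_prod_meas1// -integral21_prod_meas1// /wave_moment /Rintegral; congr fine.
rewrite [LHS]integral_mkcond; apply: eq_integral => s _.
rewrite patchE /fubini_G /= (@inner (fun u => u)); last by left.
by rewrite indicE; case: ifP => _; rewrite ?mul1r ?mul0r// mulrC.
Qed.

End fixed_horizon.

Lemma wave_moment_ae_derivable (A : R) : {ae mu, forall t, 0 < t < A -> derivable wave_moment t 1}.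
Proof.
have [A0|A0] := ltP A 0.
  by apply: aeW => t /andP[h1 h2]; have := lt_trans h1 (lt_trans h2 A0); rewrite ltxx.
have mA : measurable (`[0, A]%classic : set (measurableTypeR R)) by exact: measurable_itv.
(* The cut-off makes the rate integrable on the whole line, as the Lebesgue differentiation theorem
   is applied there; before time [A] the primitives agree. *)
pose f := wave_rate \_ `[0, A]%classic.
have iT : mu.-integrable setT (EFin \o f).
  have := (integrable_mkcond _ mA).1 (wave_rate_integrable A0).
  apply: eq_integrable => // t _; rewrite /= /f !patchE.
  by case: ifP.
have int y : mu.-integrable `[0%R, y]%classic (EFin \o f).
  have my : measurable (`[0, y]%classic : set (measurableTypeR R)) by exact: measurable_itv.
  exact: integrableS measurableT my (@subsetT _ _) iT.
have loc : locally_integrable [set: R] f.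
  by apply: open_integrable_locally => //; exact: openT.
have := @FTC1 R f (BLeft 0) int loc.
apply: filterS; first exact: (ae_filter_ringOfSetsType mu).
move=> t H /andP[t0 tA].
have [|D _] := H; first by rewrite ?bnd_simp ?lte_fin ?ltW.
apply: near_eq_derivable D; near=> u.
have u0 : 0 < u by near: u; exact: lt_nbhsr.
have uA : u < A by near: u; exact: lt_nbhsl.
rewrite (@wave_moment_integral u (ltW u0)); apply: eq_Rintegral => s /set_mem /=.
rewrite in_itv /= => /andP[s0 su]; rewrite /f patchE mem_set//= in_itv /= s0 /=.
by apply: ltW; exact: le_lt_trans su uA.
Unshelve. all: by end_near. Qed.

(** A countable union of exceptional sets, one for each integer horizon. *)
Lemma wave_ae : {ae mu, forall t, 0 < t ->
  mu.-integrable I (EFin \o (fun s => wave_factor c (q s) t * g s)) /\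
  derivable wave_moment t 1}.
Proof.
have H1 (n : nat) := wave_factor_ae_integrable (ler0n R n).
have H2 (n : nat) := wave_moment_ae_derivable n%:R.
apply: filterS2 (ae_foralln H1) (ae_foralln H2) => t h1 h2 t0.
have tn : t < (Num.trunc t).+1%:R by exact: truncnS_gt.
split; first by apply: (h1 (Num.trunc t).+1); rewrite ltW//= ltW.
by apply: (h2 (Num.trunc t).+1); rewrite t0.
Qed.

End time_derivative.

(** * The Lyapunov boundary and its double layer *)

Section curve_data.
Context {R : realType}.
Implicit Types (gamma : R -> R * R).

Lemma is_derive_components gamma s : derivable gamma s 1 ->
  is_derive s (1 : R) (fun t => (gamma t).1) (derive1 gamma s).1 /\
  is_derive s (1 : R) (fun t => (gamma t).2) (derive1 gamma s).2.
Proof.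
move=> dg; have cl := dg; rewrite /derivable in cl.
have E : derive1 gamma s = 'D_1 gamma s by rewrite derive1E.
have cv : h^-1 *: ((gamma \o shift s) (h *: (1 : R)) - gamma s) @[h --> 0^'] --> derive1 gamma s.
  by rewrite E.
have c1 : h^-1 *: ((gamma ((h *: (1 : R)) + s)).1 - (gamma s).1) @[h --> 0^']
    --> (derive1 gamma s).1.
  exact: (cvg_comp _ _ cv cvg_fst).
have c2 : h^-1 *: ((gamma ((h *: (1 : R)) + s)).2 - (gamma s).2) @[h --> 0^']
    --> (derive1 gamma s).2.
  exact: (cvg_comp _ _ cv cvg_snd).
split; apply: DeriveDef.
- by apply/cvg_ex; exists (derive1 gamma s).1.
- exact: (cvg_lim (@Rhausdorff R) c1).
- by apply/cvg_ex; exists (derive1 gamma s).2.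
- exact: (cvg_lim (@Rhausdorff R) c2).
Qed.

Lemma enorm_ge (u : R * R) : `|u.1| <= enorm u /\ `|u.2| <= enorm u.
Proof.
rewrite /enorm /dotp -!expr2; split; rewrite -sqrtr_sqr ler_wsqrtr//.
  by rewrite lerDl sqr_ge0.
by rewrite lerDr sqr_ge0.
Qed.

Lemma enorm_sqr (u : R * R) : enorm u ^+ 2 = u.1 ^+ 2 + u.2 ^+ 2.
Proof. by rewrite /enorm sqr_sqrtr /dotp -!expr2// addr_ge0 ?sqr_ge0. Qed.

Lemma edist_sqr (x y : R * R) : Defs.edist x y ^+ 2 = sqdist x y.
Proof. by rewrite /Defs.edist enorm_sqr /sqdist /=; ring. Qed.

Lemma edist_ge0 (x y : R * R) : 0 <= Defs.edist x y.
Proof. exact: sqrtr_ge0. Qed.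

Lemma edistE (x y : R * R) : Defs.edist x y = Num.sqrt (sqdist x y).
Proof. by rewrite -edist_sqr sqrtr_sqr ger0_norm// edist_ge0. Qed.

Lemma holder_continuous (f : R -> R) (K al : R) : 0 < al ->
  (forall s s', `|f s - f s'| <= K * `|s - s'| `^ al) -> continuous f.
Proof.
move=> al0 Hf s; apply/cvgrPdist_lt => e e0.
have K1 : 0 < `|K| + 1 by rewrite ltr_wpDl.
have eK : 0 < e / (`|K| + 1) by rewrite divr_gt0.
(* [d] solves [(|K| + 1) d^al = e]; the added 1 covers [K = 0]. *)
pose d := (e / (`|K| + 1)) `^ al^-1.
have d0 : 0 < d by rewrite powR_gt0.
apply/nbhs_ballP; exists d => //= u; rewrite /ball /= => su.
apply: (le_lt_trans (Hf s u)).
have p1 : `|s - u| `^ al < e / (`|K| + 1).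
  have -> : e / (`|K| + 1) = d `^ al.
    by rewrite /d -powRrM mulVf ?gt_eqF// powRr1// ltW.
  by apply: gt0_ltr_powR; rewrite ?nnegrE//; exact: ltW.
apply: (@le_lt_trans _ _ (`|K| * `|s - u| `^ al)).
  by rewrite ler_wpM2r ?powR_ge0// ler_norm.
apply: (@le_lt_trans _ _ (`|K| * (e / (`|K| + 1)))).
  by rewrite ler_wpM2l// ltW.
by rewrite mulrCA -ltr_pdivlMl// mulVf ?gt_eqF// ltr_pdivrMr// mul1r ltrDl.
Qed.

(** Both parameters are reduced to [[0, L[], where they coincide. Their difference is thus an
    integer multiple of [L], and it is less than [L] in size. *)
Lemma simple_closed_injective gamma (L : R) : 0 < L ->
  (forall s, gamma (s + L) = gamma s) -> {in `[0, L[ &, injective gamma} ->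
  forall s s', `|s - s'| < L -> gamma s = gamma s' -> s = s'.
Proof.
move=> L0 per inj s s' ss E.
have gk (k : int) t : gamma (t + k%:~R * L) = gamma t.
  have gn (n : nat) u : gamma (u + n%:R * L) = gamma u.
    elim: n u => [|n IH] u; first by rewrite mul0r addr0.
    by rewrite -natr1 mulrDl mul1r addrA per.
  case: (intP k) => [|n|n].
  - by rewrite mul0r addr0.
  - exact: gn.
  - by rewrite mulrNz mulNr -[in RHS](subrK (n.+1%:R * L) t) gn.
have red t : exists k : int, (t + k%:~R * L) \in `[0, L[.
  exists (- Num.floor (t / L)).
  have f1 : (Num.floor (t / L))%:~R <= t / L by exact: floor_le.
  have f2 : t / L < (Num.floor (t / L))%:~R + 1.
    by have := floorD1_gt (t / L); rewrite intrD.
  move: f1 f2; rewrite ler_pdivlMr// ltr_pdivrMr// mulrDl mul1r => f1 f2.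
  by rewrite in_itv /= mulrNz mulNr; apply/andP; split; lra.
have [k kI] := red s; have [k' k'I] := red s'.
have eq := inj _ _ kI k'I; rewrite !gk in eq; have {}eq := eq E.
have sk : s - s' = (k' - k)%:~R * L.
  rewrite intrB mulrBl; apply/eqP; rewrite subr_eq addrAC addrC.
  by rewrite -(inj_eq (addIr (k%:~R * L))) eq; apply/eqP; ring.
have : `|(k' - k)%:~R : R| < 1.
  by rewrite -(ltr_pM2r L0) mul1r -[X in _ * X](gtr0_norm L0) -normrM -sk.
rewrite -intr_norm -[X in _ < X]/(1%:~R) ltr_int => kk.
have k0 : k' - k = 0.
  by apply/eqP; rewrite -normr_eq0; case: (`|k' - k|) kk (normr_ge0 (k' - k)) => [[|n]|n].
by apply/eqP; rewrite -subr_eq0 sk k0 mul0r.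
Qed.

Section boundary.
Variables (L : R) (gamma : R -> R * R) (Sm : set (R * R)) (n : R * R -> R * R).
Hypothesis hS : lyapunov_curve L gamma.
Hypothesis hSm : domain_bounded_by Sm (curve_set gamma).
Hypothesis hn : external_unit_normal gamma Sm n.

Lemma lyapunov_smooth_boundary : smooth_boundary L
  (fun s => (gamma s).1) (fun s => (gamma s).2)
  (fun s => (derive1 gamma s).1) (fun s => (derive1 gamma s).2)
  (fun s => (n (gamma s)).1) (fun s => (n (gamma s)).2) Sm.
Proof.
case: hS => L0 per inj dg [K [al [al0 al1 Hol]]].
case: hSm => oS _ bS clS; rewrite ((interior_id Sm).1 oS) in clS.
split => //.
- by move=> s; rewrite per.
- by move=> s; have [] := is_derive_components (dg s).1.
- by move=> s; have [] := is_derive_components (dg s).1.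
- apply: (holder_continuous al0 (K := K)) => s s'.
  by apply: (le_trans _ (Hol s s')); have [] := enorm_ge (derive1 gamma s - derive1 gamma s').
- apply: (holder_continuous al0 (K := K)) => s s'.
  by apply: (le_trans _ (Hol s s')); have [] := enorm_ge (derive1 gamma s - derive1 gamma s').
- by move=> s; rewrite -enorm_sqr (dg s).2 expr1n.
- move=> s s' ss E1 E2; apply: (simple_closed_injective L0 per inj ss).
  by rewrite [LHS]surjective_pairing E1 E2 -surjective_pairing.
- by move=> s; rewrite -enorm_sqr; have [-> _ _] := hn s; rewrite expr1n.
- by move=> s; have [_ + _] := hn s.
- by move=> s; rewrite per.
- by move=> s; have [_ _ +] := hn s.
- move=> s; rewrite -surjective_pairing.
  have : (closure Sm `\` Sm) (gamma s) by rewrite clS; exists s.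
  by [].
- move=> y cy nSy; have : (closure Sm `\` Sm) y by [].
  rewrite clS => -[s _ <-]; exists s; exact: surjective_pairing.
(* Boundedness gives [|y| <= N] for every [N > M]; it is used for [M + 1], and one more unit makes
   the bounds on the coordinates strict. *)
- have [M [Mr HM]] := bS; exists (M + 2) => y Sy.
  have : `|y| <= M + 1 by apply: HM => //; rewrite ltrDl.
  have -> : `|y| = Num.max `|y.1| `|y.2| by [].
  rewrite ge_max => /andP[? ?]; split; lra.
Qed.

Local Notation dip := (dipole (fun s => (gamma s).1) (fun s => (gamma s).2)
  (fun s => (n (gamma s)).1) (fun s => (n (gamma s)).2)).

Lemma lyapunov_dipole_integrable x :
  (@lebesgue_measure R).-integrable `[0, L] (EFin \o dip x).
Proof.
case: hS => _ _ _ _ [K [al [al0 al1 Hol]]].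
have H s s' : enorm (derive1 gamma s - derive1 gamma s') <= `|K| * `|s - s'| `^ al.
  by apply: (le_trans (Hol s s')); rewrite ler_wpM2r ?powR_ge0// ler_norm.
apply: (dipole_integrable lyapunov_smooth_boundary al0 al1 (normr_ge0 K)) => s s';
  by apply: (le_trans _ (H s s')); have [] := enorm_ge (derive1 gamma s - derive1 gamma s').
Qed.

Lemma lyapunov_total_dipole x : (\int[@lebesgue_measure R]_(s in `[0%R, L]) dip x s)%R =
  2 * pi * domain_char Sm (curve_set gamma) x.
Proof.
have sb := lyapunov_smooth_boundary; have intg := @lyapunov_dipole_integrable x.
rewrite /domain_char; case: ifPn => [/set_mem Sx|/negP nSx].
  by rewrite mulr1; exact: (total_dipole_inside sb intg Sx).
have {}nSx : ~ Sm x by move=> /mem_set.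
case: ifPn => [/set_mem[s _ E]|/negP nx].
  rewrite mulrAC divff ?pnatr_eq0// mul1r.
  by apply: (total_dipole_on sb intg (s := s)); rewrite -E -surjective_pairing.
rewrite mulr0; apply: (total_dipole_outside sb intg) => cx.
by have [s E] := sb_bd sb cx nSx; apply/nx/mem_set; exists s; rewrite // E -surjective_pairing.
Qed.

End boundary.

End curve_data.

(** * The double layer, the volume term and their sum *)

Section layer_potential.
Context {R : realType}.
Local Notation mu := (@lebesgue_measure R).

(** A bridge between the half-open period, which counts each point of the curve once, and the closed
    one of the calculus; they differ by a null set. *)
Lemma integrable_itvco_cc (a b : R) (f : R -> R) : measurable_fun setT f ->
  mu.-integrable `[a, b[%classic (EFin \o f) <-> mu.-integrable `[a, b]%classic (EFin \o f).
Proof.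
move=> mf.
have mo : measurable (`[a, b[%classic : set (measurableTypeR R)) by exact: measurable_itv.
have mc : measurable (`[a, b]%classic : set (measurableTypeR R)) by exact: measurable_itv.
split; last first.
  apply: integrableS => // s /=; rewrite !in_itv /= => /andP[-> sb]; exact: ltW.
move=> /integrableP[_ fin]; apply/integrableP; split.
  by apply/measurable_EFinP; exact: measurable_funTS.
rewrite -integral_itv_bndo_bndc//.
apply: measurable_funTS; apply: measurableT_comp => //.
exact/measurable_EFinP.
Qed.

(** Restricted to the line through y along [v], the function is a composition of one-variable
    functions, differentiable because y differs from x. *)
Lemma derive_log_dist (x y v : R * R) : 0 < sqdist x y ->
  'D_v (fun z => ln (Defs.edist x z)^-1) y =
  - ((y.1 - x.1) * v.1 + (y.2 - x.2) * v.2) / sqdist x y.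
Proof.
move=> q0.
pose w (h : R) := sqdist x (y.1 + h * v.1, y.2 + h * v.2).
pose F h := ln (Num.sqrt (w h))^-1.
have w0 : w 0 = sqdist x y by rewrite /w !mul0r !addr0 -surjective_pairing.
have Dl u k : is_derive (0 : R) (1 : R) (fun h => u + h * k) k.
  have D := is_derive1_add (is_derive1_cst u (0 : R))
    (is_derive1_mul (is_derive1_id (0 : R)) (is_derive1_cst k (0 : R))).
  by apply: (is_derive1_eq D); ring.
have Dw : is_derive (0 : R) (1 : R) w (2 * ((y.1 - x.1) * v.1 + (y.2 - x.2) * v.2)).
  have D k u : is_derive (0 : R) (1 : R) (fun h => (u + h * k - 0) ^+ 2) (2 * u * k).
    apply: (is_derive1_eq (is_derive1_pow2 (is_derive1_sub (Dl u k) (is_derive1_cst 0 (0 : R))))).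
    by rewrite mul0r; ring.
  have E : w = (fun h => ((y.2 - x.2) + h * v.2 - 0) ^+ 2 + ((y.1 - x.1) + h * v.1 - 0) ^+ 2).
    by apply/funext => h; rewrite /w /sqdist /=; ring.
  by rewrite E; apply: (is_derive1_eq (is_derive1_add (D _ _) (D _ _))); ring.
have sp : 0 < Num.sqrt (w 0) by rewrite w0 sqrtr_gt0.
have DF : is_derive (0 : R) (1 : R) F (- ((y.1 - x.1) * v.1 + (y.2 - x.2) * v.2) / sqdist x y).
  have wp : 0 < w 0 by rewrite w0.
  have i0 : 0 < (Num.sqrt (w 0))^-1 by rewrite invr_gt0.
  have Ds := is_derive1_compose (is_derive1_sqrt wp) Dw.
  have Di := @is_derive1_inv _ (fun h => Num.sqrt (w h)) _ _ (lt0r_neq0 sp) Ds.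
  have Dln := @is_derive1_compose _ (@ln R) (fun h => (Num.sqrt (w h))^-1) _ _ _
    (is_derive1_ln i0) Di.
  apply: (is_derive1_eq Dln).
  have E : sqdist x y = Num.sqrt (w 0) ^+ 2 by rewrite sqr_sqrtr ?w0// ltW.
  by rewrite E invrK; field; rewrite gt_eqF.
rewrite -[RHS](@derive_val _ _ _ _ _ _ _ DF) /derive; congr (lim (_ @[h --> 0^'])).
apply/funext => h; rewrite /F /w /= !edistE !mul0r !addr0.
rewrite -[h%:A]/(h * 1) mulr1 -surjective_pairing; congr (_ *: (ln (Num.sqrt (sqdist x _))^-1 - _)).
by rewrite [LHS]surjective_pairing /= [_ + y.1]addrC [_ + y.2]addrC.
Qed.

Section boundary.
Variables (c L : R) (gamma : R -> R * R) (Sm : set (R * R)) (n : R * R -> R * R).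
Hypothesis c0 : 0 < c.
Hypothesis hS : lyapunov_curve L gamma.
Hypothesis hSm : domain_bounded_by Sm (curve_set gamma).
Hypothesis hn : external_unit_normal gamma Sm n.
Variable x : R * R.

Let q s := sqdist x (gamma s).
Let g := dipole (fun s => (gamma s).1) (fun s => (gamma s).2)
  (fun s => (n (gamma s)).1) (fun s => (n (gamma s)).2) x.

Let sb := lyapunov_smooth_boundary hS hSm hn.

Let cq : continuous q.
Proof.
have := continuous_curve_sqdist sb (x := x).
by under eq_fun do rewrite -surjective_pairing.
Qed.

Let mg : measurable_fun setT g.
Proof. exact: (measurable_dipole sb). Qed.

Let intg : mu.-integrable `[0, L]%classic (EFin \o g).
Proof. exact: lyapunov_dipole_integrable hS hSm hn x. Qed.

Let q0 s : 0 <= q s. Proof. exact: sqdist_ge0. Qed.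

Let g_eq0 s : q s = 0 -> g s = 0.
Proof.
by move=> qs; rewrite /g /dipole -surjective_pairing -/(q s) qs invr0 mulr0.
Qed.

(** [1 / sqrt (1 - (r / c t)^2)] is [c t / sqrt (c^2 t^2 - q)], that is [wave_factor] divided by
    [c]; the minus sign is the one in [g]. *)
Lemma layer_kernel_dipole t s : 0 < t -> 0 < q s ->
  layer_kernel c n x t (gamma s) = - c^-1 * (wave_factor c (q s) t * g s).
Proof.
move=> t0 qs; rewrite /layer_kernel derive_log_dist// expr_div_n edist_sqr -/(q s).
have ct : 0 < c * t by rewrite mulr_gt0.
have -> : 1 - q s / (c * t) ^+ 2 = (c ^+ 2 * t ^+ 2 - q s) / (c * t) ^+ 2.
  by field; rewrite !gt_eqF.
rewrite [X in Num.sqrt X]mulrC sqrtrM ?invr_ge0 ?sqr_ge0// sqrtrV ?sqr_ge0// sqrtr_sqr gtr0_norm//.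
have -> : g s = ((gamma s).1 - x.1) * (n (gamma s)).1 / q s +
    ((gamma s).2 - x.2) * (n (gamma s)).2 / q s.
  by rewrite /g /dipole /dipole_num -surjective_pairing -/(q s) mulrDl.
rewrite /wave_factor invfM invrK.
set S := (Num.sqrt _)^-1; set Q := (q s)^-1.
by rewrite /Q; field; rewrite !gt_eqF.
Qed.

Let far (e s : R) : R := if e <= Defs.edist x (gamma s) then 1 else 0.

Let measurable_far e : measurable_fun setT (far e).
Proof.
have m1 : measurable_fun setT (fun s => Num.sqrt (q s)).
  apply: continuous_measurable_fun => s.
  by apply: (@continuous_comp _ _ _ q Num.sqrt); [exact: cq|exact: sqrt_continuous].
apply: measurable_fun_ifT => //.
by apply: measurable_fun_ler => //; under eq_fun do rewrite edistE; exact: m1.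
Qed.

Let edist_gt0 e s : 0 < e -> e <= Defs.edist x (gamma s) -> 0 < q s.
Proof. by move=> e0 ed; rewrite /q -edist_sqr exprn_gt0// (lt_le_trans e0). Qed.

(** Where [r >= c t] the wave factor is already 0, so that of the two conditions on the arc only the
    puncture has to be kept. *)
Lemma layer_kernel_punctured t e : 0 < t -> 0 < e ->
  (layer_kernel c n x t \o gamma) \_ (gamma @^-1` punctured x (disc c x t) e) =
  fun s => - c^-1 * (far e s * (wave_factor c (q s) t * g s)).
Proof.
move=> t0 e0; apply/funext => s; rewrite patchE /far; case: ifPn => [/set_mem [_ ed]|].
  by rewrite [e <= _]ed mul1r /= layer_kernel_dipole// (edist_gt0 e0).
move=> /negP sE; case: ifPn => ed; last by rewrite mul0r mulr0.
have [dc|dc] := ltP (Defs.edist x (gamma s)) (c * t); first by case: sE; apply/mem_set.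
rewrite mul1r /wave_factor ler0_sqrtr ?invr0 ?mulr0 ?mul0r ?mulr0//.
rewrite subr_le0 -exprMn /q -edist_sqr lerXn2r ?nnegrE ?edist_ge0//.
by rewrite mulr_ge0// ltW.
Qed.

Let Io : set (measurableTypeR R) := `[0, L[%classic.
Let mIo : measurable Io. Proof. exact: measurable_itv. Qed.
Let Ic : set (measurableTypeR R) := `[0, L]%classic.
Let mIc : measurable Ic. Proof. exact: measurable_itv. Qed.

Let V t s := wave_factor c (q s) t * g s.

Let mV t : measurable_fun setT (V t).
Proof. by apply: measurable_funM => //; exact: measurable_wave_factor_curve. Qed.

Let mfV t e : measurable_fun setT (fun s => far e s * V t s).
Proof. exact: measurable_funM. Qed.

Let measurable_punctured t e :
  measurable (gamma @^-1` punctured x (disc c x t) e : set (measurableTypeR R)).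
Proof.
have mr : measurable_fun setT (fun s => Defs.edist x (gamma s)).
  under eq_fun do rewrite edistE; apply: continuous_measurable_fun => s.
  by apply: (@continuous_comp _ _ _ q Num.sqrt); [exact: cq|exact: sqrt_continuous].
rewrite [X in measurable X](_ : _ =
  (setT `&` (fun s => Defs.edist x (gamma s)) @^-1` `]-oo, c * t[) `&`
  (setT `&` (fun s => Defs.edist x (gamma s)) @^-1` `[e, +oo[)).
  by apply: measurableI; apply: mr => //; exact: measurable_itv.
by apply/seteqP; split => s; rewrite /= !in_itv /= ?andbT => -[? ?]; [split|split; tauto].
Qed.

Lemma layer_arc_integrable t e : 0 < t -> 0 < e ->
  arc_integrable L gamma (punctured x (disc c x t) e) (layer_kernel c n x t) <->
  mu.-integrable Ic (EFin \o (fun s => far e s * V t s)).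
Proof.
move=> t0 e0; apply: iff_trans (integrable_itvco_cc 0 L (mfV t e)).
apply: (iff_trans (integrable_restrict mu (measurable_punctured t e) mIo
  (EFin \o (layer_kernel c n x t \o gamma)))).
rewrite restrict_EFin layer_kernel_punctured//.
split => i.
  have := integrableZl mIo (- c) i; apply: eq_integrable => // s _ /=.
  rewrite -EFinM; congr EFin; rewrite /V.
  set w := wave_factor _ _ _ * _; set f := far e s. by field; rewrite gt_eqF.
by have := integrableZl mIo (- c^-1) i; apply: eq_integrable.
Qed.

Lemma layer_arc_integral t e : 0 < t -> 0 < e ->
  mu.-integrable Ic (EFin \o (fun s => far e s * V t s)) ->
  arc_integral L gamma (punctured x (disc c x t) e) (layer_kernel c n x t) =
  - c^-1 * (\int[mu]_(s in `[0%R, L]) (far e s * V t s))%R.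
Proof.
move=> t0 e0 i.
rewrite /arc_integral /arc Rintegral_mkcondr.
rewrite (layer_kernel_punctured t0 e0) -Rintegral_itv_bndo_bndc; last exact/integrable_itvco_cc.
by rewrite RintegralZl//; apply/integrable_itvco_cc => //; exact: mfV.
Qed.

(** The integrand can be singular at x and near [r = c t]. A single puncture of radius below
    [c t / 2] separates the two: outside it integrability is given, and inside the wave factor is at
    most [2 c], which leaves the integrable [g]. *)
Lemma layer_pv_integrable t : 0 < t ->
  pv_convergent L gamma x (disc c x t) (layer_kernel c n x t) ->
  mu.-integrable Ic (EFin \o V t).
Proof.
move=> t0 [near _]; have ct : 0 < c * t by rewrite mulr_gt0.
have : \forall e \near 0^'+, 0 < e /\ e < c * t / 2 /\
    arc_integrable L gamma (punctured x (disc c x t) e) (layer_kernel c n x t).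
  near=> e; split; first by near: e; exact: nbhs_right_gt.
  split; last by near: e.
  by near: e; apply: nbhs_right_lt; rewrite divr_gt0.
move=> /filter_ex [e [e0 [ec /(layer_arc_integrable t0 e0) ie]]].
have ig : mu.-integrable Ic (EFin \o (fun s => 2 * c * `|g s|)).
  by have := integrableZl mIc (2 * c) (integrable_abse intg); apply: eq_integrable.
have ii := integrableD mIc (integrable_abse ie) ig.
apply: (le_integrable mIc _ _ ii).
  by apply/measurable_EFinP; exact: measurable_funTS (mV t).
move=> s _ /=; rewrite lee_fin; apply: (le_trans _ (ler_norm _)).
rewrite /far; case: ifPn => [_|]; first by rewrite mul1r lerDl !mulr_ge0// ltW.
rewrite -ltNge => ed; rewrite mul0r normr0 add0r /V normrM ler_wpM2r//.
(* For [r <= c t / 2] the phase is at least three quarters of [c^2 t^2]; a quarter suffices, and its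
   root [c t / 2] yields the constant [2 c]. *)
have qs : c ^+ 2 * t ^+ 2 / 4 <= c ^+ 2 * t ^+ 2 - q s.
  have : q s <= (c * t / 2) ^+ 2.
    rewrite /q -edist_sqr lerXn2r ?nnegrE ?edist_ge0//.
      by apply: (le_trans (ltW e0)); exact: ltW.
    by apply: ltW; exact: lt_trans ed ec.
  by rewrite (_ : (c * t / 2) ^+ 2 = c ^+ 2 * t ^+ 2 / 4); [have := q0 s => ? ?; lra|field].
have h : c * t / 2 <= Num.sqrt (c ^+ 2 * t ^+ 2 - q s).
  have ct2 : 0 <= c * t / 2 by rewrite divr_ge0 ?ltW.
  rewrite -(ger0_norm ct2) -sqrtr_sqr ler_wsqrtr//.
  by have -> : (c * t / 2) ^+ 2 = c ^+ 2 * t ^+ 2 / 4 by field.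
have h0 : 0 < c * t / 2 by rewrite divr_gt0.
rewrite (ger0_norm (wave_factor_ge0 c (q s) (ltW t0))) /wave_factor.
rewrite ler_pdivrMr; last exact: lt_le_trans h.
have -> : c ^+ 2 * t = 2 * c * (c * t / 2) by field.
by rewrite ler_pM2l// mulr_gt0.
Unshelve. all: by end_near. Qed.

(** Once the whole integrand is integrable it dominates the punctured ones, so that the principal
    value is an ordinary integral. *)
Lemma layer_pv t : 0 < t -> mu.-integrable Ic (EFin \o V t) ->
  pv_convergent L gamma x (disc c x t) (layer_kernel c n x t) /\
  double_layer c L gamma n x t = - c^-1 * wave_rate c L q g t.
Proof.
move=> t0 iV.
have ie e : mu.-integrable Ic (EFin \o (fun s => far e s * V t s)).
  apply: (le_integrable mIc _ _ iV).
    by apply/measurable_EFinP; exact: measurable_funTS (mfV t e).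
  move=> s _ /=; rewrite lee_fin normrM ler_piMl//.
  by rewrite /far; case: ifP => _; rewrite ?normr1 ?normr0.
have cI : arc_integral L gamma (punctured x (disc c x t) e) (layer_kernel c n x t)
    @[e --> 0^'+] --> - c^-1 * wave_rate c L q g t.
  apply/cvg_at_rightP => u [u0 cu].
  under eq_fun do rewrite layer_arc_integral//.
  apply: cvgM; first exact: cvg_cst.
  apply: (@Rdominated_cvg _ _ R mu Ic (fun n s => far (u n) s * V t s) (V t)
    (fun s => `|V t s|)) => //.
  - by move=> k; exact: measurable_funTS (mfV t (u k)).
  - exact: measurable_funTS (mV t).
  - apply: aeW => s _.
    have [qs|qs] := eqVneq (q s) 0.
      rewrite /V (g_eq0 qs) mulr0; under eq_fun do rewrite mulr0; exact: cvg_cst.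
    have r0 : 0 < Defs.edist x (gamma s).
      by rewrite edistE sqrtr_gt0 lt0r q0 qs.
    apply: cvg_near_cst; near=> k; rewrite /far ifT ?mul1r//.
    by apply: ltW; near: k; exact: (cvgr_lt _ cu _ r0).
  - exact: integrable_abse iV.
  - move=> k s _; rewrite normrM ler_piMl//.
    by rewrite /far; case: ifP => _; rewrite ?normr1 ?normr0.
split; last exact: (cvg_lim (@Rhausdorff R) cI).
split; last by apply/cvg_ex; eexists; exact: cI.
by near=> e; apply/layer_arc_integrable.
Unshelve. all: by end_near. Qed.

Lemma disc_nonpos t : t <= 0 -> disc c x t = set0.
Proof.
move=> t0; apply/seteqP; split => // y; rewrite /disc /= => h.
have : Defs.edist x y < 0 by apply: (lt_le_trans h); rewrite pmulr_rle0.
by rewrite ltNge edist_ge0.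
Qed.

Lemma layer_pv_nonpos t : t <= 0 ->
  pv_convergent L gamma x (disc c x t) (layer_kernel c n x t) /\
  double_layer c L gamma n x t = 0.
Proof.
move=> t0; rewrite /double_layer /pv_convergent /pv_integral disc_nonpos//.
have E e : Defs.arc L gamma (punctured x set0 e) = set0.
  by rewrite /Defs.arc /punctured set0I preimage_set0 setI0.
have -> : arc_integral L gamma (punctured x set0 e) (layer_kernel c n x t) @[e --> 0^'+] =
    (0 : R) @[e --> (0 : R)^'+].
  by under eq_fun do rewrite /arc_integral E Rintegral_set0.
split; last exact: lim_cst.
split; last exact: is_cvg_cst.
by near=> e; rewrite /arc_integrable E; exact: integrable_set0.
Unshelve. all: by end_near. Qed.

Lemma wave_volume_nonpos t : t <= 0 -> wave_volume c Sm x t = 0.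
Proof. by move=> t0; rewrite /wave_volume disc_nonpos// setI0 Rintegral_set0. Qed.

Let total := (\int[mu]_(s in `[0%R, L]) g s)%R.

(** This is [volume_formula] for [tau = c^2 t^2]. The density vanishes off the disc by convention,
    so the integral may be taken over all of [Sm]. *)
Lemma wave_volume_pos t : 0 < t ->
  wave_volume c Sm x t = c * t * total - wave_moment c L q g t.
Proof.
move=> t0; rewrite /wave_volume Rintegral_mkcondr.
have ct : 0 < c * t by rewrite mulr_gt0.
have tau0 : 0 <= c ^+ 2 * t ^+ 2 by rewrite -exprMn sqr_ge0.
rewrite (_ : _ \_ (disc c x t) = fun y => (Num.sqrt (c ^+ 2 * t ^+ 2 - sqdist x y))^-1).
  rewrite (volume_formula sb intg tau0) -exprMn sqrtr_sqr gtr0_norm//.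
  have i1 : mu.-integrable Ic (EFin \o (fun s => c * t * g s)).
    by have := integrableZl mIc (c * t) intg; apply: eq_integrable.
  have i2 := wave_root_integrable c0 q0 cq mg intg (ltW t0).
  rewrite /total -RintegralZl// /wave_moment -RintegralB//.
  apply: eq_Rintegral => s _.
  by rewrite -surjective_pairing mulrBl -exprMn.
apply/funext => y; rewrite patchE; case: ifPn => [_|/negP yd]; first by rewrite edist_sqr.
rewrite ler0_sqrtr ?invr0// -exprMn -edist_sqr subr_le0 lerXn2r ?nnegrE ?edist_ge0 ?(ltW ct)//.
by rewrite leNgt; apply/negP => h; apply: yd; apply/mem_set.
Qed.

(** Time 0 is discarded as a null set, negative times are trivial because the disc is empty, and
    positive times are those of [wave_ae]. *)
Lemma lhs_defined_ae : {ae mu, forall t, lhs_defined c L gamma Sm n x t}.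
Proof.
have A0 : {ae mu, forall t : R, t != 0}.
  exists [set 0]; split; [exact: measurable_set1|exact: lebesgue_measure_set1|].
  by move=> t /= /negP; rewrite negbK => /eqP.
have A1 := wave_ae c0 q0 cq mg intg.
apply: filterS2 A0 A1; first exact: (ae_filter_ringOfSetsType mu).
move=> t tn0 H.
have [t0|t0] := ltP 0 t; last first.
  split; first by have [] := layer_pv_nonpos t0.
  have {}t0 : t < 0 by rewrite lt_neqAle tn0.
  apply: (@near_eq_derivable _ _ _ (cst 0)) => //.
  near=> u; rewrite wave_volume_nonpos//; apply: ltW; near: u; exact: lt_nbhsl.
have [iV dU] := H t0; split; first by have [] := layer_pv t0 iV.
apply: (@near_eq_derivable _ _ _ (fun t => c * t * total - wave_moment c L q g t)).
  near=> u; rewrite wave_volume_pos//; near: u; exact: lt_nbhsr.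
apply: derivableB => //.
Unshelve. all: by end_near. Qed.

(** The quotient [sqrt (c^2 t^2 - q) / t] is at most [c], and it is 0 once [c^2 t^2 <= q].
    Parameters with [q = 0] contribute nothing, since [g] is 0 there. *)
Lemma wave_moment_right_quotient (t_ : nat -> R) : (forall k, 0 < t_ k) ->
  t_ k @[k --> \oo] --> (0 : R) ->
  wave_moment c L q g (t_ k) / t_ k @[k --> \oo] --> (0 : R).
Proof.
move=> tp ct.
pose Q k s := (t_ k)^-1 * (Num.sqrt (c ^+ 2 * t_ k ^+ 2 - q s) * g s).
have mQ k : measurable_fun setT (Q k).
  apply: measurable_funM => //; apply: measurable_funM => //.
  apply: continuous_measurable_fun => s.
  apply: (@continuous_comp _ _ _ (fun s => c ^+ 2 * t_ k ^+ 2 - q s) Num.sqrt).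
    by apply: cvgB; [exact: cvg_cst|exact: cq].
  exact: sqrt_continuous.
have QE k : wave_moment c L q g (t_ k) / t_ k = (\int[mu]_(s in `[0%R, L]) Q k s)%R.
  by rewrite mulrC /wave_moment -RintegralZl//; exact: wave_root_integrable (ltW (tp k)).
under eq_fun do rewrite QE.
have Z : (\int[mu]_(s in `[0%R, L]) (cst 0 s : R))%R = 0 by rewrite Rintegral_cst ?mul0r.
suff : (\int[mu]_(s in `[0%R, L]) Q k s)%R @[k --> \oo] -->
    (\int[mu]_(s in `[0%R, L]) (cst 0 s : R))%R by rewrite Z.
apply: (@Rdominated_cvg _ _ R mu Ic Q (cst 0) (fun s => c * `|g s|)) => //.
- by move=> k; exact: measurable_funTS (mQ k).
- apply: aeW => s _; have [qs|qs] := eqVneq (q s) 0.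
    rewrite /Q (g_eq0 qs); under eq_fun do rewrite !mulr0; exact: cvg_cst.
  have qp : 0 < q s by rewrite lt0r q0 qs.
  have c2 : c ^+ 2 * t_ k ^+ 2 @[k --> \oo] --> c ^+ 2 * 0 ^+ 2.
    by apply: cvgM; [exact: cvg_cst|exact: cvgM].
  apply: cvg_near_cst; near=> k; rewrite /Q ler0_sqrtr ?mul0r ?mulr0//.
  rewrite subr_le0; apply: ltW; near: k; apply: (cvgr_lt _ c2).
  by rewrite expr0n mulr0.
- by have := integrableZl mIc c (integrable_abse intg); apply: eq_integrable.
- move=> k s _; rewrite /Q mulrA normrM ler_wpM2r// ger0_norm; last first.
    by rewrite mulr_ge0 ?sqrtr_ge0// invr_ge0 ltW.
  by rewrite mulrC ler_pdivrMr// wave_root_le// ltW.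
Unshelve. all: by end_near. Qed.

(** When the derivative is known to exist a single sequence determines it, so that one-sided
    information is enough. *)
Lemma derive_along (f : R -> R) t (t_ : nat -> R) l : derivable f t 1 ->
  (forall k, t_ k != t) -> t_ k @[k --> \oo] --> t ->
  (f t - f (t_ k)) / (t - t_ k) @[k --> \oo] --> l -> derive1 f t = l.
Proof.
move=> df tk ct cl.
have D : is_derive t (1 : R) f (derive1 f t).
  by apply: DeriveDef => //; rewrite derive1E.
have [G [GE cG Gt]] := (is_derive1_caratheodory _ _ _).1 D.
have c' : G (t_ k) @[k --> \oo] --> l.
  rewrite (_ : (fun k => G (t_ k)) = fun k => (f t - f (t_ k)) / (t - t_ k))//.
  apply/funext => k; have := GE (t_ k) => E.
  rewrite -[f t - _]opprB E -mulrN opprB mulfK// subr_eq0 eq_sym; exact: tk.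
have c'' : G (t_ k) @[k --> \oo] --> G t by exact: (continuous_cvg _ cG ct).
rewrite -Gt; exact: (cvg_unique (@Rhausdorff R) c'' c').
Qed.

Lemma kirchhoff_identity t : lhs_defined c L gamma Sm n x t ->
  - double_layer c L gamma n x t + c^-1 * derive1 (wave_volume c Sm x) t =
  total * heaviside t.
Proof.
move=> [pv dW]; have harm := @cvg_harmonic R.
have hp k : 0 < harmonic k :> R by exact: harmonic_gt0.
have [t0|t0|t0] := ltgtP t 0.
- have [_ ->] := layer_pv_nonpos (ltW t0).
  have -> : derive1 (wave_volume c Sm x) t = 0.
    apply: (derive_along (t_ := fun k => t - harmonic k)) => //.
    + by move=> k; rewrite lt_eqF// gtrBl; exact: hp.
    + have h : t - harmonic k @[k --> \oo] --> t - 0.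
        by apply: cvgB => //; exact: cvg_cst.
      by rewrite subr0 in h.
    + rewrite (_ : (fun k => _) = fun=> 0); first exact: cvg_cst.
      apply/funext => k; rewrite !wave_volume_nonpos ?subrr ?mul0r//; last exact: ltW.
      by have := hp k => ?; lra.
  by rewrite /heaviside lt_eqF// ltNge ltW//= oppr0 !mulr0 addr0.
- have iV := layer_pv_integrable t0 pv; have [_ ->] := layer_pv t0 iV.
  (* The factor [1 / 2] keeps the times positive, also for [k = 0], where [harmonic k] is 1. *)
  pose t_ (k : nat) := t - t / 2 * harmonic k.
  have tk k : 0 < t_ k < t.
    have h0 := hp k; have h1 : harmonic k <= 1 :> R by rewrite /harmonic invf_le1// ler1n.
    apply/andP; split; rewrite /t_; last by rewrite gtrBl mulr_gt0// divr_gt0.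
    have : t / 2 * harmonic k <= t / 2 by rewrite ler_piMr// divr_ge0// ltW.
    by lra.
  have ct : t_ k @[k --> \oo] --> t.
    have h : t - t / 2 * harmonic k @[k --> \oo] --> t - t / 2 * 0.
      by apply: cvgB; [exact: cvg_cst|apply: cvgM => //; exact: cvg_cst].
    by rewrite mulr0 subr0 in h.
  have -> : derive1 (wave_volume c Sm x) t = c * total - wave_rate c L q g t.
    apply: (derive_along (t_ := t_)) => //.
      by move=> k; have /andP[_ h] := tk k; rewrite lt_eqF.
    have := wave_moment_left_quotient c0 q0 cq mg intg t0 tk ct iV.
    move=> /(cvgB (cvg_cst (c * total))); apply: cvg_trans; apply: near_eq_cvg.
    apply: nearW => k; have /andP[h0 h1] := tk k.
    rewrite !wave_volume_pos//.
    change (c * total - (wave_moment c L q g t - wave_moment c L q g (t_ k)) / (t - t_ k) =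
      (c * t * total - wave_moment c L q g t -
        (c * t_ k * total - wave_moment c L q g (t_ k))) / (t - t_ k)).
    by field; rewrite subr_eq0 gt_eqF.
  by rewrite /heaviside gt_eqF// t0; field; rewrite gt_eqF.
- have t1 : t <= 0 by rewrite t0.
  have [_ ->] := layer_pv_nonpos t1; rewrite t0 in dW *.
  have W0 := wave_volume_nonpos (lexx 0).
  have D0 : derive1 (wave_volume c Sm x) 0 = 0.
    apply: (derive_along (t_ := fun k => - harmonic k)) => //.
    + by move=> k; rewrite lt_eqF// oppr_lt0; exact: hp.
    + have h : - harmonic k @[k --> \oo] --> (- 0 : R) by exact: cvgN.
      by rewrite oppr0 in h.
    + rewrite (_ : (fun k => _) = fun=> 0); first exact: cvg_cst.
      by apply/funext => k; rewrite W0 wave_volume_nonpos ?subrr ?mul0r ?oppr_le0//; exact: ltW.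
  have D1 : derive1 (wave_volume c Sm x) 0 = c * total.
    apply: (derive_along (t_ := harmonic)) => //.
    + by move=> k; rewrite gt_eqF//; exact: hp.
    + have := wave_moment_right_quotient (@harmonic_gt0 R) harm.
      move=> /(cvgB (cvg_cst (c * total))); rewrite subr0.
      apply: cvg_trans; apply: near_eq_cvg; apply: nearW => k.
      have h0 := hp k; rewrite W0 wave_volume_pos//.
      change (c * total - wave_moment c L q g (harmonic k) / harmonic k =
        (0 - (c * harmonic k * total - wave_moment c L q g (harmonic k))) / (0 - harmonic k)).
      by field; rewrite gt_eqF.
  have : c * total = 0 by rewrite -D1 D0.
  move/eqP; rewrite mulf_eq0 gt_eqF//= => /eqP ->.
  by rewrite D0 oppr0 mulr0 mul0r addr0.
Unshelve. all: by end_near. Qed.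

End boundary.
End layer_potential.

Unset Implicit Arguments.
Set Strict Implicit.
Set Printing Implicit Defensive.

Theorem lemma5p1 (R : realType) (c L : R) (gamma : R -> R * R)
    (Sm : set (R * R)) (n : R * R -> R * R)
    (hc : 0 < c)
    (hS : lyapunov_curve L gamma)
    (hSm : domain_bounded_by Sm (curve_set gamma))
    (hn : external_unit_normal gamma Sm n)
    (x : R * R) :
  {ae @lebesgue_measure R, forall t, lhs_defined c L gamma Sm n x t} /\
  (forall t : R, lhs_defined c L gamma Sm n x t ->
    - double_layer c L gamma n x t + c^-1 * derive1 (wave_volume c Sm x) t
    = 2 * pi * domain_char Sm (curve_set gamma) x * heaviside t).
Proof.
split; first exact: lhs_defined_ae hc hS hSm hn x.
move=> t /(kirchhoff_identity hc hS hSm hn) ->.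
by rewrite (lyapunov_total_dipole hS hSm hn).
Qed.
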